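(* Let $(\mathbb{L},\mu)$ be a random iterated function system on $\mathbb{R}^d$ (with index set $\Lambda$) which is non-extinguishing, i.e. $\int_\Lambda \mathcal{N}(\lambda)\,d\mu(\lambda)>1$, which satisfies the uniform open set condition, and all of whose maps $f_\lambda^i$ are similarities with contraction rates $c_\lambda^i$ satisfying $c_{\min}\le c_\lambda^i\le c_{\max}$ for all $\lambda\in\Lambda\setminus\{0\}$, $1\le i\le\mathcal{N}(\lambda)$, for some constants $0<c_{\min}\le c_{\max}<1$. Let $\mathbb{P}$ be the random recursive measure on the space $\mathcal{T}$ of labelled trees and let $F_\tau$ be the random set associated with $\tau\in\mathcal{T}$. Then the Assouad spectrum of $F_\tau$ is constant and coincides with the box-counting dimension: for all $\theta\in(0,1)$ and $\mathbb{P}$-almost every $\tau\in\mathcal{T}$, $$\dim_B F_\tau=\dim_A^\theta F_\tau .$$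
   Context: **Random iterated function systems.** Let $\Lambda\subset\mathbb{R}^k$ be compact (for some $k$) and let $\mu$ be a Borel probability measure on $\Lambda$. Fix $\mathcal{N}\in\mathbb{N}$. For each $\lambda\in\Lambda$ there is a finite iterated function system (IFS) $\mathbb{I}_\lambda=\{f_\lambda^1,\dots,f_\lambda^{\mathcal{N}(\lambda)}\}$ of maps $f_\lambda^i:\mathbb{R}^d\to\mathbb{R}^d$, with $\mathcal{N}(\lambda)\le\mathcal{N}$. If $0\in\Lambda$, then $0$ is an isolated point of $\Lambda$ and $\mathbb{I}_0=\varnothing$ (so $\mathcal{N}(0)=0$); for all $\lambda\in\Lambda\setminus\{0\}$ one has $\mathcal{N}(\lambda)\ge1$. The map $\lambda\mapsto\mathcal{N}(\lambda)$ and the dependence of $f_\lambda^i$ on $\lambda$ are Borel measurable. Put $\mathbb{L}=\{\mathbb{I}_\lambda\}_{\lambda\in\Lambda}$; the pair $(\mathbb{L},\mu)$ is a random iterated function system (RIFS). A similarity with contraction rate $c$ is a map $f$ with $\|f(x)-f(y)\|=c\|x-y\|$ for all $x,y$ (Euclidean norm). **Uniform open set condition (UOSC).** There exists a non-empty bounded open set $\mathcal{O}\subset\mathbb{R}^d$ such that for all $\lambda\in\Lambda\setminus\{0\}$ and all $1\le i,j\le\mathcal{N}(\lambda)$: $f_\lambda^i(\mathcal{O})\subseteq\mathcal{O}$, and $f_\lambda^i(\mathcal{O})\cap f_\lambda^j(\mathcal{O})\ne\varnothing$ implies $i=j$. **Labelled trees and the measure $\mathbb{P}$.** Let $\mathfrak{T}=\bigcup_{k\ge0}\{1,\dots,\mathcal{N}\}^k$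 be the set of nodes of the rooted $\mathcal{N}$-ary tree (the root is the empty tuple). Let $\mathcal{T}=\Lambda^{\mathfrak{T}}$ be the set of labellings $\tau:\mathfrak{T}\to\Lambda$, and let $\mathbb{P}$ be the product measure $\mu^{\otimes\mathfrak{T}}$, i.e. the labels $\tau(v)$, $v\in\mathfrak{T}$, are independent with law $\mu$. **Random recursive set.** For $\tau\in\mathcal{T}$, a node $v=(v_1,\dots,v_k)$ is called admissible if $v_{j+1}\le\mathcal{N}(\tau((v_1,\dots,v_j)))$ for all $0\le j<k$; for admissible $v$ put $$f_v=f_{\tau(\text{root})}^{v_1}\circ f_{\tau((v_1))}^{v_2}\circ\cdots\circ f_{\tau((v_1,\dots,v_{k-1}))}^{v_k}.$$ Then $F_\tau=\bigcap_{k=1}^\infty\ \bigcup_{v\text{ admissible of level }k} f_v(\Delta)$, where $\Delta\subset\mathbb{R}^d$ is a non-empty compact set with $f_\lambda^i(\Delta)\subseteq\Delta$ for all $\lambda\in\Lambda$, $1\le i\le\mathcal{N}(\lambda)$ (e.g. the closure of $\mathcal{O}$); $F_\tau$ is compact (possibly empty) and does not depend on the choice of $\Delta$. **Assouad spectrum and box dimension.** For a totally bounded metric space $F$, $|F|$ denotes its diameter; $N_r(X)$ is the minimal number of sets of diameter at most $r$ needed to cover $X$; $N_{r,R}(F)=\max_{x\in F}N_r(B(x,R)\cap F)$, with $B(x,R)$ the open ball. For $\theta\in(0,1)$, $$\dim_A^\theta F=\inf\{\alpha\ge 0\mid \exists C>0,\ \forall\, r,R>0 \text{ with } r^\theta=R\le|F|:\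 N_{r,R}(F)\le C(R/r)^\alpha\}.$$ $\dim_B F=\lim_{r\to0}\log N_r(F)/\log(1/r)$ is the box-counting dimension (the common value of the upper and lower box-counting dimensions). All dimensions of the empty set are taken to be $0$. *)

(* Defs.v *)
From HB Require Import structures.
From mathcomp Require Import all_boot all_order all_algebra.
From mathcomp Require Import all_classical all_reals all_analysis.

Set Implicit Arguments.
Unset Strict Implicit.
Unset Printing Implicit Defensive.

Import Order.TTheory GRing.Theory Num.Theory.
Import numFieldNormedType.Exports.

Local Open Scope classical_set_scope.
Local Open Scope ring_scope.

(* The library's norm on ['rV[R]_d] is the sup norm: its topology and its
   bounded sets are the Euclidean ones, but similarities, balls and diameters
   have to be taken with respect to [enorm]. *)
Definition enorm (R : realType) (d : nat) (x : 'rV[R]_d) : R :=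
  Num.sqrt (\sum_(i < d) x 0 i ^+ 2).

Definition eball (R : realType) (d : nat) (x : 'rV[R]_d) (rho : R) :
    set 'rV[R]_d :=
  [set y | enorm (y - x) < rho].

Definition similarity (R : realType) (d : nat) (c : R)
    (f : 'rV[R]_d -> 'rV[R]_d) : Prop :=
  forall x y, enorm (f x - f y) = c * enorm (x - y).

(* The outer maximum gives the empty set diameter 0 instead of -oo. *)
Definition ediam (R : realType) (d : nat) (X : set 'rV[R]_d) : \bar R :=
  maxe 0%E (ereal_sup [set (enorm (x - y))%:E | x in X & y in X]).

(* N_r(X); the value is +oo when there is no finite cover. *)
Definition covering_number (R : realType) (d : nat) (r : R)
    (X : set 'rV[R]_d) : \bar R :=
  ereal_inf [set n%:R%:E | n in [set n : nat |
    exists U : 'I_n -> set 'rV[R]_d,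
      X `<=` \bigcup_i U i /\ forall i, (ediam (U i) <= r%:E)%E]].

(* N_{r,R}(F), with [rho] for the outer radius R; the supremum is a maximum
   as soon as F is nonempty and totally bounded. *)
Definition local_covering_number (R : realType) (d : nat) (r rho : R)
    (F : set 'rV[R]_d) : \bar R :=
  ereal_sup [set covering_number r (eball x rho `&` F) | x in F].

(* For F = set0 the diameter condition is never met, so the value is 0. *)
Definition assouad_spectrum (R : realType) (d : nat) (theta : R)
    (F : set 'rV[R]_d) : \bar R :=
  ereal_inf [set alpha%:E | alpha in [set alpha : R | 0 <= alpha /\
    exists2 C : R, 0 < C & forall r rho : R, 0 < r -> 0 < rho ->
      r `^ theta = rho -> (rho%:E <= ediam F)%E ->
      (local_covering_number r rho F <= (C * (rho / r) `^ alpha)%:E)%E]].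

(* The box-counting dimension of F exists and equals s. *)
Definition is_box_dim (R : realType) (d : nat) (F : set 'rV[R]_d)
    (s : \bar R) : Prop :=
  (F = set0 -> s = 0%E) /\
  (F !=set0 ->
   (lne (covering_number r F) * ((ln r^-1)^-1)%:E)%E @[r --> 0^'+] --> s).

(* [measurableType]s are pointed in the library, so the subspace on a set A
   gets an (irrelevant) base point from a proof that A is nonempty. *)
Definition subspace_of (T : topologicalType) (A : set T) (A0 : A !=set0) :
    Type :=
  set_type A.

Section subspace_of_instances.
Context (T : topologicalType) (A : set T) (A0 : A !=set0).

HB.instance Definition _ := Topological.copy (subspace_of A0) (set_type A).

HB.instance Definition _ := isPointed.Build (subspace_of A0)
  (exist _ (projT1 (cid A0)) (mem_set (projT2 (cid A0)))).

End subspace_of_instances.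

Definition borel (T : ptopologicalType) := g_sigma_algebraType (@open T).

Definition index_space (R : realType) (k : nat) (A : set 'rV[R]_k)
    (A0 : A !=set0) :=
  borel (subspace_of A0).

Definition index_val (R : realType) (k : nat) (A : set 'rV[R]_k)
    (A0 : A !=set0) (l : index_space A0) : 'rV[R]_k :=
  sval (l : set_type A).

(* The maps of the IFS of index l are the [rifs_map l i] with [i < nmaps l]
   (numbered from 0); the other values of [rifs_map] are irrelevant. *)
Record rifs (R : realType) (k d : nat) := Rifs {
  index : set 'rV[R]_k;
  index_compact : compact index;
  index_neq0 : index !=set0;
  law : probability (index_space index_neq0) R;
  maxmaps : nat;
  nmaps : index_space index_neq0 -> nat;
  rifs_map : index_space index_neq0 -> 'I_maxmaps -> 'rV[R]_d -> 'rV[R]_d;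
  nmaps_le : forall l, (nmaps l <= maxmaps)%N;
  index0_isolated : index 0 -> isolated index 0;
  nmaps_eq0 : forall l, index_val l = 0 -> nmaps l = 0%N;
  nmaps_gt0 : forall l, index_val l <> 0 -> (0 < nmaps l)%N;
  nmaps_measurable : measurable_fun setT nmaps;
  rifs_map_measurable : forall (i : 'I_maxmaps) (x : 'rV[R]_d),
    measurable_fun [set l | (i < nmaps l)%N]
      (fun l => rifs_map l i x : borel 'rV[R]_d)
}.

Section random_recursive_set.
Context (R : realType) (k d : nat) (L : rifs R k d).

Definition label : measurableType _ := index_space (index_neq0 L).

Definition non_extinguishing : Prop :=
  (1 < \int[law L]_l (nmaps l)%:R%:E)%E.

Definition uosc : Prop :=
  exists O : set 'rV[R]_d,
    [/\ O !=set0, bounded_set O, open O &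
      forall l : label, index_val l <> 0 ->
      forall i j : 'I_(maxmaps L), (i < nmaps l)%N -> (j < nmaps l)%N ->
        rifs_map l i @` O `<=` O /\
        ((rifs_map l i @` O) `&` (rifs_map l j @` O) !=set0 -> i = j)].

Definition node : Type := seq 'I_(maxmaps L).

Definition cylinders : set (set (node -> label)) :=
  [set C | exists (v : node) (B : set label),
    measurable B /\ C = [set tau | B (tau v)]].

Definition labelling := g_sigma_algebraType cylinders.

(* This characterises the product measure uniquely: the finite-dimensional
   cylinders are stable under intersection and generate the sigma-algebra. *)
Definition is_product_law (P : probability labelling R) : Prop :=
  forall (s : seq node) (B : node -> set label),
    uniq s -> (forall v, measurable (B v)) ->
    P [set tau | forall v, v \in s -> B v (tau v)] =
      (\prod_(v <- s) law L (B v))%E.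

Definition admissible (tau : labelling) (v : node) : Prop :=
  forall (u : node) (i : 'I_(maxmaps L)),
    prefix (rcons u i) v -> (i < nmaps (tau u))%N.

(* The composition along v of the maps met from the node u on, i.e.
   f_{tau(u)}^{v_1} \o f_{tau(u v_1)}^{v_2} \o ... *)
Fixpoint node_map_from (tau : labelling) (u v : node) :
    'rV[R]_d -> 'rV[R]_d :=
  if v is i :: w then rifs_map (tau u) i \o node_map_from tau (rcons u i) w
  else id.

Definition node_map (tau : labelling) (v : node) : 'rV[R]_d -> 'rV[R]_d :=
  node_map_from tau [::] v.

Definition trapping (Delta : set 'rV[R]_d) : Prop :=
  [/\ Delta !=set0, compact Delta &
    forall (l : label) (i : 'I_(maxmaps L)), (i < nmaps l)%N ->
      rifs_map l i @` Delta `<=` Delta].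

Definition random_set (Delta : set 'rV[R]_d) (tau : labelling) :
    set 'rV[R]_d :=
  \bigcap_(n in [set n : nat | (1 <= n)%N])
    \bigcup_(v in [set v : node | size v = n /\ admissible tau v])
      (node_map tau v @` Delta).

End random_recursive_set.

(* Main.v *)
(* Let phi t be the mean of the sum of the c_i^t over the maps of a random IFS.
   It decreases strictly from above 1 to 0, and drops below 1 at an s > 0,
   which is shown to be the value of both dimensions.

   Upper bound.  For t > s the total weight X of a tree, i.e. the sum of the
   c_v^t over its admissible nodes v, has a finite exponential moment.  Hence
   almost surely X(tau_v) grows at most linearly in |v|, simultaneously for all
   nodes v.  The nodes where c_v first drops below rho form a cut, and by the
   open set condition only boundedly many of their pieces meet a given ball of
   radius rho; each such piece is covered by at most
   const * X(tau_v) * (rho / r)^t sets of diameter r.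

   Lower bound.  For t < s keep each edge of the tree independently with
   probability c_i^t, and let V(tau) be the conditional probability that the
   root is joined to infinity.  Since phi t > 1, V is positive with positive
   probability, and by a zero-one argument for the generating function of the
   offspring number it is positive on almost every infinite tree.  A union bound
   over a cut at scale r shows that at least V(tau) * r^-t of its nodes carry a
   nonempty piece of the attractor, and a set of diameter r meets boundedly many
   of these pieces.

   Finally, covering by balls of radius rho = r^theta and then covering each
   ball at scale r shows that the Assouad spectrum is at least s. *)

From HB Require Import structures.
Require Import Defs.
From mathcomp Require Import all_boot all_order all_algebra.
From mathcomp Require Import all_classical all_reals all_analysis.
From mathcomp Require Import measurable_realfun.
From mathcomp Require Import ring lra.
Set Implicit Arguments.
Unset Strict Implicit.
Unset Printing Implicit Defensive.
Import Order.TTheory GRing.Theory Num.Theory.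
Import numFieldNormedType.Exports.

Local Open Scope classical_set_scope.
Local Open Scope ring_scope.

(** * Elementary estimates and bounded integrands *)

(** Independence enters only through [branching]: replacing one subtree by an independent copy
    preserves the law, so expectations obey recursions over the children of the root, without
    filtrations or conditional expectations. Nothing is asserted at the critical exponent itself;
    every estimate concerns one fixed exponent on one side of s, so that countably many null sets
    suffice. The obstacle is uniformity. The spectrum takes a maximum over all balls of radius rho,
    and the cut at scale rho may have as many nodes as a power of 1/rho, so the worst subtree
    decides. The exponential moment makes its weight at most linear in |v|, that is, in log (1/rho).
    Since rho = r^theta with theta < 1, log (1/rho) and log (rho/r) are comparable, and an
    arbitrarily small increase of the exponent absorbs this linear factor. The comparison
    degenerates as theta tends to 1. *)

Lemma ge0_integral_law (R : realType) d1 d2 (X : measurableType d1)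
    (Y : measurableType d2) (m : {measure set X -> \bar R})
    (m' : {measure set Y -> \bar R}) (f : X -> Y) (g : Y -> \bar R) :
  measurable_fun [set: X] f ->
  (forall A, measurable A -> m (f @^-1` A) = m' A) ->
  measurable_fun [set: Y] g -> (forall y, 0 <= g y)%E ->
  (\int[m]_x g (f x) = \int[m']_y g y)%E.
Proof.
move=> mf mE mg g0.
transitivity (\int[pushforward m f]_y g y)%E.
  by rewrite ge0_integral_pushforward.
have pm : isMeasurableFun _ _ _ _ f := isMeasurableFun.Build _ _ _ _ _ mf.
pose F : {mfun X >-> Y} := HB.pack f pm.
rewrite -[f]/(F : _ -> _).
by apply: eq_measure_integral => A mA _; exact: mE.
Qed.

Lemma expR_convex_le (R : realType) (p x : R) : 0 <= p <= 1 ->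
  expR (p * x) <= 1 - p + p * expR x.
Proof.
move=> /andP[p0 p1].
(* both endpoints lie above the tangent line of exp at [p * x] *)
have tangent y : expR (p * x) * (1 + (y - p * x)) <= expR y.
  have -> : expR y = expR (p * x) * expR (y - p * x).
    by rewrite -expRD addrC subrK.
  rewrite ler_pM2l ?expR_gt0 //.
  exact: expR_ge1Dx.
have h0 := tangent 0; have h1 := tangent x; rewrite expR0 in h0.
have := lerD (ler_wpM2l p0 h1) (ler_wpM2l (_ : 0 <= 1 - p) h0).
rewrite subr_ge0 p1 => /(_ isT) h; lra.
Qed.

(** A second-order expansion whose error constant depends only on the number of factors. It is
    applied near 0 on both sides: with [x > 0] to exponential moments and with [x < 0] to
    percolation. *)
Lemma prod_expansion (R : realDomainType) (I : Type) (s : seq I) (p : I -> R) (x : R) :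
  (forall i, 0 <= p i <= 1) -> `|x| <= 1 ->
  `|\prod_(i <- s) (1 + p i * x) - (1 + x * \sum_(i <- s) p i)|
    <= 2 ^+ size s * x ^+ 2.
Proof.
move=> p01 x1.
have px i : `|p i * x| <= `|x|.
  have /andP[p0 p1] := p01 i.
  by rewrite normrM ger0_norm // ler_piMl.
have prod_le s' : `|\prod_(i <- s') (1 + p i * x)| <= 2 ^+ size s'.
  elim: s' => [|i s' IH]; first by rewrite big_nil normr1.
  rewrite big_cons normrM exprS ler_pM // (le_trans (ler_normD _ _)) //.
  by rewrite normr1 lerD2l (le_trans (px _)).
have prod1_le s' : `|\prod_(i <- s') (1 + p i * x) - 1| <= (2 ^+ size s' - 1) * `|x|.
  elim: s' => [|i s' IH]; first by rewrite big_nil expr0 !subrr normr0 mul0r.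
  rewrite big_cons mulrDl mul1r addrAC (le_trans (ler_normD _ _)) //.
  rewrite normrM exprS.
  have := ler_pM (normr_ge0 _) (normr_ge0 _) (px i) (prod_le s').
  rewrite /=; set u := `|p i * x| * _; lra.
elim: s => [|i s IH].
  by rewrite !big_nil mulr0 addr0 subrr normr0 mulr_ge0 // sqr_ge0.
rewrite !big_cons /= (exprS 2).
set A := \prod_(j <- s) _ in IH *; set S := \sum_(j <- s) _ in IH *.
have -> : (1 + p i * x) * A - (1 + x * (p i + S)) =
  (A - (1 + x * S)) + (p i * x) * (A - 1) by ring.
rewrite (le_trans (ler_normD _ _)) // normrM.
have := ler_pM (normr_ge0 _) (normr_ge0 _) (px i) (prod1_le s).
have -> : `|x| * ((2 ^+ size s - 1) * `|x|) = (2 ^+ size s - 1) * x ^+ 2.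
  by rewrite -[in RHS](real_normK (num_real x)); ring.
rewrite -/A; have := sqr_ge0 x; move: IH.
move: (_ ^+ size s) (`|p i * x| * _) (x ^+ 2) `|_| => b u y z; lra.
Qed.

Section bounded_measurable.
Context (R : realType) (d : measure_display) (T : measurableType d).

(** A class closed under sums and products whose members are integrable for every probability, so
    this one predicate discharges the side conditions of linearity and monotonicity of the real
    integral. *)
Definition bounded_measurable (f : T -> R) :=
  measurable_fun setT f /\ exists M : R, forall t, `|f t| <= M.

Context (P : probability T R).

Lemma bounded_measurable_cst (a : R) : bounded_measurable (fun=> a).
Proof. by split; [exact: measurable_cst|exists `|a|]. Qed.

Lemma bounded_measurableD f g : bounded_measurable f -> bounded_measurable g ->
  bounded_measurable (fun t => f t + g t).
Proof.
move=> [mf [M hM]] [mg [M' hM']]; split; first exact: measurable_funD.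
by exists (M + M') => t; rewrite (le_trans (ler_normD _ _)) // lerD.
Qed.

Lemma bounded_measurableM f g : bounded_measurable f -> bounded_measurable g ->
  bounded_measurable (fun t => f t * g t).
Proof.
move=> [mf [M hM]] [mg [M' hM']]; split; first exact: measurable_funM.
by exists (M * M') => t; rewrite normrM ler_pM.
Qed.

Lemma bounded_measurableB f g : bounded_measurable f -> bounded_measurable g ->
  bounded_measurable (fun t => f t - g t).
Proof.
move=> [mf [M hM]] [mg [M' hM']]; split; first exact: measurable_funB.
by exists (M + M') => t; rewrite (le_trans (ler_normB _ _)) // lerD.
Qed.

Lemma bounded_measurable_sum (I : Type) (s : seq I) (F : I -> T -> R) :
  (forall i, bounded_measurable (F i)) ->
  bounded_measurable (fun t => \sum_(i <- s) F i t).
Proof.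
move=> bF; elim: s => [|i s IH].
  by under eq_fun do rewrite big_nil; exact: bounded_measurable_cst.
by under eq_fun do rewrite big_cons; exact: bounded_measurableD.
Qed.

Lemma bounded_measurable_prod (I : Type) (s : seq I) (F : I -> T -> R) :
  (forall i, bounded_measurable (F i)) ->
  bounded_measurable (fun t => \prod_(i <- s) F i t).
Proof.
move=> bF; elim: s => [|i s IH].
  by under eq_fun do rewrite big_nil; exact: bounded_measurable_cst.
by under eq_fun do rewrite big_cons; exact: bounded_measurableM.
Qed.

Lemma measurable_pos f : bounded_measurable f ->
  measurable [set t | 0 < f t].
Proof.
move=> [mf _]; have := mf measurableT _ (measurable_itv `]0, +oo[).
rewrite setTI; congr measurable.
by apply/seteqP; split => t /=; rewrite in_itv /= andbT.
Qed.

Lemma bounded_measurable_indic (A : set T) : measurable A ->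
  bounded_measurable (\1_A : T -> R).
Proof.
move=> mA; split; first exact: measurable_indic.
by exists 1 => t; rewrite indicE; case: (_ \in _); rewrite ?normr1 ?normr0.
Qed.

Lemma bounded_measurable_integrable f : bounded_measurable f ->
  P.-integrable setT (EFin \o f).
Proof.
move=> [mf [M hM]]; apply: measurable_bounded_integrable => //.
  by rewrite (le_lt_trans (probability_le1 _ _)) // ltry.
exists M; split; first exact: num_real.
by move=> x Mx t _; rewrite /= (le_trans (hM t)) // ltW.
Qed.

Lemma EFin_Rintegral f : bounded_measurable f ->
  (\int[P]_t (f t)%:E)%E = (\int[P]_t f t)%:E.
Proof.
move=> /bounded_measurable_integrable/(integrable_fin_num measurableT) h.
by rewrite /Rintegral fineK.
Qed.

Lemma Rintegral_prob_cst (a : R) : \int[P]_t a = a.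
Proof.
rewrite Rintegral_cst // -[RHS]mulr1; congr (_ * _).
by rewrite -[RHS]/(fine 1%E); congr fine; exact: probability_setT.
Qed.

Lemma le_Rintegral_bounded f g : bounded_measurable f -> bounded_measurable g ->
  (forall t, f t <= g t) -> \int[P]_t f t <= \int[P]_t g t.
Proof.
move=> bf bg fg; apply: le_Rintegral => //; exact: bounded_measurable_integrable.
Qed.

Lemma RintegralD_bounded f g : bounded_measurable f -> bounded_measurable g ->
  \int[P]_t (f t + g t) = \int[P]_t f t + \int[P]_t g t.
Proof.
by move=> bf bg; apply: RintegralD => //; exact: bounded_measurable_integrable.
Qed.

Lemma RintegralZl_bounded f (a : R) : bounded_measurable f ->
  \int[P]_t (a * f t) = a * \int[P]_t f t.
Proof.
by move=> bf; apply: RintegralZl => //; exact: bounded_measurable_integrable.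
Qed.

Lemma Rintegral_onem f : bounded_measurable f ->
  \int[P]_t (1 - f t) = 1 - \int[P]_t f t.
Proof.
move=> bf; have b1 := bounded_measurable_cst 1.
by rewrite RintegralB ?Rintegral_prob_cst //; exact: bounded_measurable_integrable.
Qed.

Lemma Rintegral_sum_bounded (I : Type) (s : seq I) (F : I -> T -> R) :
  (forall i, bounded_measurable (F i)) ->
  \int[P]_t (\sum_(i <- s) F i t) = \sum_(i <- s) \int[P]_t F i t.
Proof.
move=> bF; elim: s => [|i s IH].
  rewrite big_nil -[RHS](Rintegral_prob_cst 0).
  by apply: eq_Rintegral => t _; rewrite big_nil.
rewrite big_cons -IH -RintegralD_bounded //; last exact: bounded_measurable_sum.
by apply: eq_Rintegral => t _; rewrite big_cons.
Qed.

Lemma Rintegral_dist_le f g (e : R) : bounded_measurable f ->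
  bounded_measurable g -> (forall t, `|f t - g t| <= e) ->
  `|\int[P]_t f t - \int[P]_t g t| <= e.
Proof.
move=> bf bg fg; rewrite ler_distl.
have bc := bounded_measurable_cst.
have E (a : R) : \int[P]_t g t + a = \int[P]_t (g t + a).
  by rewrite RintegralD_bounded // Rintegral_prob_cst.
rewrite !E !le_Rintegral_bounded //; try exact: bounded_measurableD.
  by move=> t; have := fg t; rewrite ler_distl => /andP[].
by move=> t; have := fg t; rewrite ler_distl => /andP[].
Qed.

Lemma Rintegral_cvg_ge (f_ : nat -> T -> R) (f : T -> R) (M a : R) :
  (forall n, bounded_measurable (f_ n)) -> bounded_measurable f ->
  (forall n t, `|f_ n t| <= M) -> (forall t, f_ n t @[n --> \oo] --> f t) ->
  (forall n, a <= \int[P]_t f_ n t) -> a <= \int[P]_t f t.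
Proof.
move=> bf_ bf fM cf fa.
have [] := @dominated_convergence _ _ _ P setT measurableT
  (fun n t => (f_ n t)%:E) (fun t => (f t)%:E) (fun=> M%:E).
- by move=> n; apply/measurable_EFinP; case: (bf_ n).
- by apply/measurable_EFinP; case: bf.
- by apply: aeW => t _; apply: cvg_EFin; [exact: nearW|exact: cf].
- by apply: bounded_measurable_integrable; exact: bounded_measurable_cst.
- by apply: aeW => t n _; rewrite lee_fin.
move=> _ _ c; rewrite -lee_fin -EFin_Rintegral //.
rewrite -(cvg_lim (@ereal_hausdorff R) c); apply: lime_ge.
  by apply/cvg_ex; eexists; exact: c.
by apply: nearW => n; rewrite /= EFin_Rintegral // lee_fin.
Qed.

(** By monotone convergence the increasing limit has integral at most [B], hence is finite almost
    everywhere; its value is the bound [C]. *)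
Lemma Rintegral_bounded_seq (f : nat -> T -> R) (B : R) :
  (forall n, bounded_measurable (f n)) -> (forall n t, 0 <= f n t) ->
  (forall n t, f n t <= f n.+1 t) -> (forall n, \int[P]_t f n t <= B) ->
  {ae P, forall t, exists C : R, forall n, f n t <= C}.
Proof.
move=> bf f0 fS fB.
have nd t : nondecreasing_seq (fun n => (f n t)%:E).
  by apply/nondecreasing_seqP => n; rewrite lee_fin.
pose g t := limn (fun n => (f n t)%:E).
have cvgf t : cvgn (fun n => (f n t)%:E) by exact: ereal_nondecreasing_is_cvgn.
have mf n : measurable_fun setT (fun t => (f n t)%:E).
  by apply/measurable_EFinP; case: (bf n).
have g_ge n t : ((f n t)%:E <= g t)%E.
  rewrite /g (cvg_lim (@ereal_hausdorff R) (ereal_nondecreasing_cvgn (nd t))).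
  by apply: ereal_sup_ubound; exists n.
have mg : measurable_fun setT g.
  apply: (emeasurable_fun_cvg (fun n t => (f n t)%:E)) => // t _; exact: cvgf.
have g0 t : (0 <= g t)%E by rewrite (le_trans _ (g_ge 0%N t)) // lee_fin.
have gB : (\int[P]_t g t <= B%:E)%E.
  rewrite monotone_convergence //; last first.
  - by move=> n t _; rewrite lee_fin.
  apply: lime_le.
    apply: ereal_nondecreasing_is_cvgn => m n mn; apply: ge0_le_integral => //.
    - by move=> t _; rewrite lee_fin.
    - by move=> t _; exact: nd.
  by apply: nearW => n; rewrite EFin_Rintegral // lee_fin.
have ig : P.-integrable setT g.
  apply/integrableP; split => //.
  under eq_integral do rewrite gee0_abs //.
  by rewrite (le_lt_trans gB) // ltry.
apply: filterS (integrable_ae measurableT ig) => t /(_ Logic.I) gt.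
by exists (fine (g t)) => n; rewrite -lee_fin fineK.
Qed.

End bounded_measurable.

(** * Trees with independent subtrees *)

Section branching.
Context (R : realType) (d1 d2 : measure_display) (Lab : measurableType d1)
  (T : measurableType d2) (N : nat) (mu : probability Lab R)
  (P : probability T R) (root : T -> Lab) (shift : 'I_N -> T -> T)
  (graft : 'I_N -> T * T -> T).

(* [graft i (t, t')] is [t] with its i-th subtree replaced by [t']. *)
Record branching : Prop := Branching {
  branching_measurable_root : measurable_fun setT root;
  branching_measurable_shift : forall i, measurable_fun setT (shift i);
  branching_measurable_graft : forall i, measurable_fun setT (graft i);
  branching_law_root : forall B, measurable B -> P (root @^-1` B) = mu B;
  branching_law_graft : forall i A, measurable A ->
    (P \x P)%E (graft i @^-1` A) = P A;
  branching_root_graft : forall i x, root (graft i x) = root x.1;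
  branching_shift_graft : forall i x, shift i (graft i x) = x.2;
  branching_shift_graft_neq : forall i j x, j != i ->
    shift j (graft i x) = shift j x.1
}.

End branching.

Section product_formula.
Context (R : realType) (d1 d2 : measure_display) (Lab : measurableType d1)
  (T : measurableType d2) (N : nat) (mu : probability Lab R)
  (P : probability T R) (root : T -> Lab) (shift : 'I_N -> T -> T)
  (graft : 'I_N -> T * T -> T).
Context (br : branching mu P root shift graft).

Let mroot : measurable_fun setT root := branching_measurable_root br.
Let mshift i : measurable_fun setT (shift i) := branching_measurable_shift br i.
Let mgraft i : measurable_fun setT (graft i) := branching_measurable_graft br i.

Lemma integral_root (g : Lab -> \bar R) : measurable_fun setT g ->
  (forall l, 0 <= g l)%E ->
  (\int[P]_t g (root t) = \int[mu]_l g l)%E.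
Proof.
by move=> mg g0; apply: ge0_integral_law => //; exact: branching_law_root br.
Qed.

(** Resampling: [graft i] carries [P \x P] to [P], so by Tonelli the i-th subtree can be integrated
    out as an independent copy while the root label and the other subtrees stay fixed. *)
Lemma integral_graft i (g : T -> \bar R) : measurable_fun setT g ->
  (forall t, 0 <= g t)%E ->
  (\int[P]_t g t = \int[P]_t \int[P]_t' g (graft i (t, t')))%E.
Proof.
move=> mg g0.
rewrite -(@fubini_tonelli1 _ _ _ _ _ P P (fun x => g (graft i x))) //.
  apply/esym; apply: (ge0_integral_law (m := (P \x P)%E)) => //.
  exact: branching_law_graft br i.
by apply: measurableT_comp => //.
Qed.

Lemma integral_shift i (g : T -> \bar R) : measurable_fun setT g ->
  (forall t, 0 <= g t)%E ->
  (\int[P]_t g (shift i t) = \int[P]_t g t)%E.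
Proof.
move=> mg g0; rewrite (integral_graft i); last 2 first.
- exact: measurableT_comp.
- by [].
under eq_integral => t _.
  under eq_integral => t' _ do rewrite (branching_shift_graft br) /=.
  over.
by rewrite integral_cst // -[RHS]mule1; congr (_ * _)%E; exact: probability_setT.
Qed.

Lemma integral_affine (Y : T -> R) (m a b : R) :
  measurable_fun setT Y -> (forall t, 0 <= Y t) ->
  (\int[P]_t (Y t)%:E = m%:E)%E -> 0 <= a -> 0 <= b ->
  (\int[P]_t (a + b * Y t)%:E = (a + b * m)%:E)%E.
Proof.
move=> mY Y0 mE a0 b0.
under eq_integral do rewrite EFinD EFinM.
rewrite ge0_integralD //=; last 2 first.
- by move=> t _; rewrite -EFinM lee_fin mulr_ge0.
- by apply: emeasurable_funM => //; exact/measurable_EFinP.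
rewrite integral_cst // ge0_integralZl_EFin //; last 2 first.
- by move=> t _; rewrite lee_fin.
- exact/measurable_EFinP.
transitivity (a%:E * 1 + b%:E * m%:E)%E; last by rewrite mule1.
by congr (_ * _ + _ * _)%E => //; exact: probability_setT.
Qed.

(** The branching property: given the root label, the subtrees are independent copies of the whole
    tree. The affine factors fit all its uses, where [Y] is an exponential of the total weight, a
    failure probability of percolation, or the indicator of a complement. *)
Lemma integral_prod_subtrees (p : 'I_N -> Lab -> R) (Y : T -> R) (m : R) :
  (forall i, measurable_fun setT (p i)) -> (forall i l, 0 <= p i l <= 1) ->
  measurable_fun setT Y -> (forall t, 0 <= Y t) ->
  (\int[P]_t (Y t)%:E = m%:E)%E ->
  (\int[P]_t (\prod_(i < N) (1 - p i (root t) +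
     p i (root t) * Y (shift i t)))%:E =
   \int[mu]_l (\prod_(i < N) (1 - p i l + p i l * m))%:E)%E.
Proof.
move=> mp p01 mY Y0 mE.
have m0 : 0 <= m.
  by rewrite -lee_fin -mE integral_ge0 // => t _; rewrite lee_fin.
have p0 i l : 0 <= p i l by case/andP: (p01 i l).
have p1 i l : 0 <= 1 - p i l by rewrite subr_ge0; case/andP: (p01 i l).
have mroot' (h : Lab -> R) : measurable_fun setT h ->
    measurable_fun setT (fun t : T => h (root t)).
  by move=> mh; apply: measurableT_comp => //; exact: mroot.
pose A i l := 1 - p i l + p i l * m.
have A0 i l : 0 <= A i l by rewrite addr_ge0 // mulr_ge0.
have mA i : measurable_fun setT (A i).
  by apply: measurable_funD; [exact: measurable_funB|exact: measurable_funM].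
pose F i (t : T) :=
  1 - p i (root t) + p i (root t) * Y (shift i t).
have F0 i t : 0 <= F i t by rewrite addr_ge0 // mulr_ge0.
have mF i : measurable_fun setT (F i).
  apply: measurable_funD; first by apply: measurable_funB => //; exact: mroot'.
  apply: measurable_funM; first exact: mroot'.
  by apply: measurableT_comp => //; exact: mshift.
(* The subtrees are integrated out one at a time. A factor replaced by its mean depends on the root
   label only and is absorbed into [H]. *)
have key (s : seq 'I_N) (H : Lab -> R) : uniq s ->
    measurable_fun setT H -> (forall l, 0 <= H l) ->
    (\int[P]_t (H (root t) * \prod_(i <- s) F i t)%:E =
     \int[P]_t (H (root t) *
       \prod_(i <- s) A i (root t))%:E)%E.
  elim: s H => [|i s IHs] H /=; first by move=> *; apply: eq_integral => t _; rewrite !big_nil.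
  move=> /andP[nis us] mH H0.
  pose G t := H (root t) * \prod_(j <- s) F j t.
  have G0 t : 0 <= G t by rewrite mulr_ge0 // prodr_ge0.
  have mG : measurable_fun setT G.
    apply: measurable_funM; first exact: mroot'.
    exact: measurable_prod.
  transitivity (\int[P]_t (G t * F i t)%:E)%E.
    by apply: eq_integral => t _; rewrite big_cons /G; congr (_%:E); ring.
  rewrite (integral_graft i); last 2 first.
  - by apply/measurable_EFinP; exact: measurable_funM.
  - by move=> t; rewrite lee_fin mulr_ge0.
  transitivity (\int[P]_t ((H \* A i) (root t) *
      \prod_(j <- s) F j t)%:E)%E.
    apply: eq_integral => t _.
    (* As [i] is not in [s], [G] sees only the root and the other subtrees. *)
    have Ggraft t' : G (graft i (t, t')) = G t.
      rewrite /G (branching_root_graft br); congr (_ * _); rewrite big_seq_cond [RHS]big_seq_cond.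
      apply: eq_bigr => j /andP[js _]; rewrite /F (branching_shift_graft_neq br) //
        ?(branching_root_graft br) //.
      by apply: contraNneq nis => <-.
    under eq_integral => t' _.
      rewrite Ggraft /F (branching_shift_graft br) (branching_root_graft br).
      rewrite mulrDr mulrA.
      rewrite /=.
      over.
    rewrite (integral_affine mY Y0 mE); [|by rewrite mulr_ge0..].
    by congr (_%:E); rewrite /G /A /=; ring.
    etransitivity; [apply: (IHs (H \* A i)) => //|].
  - exact: measurable_funM.
  - by move=> l; rewrite mulr_ge0.
  - by apply: eq_integral => t _; rewrite big_cons; congr (_%:E) => /=; ring.
have := key (index_enum 'I_N) (cst 1) (index_enum_uniq _).
move=> /(_ (measurable_cst _) (fun=> ler01)).
under eq_integral do rewrite mul1r.
under [in RHS]eq_integral do rewrite mul1r.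
move=> ->.
rewrite -(integral_root (g := fun l => (\prod_(i < N) A i l)%:E)) //.
  by apply/measurable_EFinP; exact: measurable_prod.
by move=> l; rewrite lee_fin prodr_ge0.
Qed.

End product_formula.

(** * Total weight and percolation on a tree *)

Section galton_watson.
Context (R : realType) (Lab T : Type) (N : nat) (root : T -> Lab)
  (shift : 'I_N -> T -> T) (p : 'I_N -> Lab -> R).

(** Unfolded, this sums over all nodes of level below [n] the product of [p] along the path; the
    recursive form is the one to which the branching property applies. *)
Fixpoint total_weight (n : nat) (t : T) : R :=
  if n is m.+1 then
    1 + \sum_(i < N) p i (root t) * total_weight m (shift i t)
  else 0.

(* Conditional probability, given the tree, that the root is joined to
   level n when each edge is kept independently with probability [p]. *)
Fixpoint percolation (n : nat) (t : T) : R :=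
  if n is m.+1 then
    1 - \prod_(i < N) (1 - p i (root t) * percolation m (shift i t))
  else 1.

Context (p01 : forall i l, 0 <= p i l <= 1).

Lemma total_weight_ge0 n t : 0 <= total_weight n t.
Proof.
elim: n t => //= n IH t; rewrite addr_ge0 // sumr_ge0 // => i _.
by rewrite mulr_ge0 //; case/andP: (p01 i (root t)).
Qed.

Lemma total_weightS n t : total_weight n t <= total_weight n.+1 t.
Proof.
elim: n t => [|n IH] t; first exact: total_weight_ge0.
rewrite [leLHS]/= [leRHS]/= lerD2l ler_sum // => i _.
by rewrite ler_wpM2l //; case/andP: (p01 i (root t)).
Qed.

Lemma percolation01 n t : 0 <= percolation n t <= 1.
Proof.
elim: n t => [|n IH] t /=; first by rewrite ler01 lexx.
have h i : 0 <= 1 - p i (root t) * percolation n (shift i t) <= 1.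
  have /andP[a0 a1] := p01 i (root t); have /andP[b0 b1] := IH (shift i t).
  by rewrite subr_ge0 mulr_ile1 // gerBl mulr_ge0.
have h0 i (_ : true) := let: conj h _ := andP (h i) in h.
rewrite subr_ge0 gerBl prodr_ge0 // prodr_ile1 //.
Qed.

Lemma percolationS n t : percolation n.+1 t <= percolation n t.
Proof.
elim: n t => [|n IH] t; first by case/andP: (percolation01 1 t).
rewrite [leLHS]/= [leRHS]/= lerD2l lerN2 ler_prod // => i _.
have /andP[a0 a1] := p01 i (root t).
have /andP[b0 b1] := percolation01 n (shift i t).
rewrite subr_ge0 mulr_ile1 //= lerD2l lerN2 ler_wpM2l //; exact: IH.
Qed.

(** Union bound over the edges at the root. *)
Lemma percolation_le_sum n t : percolation n.+1 t <=
  \sum_(i < N) p i (root t) * percolation n (shift i t).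
Proof.
rewrite /= lerBlDr -lerBlDl.
have c01 i : 0 <= p i (root t) * percolation n (shift i t) <= 1.
  have /andP[a0 a1] := p01 i (root t).
  have /andP[b0 b1] := percolation01 n (shift i t).
  by rewrite mulr_ge0 // mulr_ile1.
elim: (index_enum _) => [|i s IH]; first by rewrite !big_nil subr0.
rewrite !big_cons.
have s0 : 0 <= \sum_(i <- s) p i (root t) * percolation n (shift i t).
  by apply: sumr_ge0 => j _; case/andP: (c01 j).
move: IH s0 (c01 i); move: (\sum_(_ <- _) _) (\prod_(_ <- _) _) (_ * _).
by move=> S Q c h S0 /andP[c0 c1]; nra.
Qed.

Lemma percolation_ge_child n i t :
  p i (root t) * percolation n (shift i t) <= percolation n.+1 t.
Proof.
rewrite /= lerBrDr -lerBrDl (bigD1 i) //= ler_piMr //.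
  have /andP[a0 a1] := p01 i (root t).
  have /andP[b0 b1] := percolation01 n (shift i t).
  by rewrite subr_ge0 mulr_ile1.
apply: prodr_ile1 => j _.
have /andP[a0 a1] := p01 j (root t).
have /andP[b0 b1] := percolation01 n (shift j t).
by rewrite subr_ge0 mulr_ile1 // gerBl mulr_ge0.
Qed.

End galton_watson.

Lemma percolation_le (R : realType) (Lab T : Type) (N : nat) (root : T -> Lab)
    (shift : 'I_N -> T -> T) (p q : 'I_N -> Lab -> R) n t :
  (forall i l, 0 <= p i l) -> (forall i l, p i l <= q i l) ->
  (forall i l, q i l <= 1) ->
  percolation root shift p n t <= percolation root shift q n t.
Proof.
move=> p0 pq q1.
have p01 i l : 0 <= p i l <= 1 by rewrite p0 (le_trans (pq i l)).
have q01 i l : 0 <= q i l <= 1 by rewrite q1 (le_trans (p0 i l)).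
elim: n t => [|n IH] t //=; rewrite lerD2l lerN2 ler_prod // => i _.
have /andP[a0 a1] := percolation01 root shift q01 n (shift i t).
have /andP[b0 b1] := percolation01 root shift p01 n (shift i t).
have /andP[c0 c1] := q01 i (root t).
by rewrite subr_ge0 mulr_ile1 //= lerD2l lerN2 ler_pM.
Qed.

(** With edge probabilities 0 and 1 nothing random remains once the tree is given: the value is the
    indicator that level [n] is reached. Survival of the tree thus obeys the same recursion as
    percolation. *)
Lemma percolation_bool (R : realType) (Lab T : Type) (N : nat) (root : T -> Lab)
    (shift : 'I_N -> T -> T) (b : 'I_N -> Lab -> bool) n t :
  percolation root shift (fun i l => (b i l)%:R : R) n t = 0 \/
  percolation root shift (fun i l => (b i l)%:R : R) n t = 1.
Proof.
elim: n t => [|n IH] t; first by right.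
have [[i h]|h] := pselect (exists i,
    (b i (root t))%:R * percolation root shift (fun i l => (b i l)%:R : R) n (shift i t) = 1).
  by right; rewrite /= (bigD1 i) //= h subrr mul0r subr0.
left; rewrite /= big1 ?subrr // => i _.
suff -> : (b i (root t))%:R *
    percolation root shift (fun i l => (b i l)%:R : R) n (shift i t) = 0.
  by rewrite subr0.
have [//|e] := IH (shift i t); first by move=> ->; rewrite mulr0.
case hb : (b i (root t)); last by rewrite mul0r.
by exfalso; apply: h; exists i; rewrite hb e mulr1.
Qed.

Section percolation_limit.
Context (R : realType) (Lab T : Type) (N : nat) (root : T -> Lab)
  (shift : 'I_N -> T -> T) (p : 'I_N -> Lab -> R)
  (p01 : forall i l, 0 <= p i l <= 1).

(** The V of the overview. The sequence decreases and is nonnegative under [p01], so [limn] is a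
    genuine limit. *)
Definition percolation_lim (t : T) : R :=
  limn (fun n => percolation root shift p n t).

Lemma percolation_nonincreasing t :
  nonincreasing_seq (fun n => percolation root shift p n t).
Proof. by apply/nonincreasing_seqP => n; exact: percolationS. Qed.

Lemma cvg_percolation t :
  percolation root shift p n t @[n --> \oo] --> percolation_lim t.
Proof.
apply: nonincreasing_is_cvgn; first exact: percolation_nonincreasing.
by exists 0 => _ [n _ <-]; case/andP: (percolation01 root shift p01 n t).
Qed.

Lemma percolation_lim_le n t : percolation_lim t <= percolation root shift p n t.
Proof.
apply: nonincreasing_cvgn_ge; first exact: percolation_nonincreasing.
exact: cvg_percolation.
Qed.

Lemma percolation_lim_ge (a : R) t :
  (forall n, a <= percolation root shift p n t) -> a <= percolation_lim t.
Proof.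
move=> h; apply: limr_ge; first exact: cvg_percolation.
exact: nearW.
Qed.

Lemma percolation_lim_ge0 t : 0 <= percolation_lim t.
Proof.
by apply: percolation_lim_ge => n; case/andP: (percolation01 root shift p01 n t).
Qed.

Lemma percolation_lim_le_sum t :
  percolation_lim t <= \sum_(i < N) p i (root t) * percolation_lim (shift i t).
Proof.
pose f n := \sum_(i < N) p i (root t) * percolation root shift p n (shift i t).
have cf : f n @[n --> \oo] -->
    \sum_(i < N) p i (root t) * percolation_lim (shift i t).
  apply: cvg_big => [|i _]; first exact: add_continuous.
  by apply: cvgM; [exact: cvg_cst|exact: cvg_percolation].
rewrite -(cvg_lim _ cf) //; apply: limr_ge; first by apply/cvg_ex; eexists; exact: cf.
by apply: nearW => n; rewrite (le_trans (percolation_lim_le n.+1 t)) //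
  percolation_le_sum.
Qed.

Lemma percolation_lim_ge_child i t :
  p i (root t) * percolation_lim (shift i t) <= percolation_lim t.
Proof.
apply: percolation_lim_ge => n; apply: le_trans (percolationS _ _ p01 _ _).
apply: le_trans (percolation_ge_child _ _ p01 _ i _).
by rewrite ler_wpM2l ?percolation_lim_le //; case/andP: (p01 i (root t)).
Qed.

End percolation_limit.

(** Quantitative concavity of [1 - (1 - z) ^+ m] in [z]. The difference [D m] increases with [m],
    vanishes at 0 and 1, and equals [x * y * (x - y)] at 2. The factor [m - 1], negative only for
    [m = 0], is chosen so that integration over the offspring number produces the mean minus 1. *)
Lemma onem_expr_concave (R : realDomainType) (x y : R) (m N : nat) :
  0 <= y -> y <= x -> x <= 1 -> (m <= N)%N ->
  x * y * (x - y) * (m%:R - 1) <=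
  N%:R * (x * (1 - (1 - y) ^+ m) - y * (1 - (1 - x) ^+ m)).
Proof.
move=> y0 yx x1 mN.
pose D m := x * (1 - (1 - y) ^+ m) - y * (1 - (1 - x) ^+ m).
have x0 : 0 <= x by rewrite (le_trans y0).
have DS k : D k <= D k.+1.
  rewrite -subr_ge0 (_ : _ - _ = x * y * ((1 - y) ^+ k - (1 - x) ^+ k)).
    rewrite mulr_ge0 ?mulr_ge0 // subr_ge0 lerXn2r ?nnegrE ?subr_ge0 //.
    - by rewrite (le_trans yx).
    - by rewrite lerD2l lerN2.
  by rewrite /D !exprS; ring.
have D2 : D 2%N = x * y * (x - y) by rewrite /D; ring.
have xy0 : 0 <= x * y * (x - y) by rewrite !mulr_ge0 // subr_ge0.
case: m mN => [|[|m]] mN.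
- rewrite !expr0 !subrr !mulr0 subr0 mulr0 sub0r mulrN1 oppr_le0 //.
- by rewrite subrr mulr0 !expr1 !subKr mulrC [y * x]mulrC subrr mul0r.
have Dm : x * y * (x - y) <= D m.+2.
  rewrite -D2; elim: m {mN} => // m IH; exact: le_trans IH (DS _).
rewrite mulrC ler_pM // ?subr_ge0 ?ler1n //.
by rewrite lerBlDr (le_trans (_ : _ <= N%:R)) ?ler_nat // lerDl.
Qed.

Lemma prod_onem_bool (R : pzRingType) (I : Type) (s : seq I) (b : pred I) (x : R) :
  \prod_(i <- s) (1 - (b i)%:R * x) = (1 - x) ^+ count b s.
Proof.
elim: s => [|i s IH]; first by rewrite big_nil.
rewrite big_cons /= IH; case: (b i); first by rewrite mul1r exprS.
by rewrite mul0r subr0 mul1r.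
Qed.

Lemma bounded_measurable_comp (R : realType) (d d' : measure_display)
    (X : measurableType d) (Y : measurableType d') (f : X -> Y) (g : Y -> R) :
  measurable_fun setT f -> bounded_measurable g ->
  bounded_measurable (fun x => g (f x)).
Proof.
move=> mf [mg [M hM]]; split; first exact: measurableT_comp.
by exists M.
Qed.

(** * Exponential moments, growth and survival of random trees *)

Section random_galton_watson.
Context (R : realType) (d1 d2 : measure_display) (Lab : measurableType d1)
  (T : measurableType d2) (N : nat) (mu : probability Lab R)
  (P : probability T R) (root : T -> Lab) (shift : 'I_N -> T -> T)
  (graft : 'I_N -> T * T -> T).
Context (br : branching mu P root shift graft).

Let mroot : measurable_fun setT root := branching_measurable_root br.
Let mshift i : measurable_fun setT (shift i) := branching_measurable_shift br i.

Lemma Rintegral_shift i (g : T -> R) : bounded_measurable g ->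
  (forall t, 0 <= g t) -> \int[P]_t g (shift i t) = \int[P]_t g t.
Proof.
move=> [mg _] g0; congr fine.
rewrite (integral_shift br i (g := fun t => (g t)%:E)) //.
exact/measurable_EFinP.
Qed.

Lemma Rintegral_prod_subtrees (p : 'I_N -> Lab -> R) (Y : T -> R) :
  (forall i, measurable_fun setT (p i)) -> (forall i l, 0 <= p i l <= 1) ->
  bounded_measurable Y -> (forall t, 0 <= Y t) ->
  \int[P]_t (\prod_(i < N) (1 - p i (root t) + p i (root t) * Y (shift i t))) =
  \int[mu]_l (\prod_(i < N) (1 - p i l + p i l * \int[P]_t Y t)).
Proof.
move=> mp p01 bY Y0; congr fine; apply: (integral_prod_subtrees br) => //.
  by case: bY.
exact: EFin_Rintegral.
Qed.

Section weights.
Context (p : 'I_N -> Lab -> R) (mp : forall i, measurable_fun setT (p i))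
  (p01 : forall i l, 0 <= p i l <= 1).

Let bp i : bounded_measurable (p i).
Proof.
split => //; exists 1 => l; have /andP[p0 p1] := p01 i l.
by rewrite ger0_norm.
Qed.

Let bproot i : bounded_measurable (fun t => p i (root t)).
Proof. by apply: bounded_measurable_comp. Qed.

Let bshift i (f : T -> R) : bounded_measurable f ->
  bounded_measurable (fun t => f (shift i t)).
Proof. by apply: bounded_measurable_comp. Qed.

Lemma bounded_measurable_total_weight n :
  bounded_measurable (total_weight root shift p n).
Proof.
elim: n => [|n IH]; first exact: bounded_measurable_cst.
apply: bounded_measurableD; first exact: bounded_measurable_cst.
apply: bounded_measurable_sum => i; apply: bounded_measurableM => //.
exact: bshift.
Qed.

Lemma bounded_measurable_percolation n :
  bounded_measurable (percolation root shift p n).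
Proof.
elim: n => [|n IH]; first exact: bounded_measurable_cst.
apply: bounded_measurableB; first exact: bounded_measurable_cst.
apply: bounded_measurable_prod => i; apply: bounded_measurableB.
  exact: bounded_measurable_cst.
by apply: bounded_measurableM => //; exact: bshift.
Qed.

Let phi := \int[mu]_l (\sum_(i < N) p i l).

Lemma Rintegral_prod_expansion (x : R) : `|x| <= 1 ->
  `|\int[mu]_l (\prod_(i < N) (1 + p i l * x)) - (1 + x * phi)|
    <= 2 ^+ N * x ^+ 2.
Proof.
move=> x1.
have bs : bounded_measurable (fun l => \sum_(i < N) p i l).
  exact: bounded_measurable_sum.
have bc (a : R) : bounded_measurable (fun=> a : R) by exact: bounded_measurable_cst.
have -> : 1 + x * phi = \int[mu]_l (1 + x * \sum_(i < N) p i l).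
  rewrite RintegralD_bounded //; last exact: bounded_measurableM.
  by rewrite Rintegral_prob_cst RintegralZl_bounded.
apply: Rintegral_dist_le.
- apply: bounded_measurable_prod => i; apply: bounded_measurableD => //.
  exact: bounded_measurableM.
- by apply: bounded_measurableD => //; exact: bounded_measurableM.
- move=> l; have := prod_expansion (index_enum 'I_N) (p01 ^~ l) x1.
  by rewrite [index_enum _]unlock -enumT size_enum_ord.
Qed.

Let phi_ge0 : 0 <= phi.
Proof.
by apply: Rintegral_ge0 => l _; apply: sumr_ge0 => i _; case/andP: (p01 i l).
Qed.

Local Notation X := (total_weight root shift p).
Local Notation V := (percolation root shift p).

Let bexpX u n : 0 <= u -> bounded_measurable (fun t => expR (u * X n t)).
Proof.
move=> u0; have [mX [M hM]] := bounded_measurable_total_weight n; split.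
  by apply: measurableT_comp => //; exact: measurable_funM.
exists (expR (u * M)) => t; rewrite ger0_norm ?expR_ge0 // ler_expR.
by rewrite ler_wpM2l // (le_trans (ler_norm _)).
Qed.

(* By [expR_convex_le] the moments [m] of successive generations satisfy
   [m' <= expR u * E (prod (1 + p i * (m - 1)))]; as [phi < 1], for small [u]
   this map preserves an interval [1, 1 + dl]. *)
Lemma total_weight_exp_moment : phi < 1 ->
  exists u B : R, 0 < u /\ forall n, \int[P]_t expR (u * X n t) <= B.
Proof.
move=> phi1.
have K0 : 0 < 2 ^+ N :> R by rewrite exprn_gt0.
(* With this [dl] the quadratic error [2 ^+ N * dl ^+ 2] is at most half of [(1 - phi) * dl]. Hence
   the expected product is at most [c], and [u] is the room left between [c] and [1 + dl]. *)
pose dl := Num.min 1 ((1 - phi) / (2 * 2 ^+ N)).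
have dl0 : 0 < dl by rewrite lt_min ltr01 divr_gt0 ?subr_gt0 // mulr_gt0.
have dl1 : dl <= 1 by rewrite ge_min lexx.
have dlK : 2 * 2 ^+ N * dl <= 1 - phi.
  by rewrite mulrC -ler_pdivlMr ?mulr_gt0 // ge_min lexx orbT.
pose c := 1 + dl * (1 + phi) / 2.
have c0 : 0 < c by rewrite /c; have := phi_ge0; nra.
have c1 : c < 1 + dl by rewrite /c; nra.
pose u := ln ((1 + dl) / c).
have q1 : 1 < (1 + dl) / c by rewrite ltr_pdivlMr // mul1r.
have u0 : 0 < u by rewrite ln_gt0.
have eu : expR u = (1 + dl) / c by rewrite lnK // posrE (lt_trans ltr01).
exists u, (1 + dl); split => // n.
elim: n => [|n IH].
  under eq_Rintegral do rewrite /= mulr0 expR0.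
  by rewrite Rintegral_prob_cst lerDl ltW.
set m := \int[P]_t _ in IH.
have bY := bexpX n (ltW u0).
have m1 : 1 <= m.
  rewrite -[leLHS](Rintegral_prob_cst P 1) le_Rintegral_bounded //.
    exact: bounded_measurable_cst.
  move=> t; rewrite -expR0 ler_expR mulr_ge0 ?(ltW u0) //.
  exact: total_weight_ge0.
have bP : bounded_measurable (fun t =>
    \prod_(i < N) (1 - p i (root t) + p i (root t) * expR (u * X n (shift i t)))).
  apply: bounded_measurable_prod => i; apply: bounded_measurableD.
    by apply: bounded_measurableB => //; exact: bounded_measurable_cst.
  by apply: bounded_measurableM => //; exact: bshift bY.
apply: (@le_trans _ _ (\int[P]_t (expR u * \prod_(i < N)
    (1 - p i (root t) + p i (root t) * expR (u * X n (shift i t)))))).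
  apply: le_Rintegral_bounded; first exact: bexpX (ltW u0).
    by apply: bounded_measurableM => //; exact: bounded_measurable_cst.
  move=> t; rewrite /= mulrDr mulr1 expRD ler_pM2l ?expR_gt0 // mulr_sumr.
  rewrite (big_morph expR (@expRD R) (expR0 R)) ler_prod // => i _.
  by rewrite expR_ge0 mulrCA expR_convex_le.
rewrite RintegralZl_bounded // (Rintegral_prod_subtrees mp p01 bY); last first.
  by move=> t; exact: expR_ge0.
have -> : \int[mu]_l (\prod_(i < N) (1 - p i l + p i l * m)) =
    \int[mu]_l (\prod_(i < N) (1 + p i l * (m - 1))).
  by apply: eq_Rintegral => l _; apply: eq_bigr => i _; ring.
have x1 : `|m - 1| <= 1 by rewrite ger0_norm ?subr_ge0 //; lra.
have := Rintegral_prod_expansion x1; rewrite ler_distl => /andP[_].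
set J := \int[mu]_l _ => hJ.
have hJc : J <= c.
  apply: le_trans hJ _; rewrite /c.
  have x0 : 0 <= m - 1 by rewrite subr_ge0.
  have xd : m - 1 <= dl by lra.
  have h1 : (m - 1) * phi <= dl * phi by rewrite ler_wpM2r.
  have h2 : 2 ^+ N * (m - 1) ^+ 2 <= 2 ^+ N * dl ^+ 2.
    by rewrite ler_pM2l // lerXn2r // nnegrE ltW.
  have h3 : 2 * 2 ^+ N * dl * dl <= (1 - phi) * dl by rewrite ler_wpM2r // ltW.
  move: h2 h3; move: (2 ^+ N) => K h2 h3; nra.
by rewrite eu -mulrA ler_piMr ?addr_ge0 // ?(ltW dl0) // ler_pdivrMl // mulr1.
Qed.

(* The factor [(2 N + 1)^-1] compensates for the number of children, so that
   one almost surely finite quantity controls all subtrees simultaneously. *)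
Fixpoint exp_potential (u : R) (n : nat) (t : T) : R :=
  if n is m.+1 then
    expR (u * X n t) +
      (N.*2.+1%:R)^-1 * \sum_(i < N) exp_potential u m (shift i t)
  else 0.

Let K_gt0 : 0 < N.*2.+1%:R :> R. Proof. by rewrite ltr0n. Qed.

Lemma exp_potential_ge0 u n t : 0 <= exp_potential u n t.
Proof.
elim: n t => //= n IH t; rewrite addr_ge0 ?expR_ge0 // mulr_ge0 ?invr_ge0 ?(ltW K_gt0) //.
by apply: sumr_ge0.
Qed.

Lemma exp_potentialS u n t : 0 <= u ->
  exp_potential u n t <= exp_potential u n.+1 t.
Proof.
move=> u0; elim: n t => [|n IH] t; first exact: exp_potential_ge0.
rewrite [leLHS]/= [leRHS]/=; apply: lerD.
  by rewrite ler_expR ler_wpM2l //; exact: (total_weightS root shift p01 n.+1 t).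
rewrite ler_wpM2l ?invr_ge0 ?(ltW K_gt0) // ler_sum // => i _; exact: IH.
Qed.

Lemma exp_potential_shift u n i t (C : R) :
  (forall n, exp_potential u n t <= C) ->
  exp_potential u n (shift i t) <= N.*2.+1%:R * C.
Proof.
move=> /(_ n.+1) /= h; rewrite mulrC -ler_pdivrMr // mulrC.
apply: le_trans h; rewrite -[leLHS]add0r lerD ?expR_ge0 //.
rewrite ler_wpM2l ?invr_ge0 ?(ltW K_gt0) // (bigD1 i) //= lerDl.
by apply: sumr_ge0 => j _; exact: exp_potential_ge0.
Qed.

(** The means satisfy [I' <= B + N / (2 N + 1) * I], and as the ratio is at most 1/2 they stay below
    [2 * B]. The odd constant stays positive even for [N = 0]. *)
Lemma exp_potential_ae_bounded u (B : R) : 0 < u ->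
  (forall n, \int[P]_t expR (u * X n t) <= B) ->
  {ae P, forall t, exists C : R, forall n, exp_potential u n t <= C}.
Proof.
move=> u0 hB.
have B0 : 0 <= B.
  by rewrite (le_trans _ (hB 0%N)) //; apply: Rintegral_ge0 => t _; exact: expR_ge0.
have bQ n : bounded_measurable (exp_potential u n).
  elim: n => [|n IH]; first exact: bounded_measurable_cst.
  apply: bounded_measurableD; first exact: bexpX (ltW u0).
  apply: bounded_measurableM; first exact: bounded_measurable_cst.
  by apply: bounded_measurable_sum => i; exact: bshift.
apply: (@Rintegral_bounded_seq _ _ _ _ _ (2 * B)) => //.
- by move=> n t; exact: exp_potential_ge0.
- by move=> n t; apply: exp_potentialS; exact: ltW.
elim=> [|n IH].
  by rewrite Rintegral_prob_cst mulr_ge0.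
have bsum : bounded_measurable (fun t => \sum_(i < N) exp_potential u n (shift i t)).
  by apply: bounded_measurable_sum => i; exact: bshift.
rewrite RintegralD_bounded; [|exact: bexpX (ltW u0)|]; last first.
  by apply: bounded_measurableM => //; exact: bounded_measurable_cst.
rewrite RintegralZl_bounded // Rintegral_sum_bounded; last by move=> i; exact: bshift.
have NN : N.*2.+1%:R = 2 * N%:R + 1 :> R by rewrite -natr1 -mul2n natrM.
set I := \int[P]_t exp_potential u n t in IH.
apply: (@le_trans _ _ (B + N.*2.+1%:R^-1 * (N%:R * I))).
  rewrite lerD // ler_wpM2l ?invr_ge0 ?(ltW K_gt0) //.
  have -> : N%:R * I = \sum_(i < N) I by rewrite sumr_const card_ord mulr_natl.
  apply: ler_sum => i _.
  by rewrite [leLHS]Rintegral_shift // => t; exact: exp_potential_ge0.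
have -> : 2 * B = B + B by ring.
rewrite lerD2l mulrC ler_pdivrMr //.
have h := ler_wpM2l (ler0n R N) IH; rewrite NN; clearbody I.
by move: (N%:R) h => x h; lra.
Qed.

(** Passing to a child costs the potential a factor at most [2 N + 1], so at the node [v] it is at
    most [(2 N + 1) ^+ size v * C]. It dominates [expR (u * X)], and taking logarithms gives the
    linear bound with slope [ln (2 N + 1) / u]. *)
Lemma total_weight_ae_growth : phi < 1 ->
  exists a : R, 0 <= a /\
  {ae P, forall t, exists C : R, forall (v : seq 'I_N) n,
    X n (foldl (fun t i => shift i t) t v) <= C + a * (size v)%:R}.
Proof.
move=> phi1; have [u [B [u0 hB]]] := total_weight_exp_moment phi1.
exists (ln N.*2.+1%:R / u); split.
  by rewrite divr_ge0 ?(ltW u0) // ln_ge0 // ler1n.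
apply: filterS (exp_potential_ae_bounded u0 hB) => t [C0 hC0].
pose C := Num.max 1 C0.
have hC n : exp_potential u n t <= C by rewrite le_max hC0 orbT.
have C_gt0 : 0 < C by rewrite lt_max ltr01.
exists (ln C / u) => v n.
have hv : forall n, exp_potential u n (foldl (fun t i => shift i t) t v) <=
    N.*2.+1%:R ^+ size v * C.
  elim: v t C hC {n hC0 C_gt0} => [|i v IH] t C hC n /=; first by rewrite mul1r.
  rewrite exprSr -mulrA; apply: IH => m.
  exact: exp_potential_shift.
(* One level is added because the potential at level 0 is 0 and controls nothing. *)
rewrite (le_trans (total_weightS _ _ p01 _ _)) //.
set s := foldl _ _ _ in hv *.
have h : expR (u * X n.+1 s) <= N.*2.+1%:R ^+ size v * C.
  apply: le_trans (hv n.+1); rewrite [leRHS]/= lerDl mulr_ge0 ?invr_ge0 ?(ltW K_gt0) //.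
  by apply: sumr_ge0 => i _; exact: exp_potential_ge0.
have D0 : 0 < N.*2.+1%:R ^+ size v * C by rewrite mulr_gt0 // exprn_gt0.
move: h; rewrite -[leRHS]lnK ?posrE // ler_expR.
rewrite lnM ?posrE ?exprn_gt0 // lnXn // => h.
rewrite -(ler_pM2l u0) (le_trans h) //.
rewrite mulrDr addrC [in leRHS]mulrCA divff ?gt_eqF // mulr1 lerD2l.
by rewrite mulrA [u * _]mulrCA divff ?gt_eqF // mulr1 mulr_natr.
Qed.

Lemma Rintegral_percolationS n :
  \int[P]_t V n.+1 t =
  1 - \int[mu]_l (\prod_(i < N) (1 - p i l * \int[P]_t V n t)).
Proof.
have bc (a : R) : bounded_measurable (fun=> a : R) by exact: bounded_measurable_cst.
have bV := bounded_measurable_percolation n.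
have bU : bounded_measurable (fun t => 1 - V n t) by exact: bounded_measurableB.
have U0 t : 0 <= 1 - V n t.
  by rewrite subr_ge0; case/andP: (percolation01 root shift p01 n t).
have bVS : bounded_measurable (fun t =>
    \prod_(i < N) (1 - p i (root t) * V n (shift i t))).
  apply: bounded_measurable_prod => i; apply: bounded_measurableB => //.
  by apply: bounded_measurableM => //; exact: bshift.
transitivity (\int[P]_t (1 - \prod_(i < N)
    (1 - p i (root t) * V n (shift i t)))); first by [].
rewrite Rintegral_onem //; congr (1 - _).
transitivity (\int[P]_t (\prod_(i < N)
    (1 - p i (root t) + p i (root t) * (1 - V n (shift i t))))).
  by apply: eq_Rintegral => t _; apply: eq_bigr => i _; ring.
rewrite (Rintegral_prod_subtrees mp p01 bU U0) Rintegral_onem //.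
set v := \int[P]_t V n t; clearbody v.
by apply: eq_Rintegral => l _; apply: eq_bigr => i _; ring.
Qed.

(* The means of [V n] are the iterates from 1 of the increasing function
   [x |-> 1 - E (prod (1 - p i * x))], whose slope at 0 is [phi > 1]. *)
Lemma percolation_mean_ge : 1 < phi ->
  exists2 x0 : R, 0 < x0 & forall n, x0 <= \int[P]_t V n t.
Proof.
move=> phi1; have K0 : 0 < 2 ^+ N :> R by rewrite exprn_gt0.
(* At this [x0] the gain [(phi - 1) * x0] from the slope beats the error [2 ^+ N * x0 ^+ 2], so the
   increasing map sends [x0] to a value at least [x0]. *)
pose x0 := Num.min 1 ((phi - 1) / 2 ^+ N).
have x00 : 0 < x0 by rewrite lt_min ltr01 divr_gt0 ?subr_gt0.
have x01 : x0 <= 1 by rewrite ge_min lexx.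
have x0K : 2 ^+ N * x0 <= phi - 1.
  by rewrite mulrC -ler_pdivlMr // ge_min lexx orbT.
have bc (a : R) : bounded_measurable (fun=> a : R) by exact: bounded_measurable_cst.
exists x0 => //; elim=> [|n IH]; first by rewrite Rintegral_prob_cst.
rewrite Rintegral_percolationS; set v := Rintegral _ _ _ in IH *.
have v1 : v <= 1.
  rewrite -[leRHS](Rintegral_prob_cst P 1) le_Rintegral_bounded //.
    exact: bounded_measurable_percolation.
  by move=> t; case/andP: (percolation01 root shift p01 n t).
have bprod (x : R) : bounded_measurable (fun l => \prod_(i < N) (1 - p i l * x)).
  apply: bounded_measurable_prod => i; apply: bounded_measurableB => //.
  exact: bounded_measurableM.
apply: (@le_trans _ _ (1 - \int[mu]_l (\prod_(i < N) (1 - p i l * x0)))); last first.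
  rewrite lerD2l lerN2 le_Rintegral_bounded // => l.
  apply: ler_prod => i _; have /andP[p0 p1] := p01 i l.
  have v0 : 0 <= v by rewrite (le_trans (ltW x00)).
  by rewrite subr_ge0 mulr_ile1 //= lerD2l lerN2 ler_wpM2l.
have xx : `|- x0| <= 1 by rewrite normrN ger0_norm // ltW.
have := Rintegral_prod_expansion xx; rewrite ler_distl => /andP[_].
under eq_Rintegral do under eq_bigr do rewrite mulrN.
have h : 2 ^+ N * x0 * x0 <= (phi - 1) * x0 by rewrite ler_wpM2r // ltW.
rewrite sqrrN; move: (Rintegral _ _ _) h => J; move: (2 ^+ N) => K h; nra.
Qed.

Local Notation W := (percolation_lim root shift p).

Lemma bounded_measurable_percolation_lim : bounded_measurable W.
Proof.
split; last first.
  exists 1 => t; rewrite ger0_norm ?percolation_lim_ge0 //.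
  exact: (percolation_lim_le root shift p01 0 t).
apply: (measurable_fun_cvg (h := V)) => [m|t _].
  by case: (bounded_measurable_percolation m).
exact: cvg_percolation.
Qed.

(** The limit inherits the lower bound on the means by dominated convergence, and being at most 1 it
    lies below the indicator of its own positivity. *)
Lemma percolation_lim_pos_prob : 1 < phi -> 
  0 < \int[P]_t \1_[set t | 0 < W t] t :> R.
Proof.
move=> /percolation_mean_ge[x0 x00 hx0].
have bc (a : R) : bounded_measurable (fun=> a : R) by exact: bounded_measurable_cst.
have bW := bounded_measurable_percolation_lim.
apply: (lt_le_trans x00); apply: (@le_trans _ _ (\int[P]_t W t)).
  apply: (@Rintegral_cvg_ge _ _ _ _ V _ 1) => //.
  - exact: bounded_measurable_percolation.
  - move=> n t; have /andP[v0 v1] := percolation01 root shift p01 n t.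
    by rewrite ger0_norm.
  - by move=> t; exact: cvg_percolation.
apply: le_Rintegral_bounded => //; first exact/bounded_measurable_indic/measurable_pos.
move=> t; rewrite indicE; have [_|nt] := boolP (t \in [set t | 0 < W t]).
  exact: (percolation_lim_le root shift p01 0 t).
by rewrite leNgt; apply: contra nt => ?; rewrite inE.
Qed.

End weights.

Lemma measurable_support (p : 'I_N -> Lab -> R) :
  (forall i, measurable_fun setT (p i)) -> (forall i l, 0 <= p i l <= 1) ->
  forall i, measurable_fun setT (fun l => (0 < p i l)%R%:R : R).
Proof.
move=> mp p01 i; have mpi : measurable [set l | 0 < p i l].
  apply: measurable_pos; split => //; exists 1 => l.
  by have /andP[a0 a1] := p01 i l; rewrite ger0_norm.
rewrite (_ : (fun=> _) = \1_[set l | 0 < p i l]); first exact: measurable_indic.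
apply/funext => l; rewrite indicE; congr (_%:R); congr nat_of_bool.
by apply/idP/idP; rewrite inE.
Qed.

(** An infinite open path is in particular a path of the tree reaching level [n]. *)
Lemma indic_percolation_lim_le (p : 'I_N -> Lab -> R) n t :
  (forall i l, 0 <= p i l <= 1) ->
  \1_[set t | 0 < percolation_lim root shift p t] t <=
  percolation root shift (fun i l => (0 < p i l)%R%:R : R) n t.
Proof.
move=> p01; set q := fun i l => (0 < p i l)%R%:R : R.
have q01 i l : 0 <= q i l <= 1 by rewrite /q; case: (0 < p i l)%R; rewrite ?lexx ?ler01.
rewrite indicE; have /andP[v0 v1] := percolation01 root shift q01 n t.
case: (boolP (t \in _)) => // /set_mem /= Wt.
have [v|->//] := percolation_bool R root shift (fun i l => 0 < p i l)%R n t.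
have : 0 < percolation root shift q n t.
  rewrite (lt_le_trans Wt) // (le_trans (percolation_lim_le root shift p01 n t)) //.
  apply: percolation_le => i l; have /andP[a0 a1] := p01 i l => //.
    by rewrite /q; case: ltP.
  by case/andP: (q01 i l).
by rewrite v ltxx.
Qed.

(** The zero-one argument in quantitative form. The probabilities [h n] of reaching level [n] are
    the iterates from 1 of the generating function [H], and the percolation probability [y > 0]
    satisfies [H y <= y]. A persistent excess of [h n] over [y] would force a drop of fixed size at
    every step, which a sequence in [0, 1] cannot afford. *)
Lemma survival_gap (p : 'I_N -> Lab -> R) :
  (forall i, measurable_fun setT (p i)) -> (forall i l, 0 <= p i l <= 1) ->
  1 < \int[mu]_l (\sum_(i < N) p i l) ->
  1 < \int[mu]_l (\sum_(i < N) ((0 < p i l)%R%:R : R)) ->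
  forall e, 0 < e -> exists n,
    \int[P]_t percolation root shift (fun i l => (0 < p i l)%R%:R) n t -
    \int[P]_t \1_[set t | 0 < percolation_lim root shift p t] t < e.
Proof.
move=> mp p01 phi1; set q := fun i l => (0 < p i l)%R%:R : R.
have q01 i l : 0 <= q i l <= 1 by rewrite /q; case: (0 < p i l); rewrite ?lexx ?ler01.
have mq := measurable_support mp p01.
set phiq := Rintegral _ _ _ => phiq1 e e0.
pose W := percolation_lim root shift p.
pose A : set T := [set t | 0 < W t].
have mA : measurable A.
  exact/measurable_pos/bounded_measurable_percolation_lim.
have bA := bounded_measurable_indic R mA.
set y := \int[P]_t \1_A t.
have y0 : 0 < y by exact: percolation_lim_pos_prob.
pose h n := \int[P]_t percolation root shift q n t.
have bV n := bounded_measurable_percolation mq q01 n.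
pose H x := 1 - \int[mu]_l (\prod_(i < N) (1 - q i l * x)).
have hS n : h n.+1 = H (h n) by exact: Rintegral_percolationS.
have bc (a : R) : bounded_measurable (fun=> a : R) by exact: bounded_measurable_cst.
have bqr i : bounded_measurable (fun t => q i (root t)).
  apply: bounded_measurable_comp; first exact: mroot.
  split; [exact: mq|]; exists 1 => l; have /andP[a0 a1] := q01 i l.
  by rewrite ger0_norm.
have bq i : bounded_measurable (q i).
  split; [exact: mq|]; exists 1 => l; have /andP[a0 a1] := q01 i l.
  by rewrite ger0_norm.
have y1 : y <= 1.
  by rewrite -[leRHS](Rintegral_prob_cst P 1) le_Rintegral_bounded.
(* A tree outside [A] has no subtree in [A] along an edge with [0 < p]. Its product over the
   children is therefore 1, while on [A] the bound 0 is trivial. *)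
have HyE : H y <= y.
  have bU : bounded_measurable (fun t => 1 - \1_A t : R) by exact: bounded_measurableB.
  have U0 t : 0 <= 1 - \1_A t :> R.
    by rewrite indicE; case: (t \in A); rewrite ?subrr ?subr0 ?ler01.
  rewrite /H lerBlDr -lerBlDl.
  have := Rintegral_prod_subtrees mq q01 bU U0.
  rewrite Rintegral_onem // -/y => E.
  have -> : \int[mu]_l (\prod_(i < N) (1 - q i l * y)) =
      \int[mu]_l (\prod_(i < N) (1 - q i l + q i l * (1 - y))).
    by clearbody y; apply: eq_Rintegral => l _; apply: eq_bigr => i _; ring.
  rewrite -E /y -Rintegral_onem //; apply: le_Rintegral_bounded => //.
    apply: bounded_measurable_prod => i; apply: bounded_measurableD.
      by apply: bounded_measurableB => //; exact: bqr.
    apply: bounded_measurableM; first exact: bqr.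
    by apply: (bounded_measurable_comp (f := shift i) (mshift i) bU).
  move=> t; rewrite [\1_A t]indicE; have [At|At] := boolP (t \in A).
    rewrite subrr; apply: prodr_ge0 => i _; have /andP[a0 a1] := q01 i (root t).
    by rewrite addr_ge0 ?subr_ge0 // mulr_ge0.
  rewrite subr0 big1 // => i _; rewrite indicE /q.
  have [pi|_] := ltP 0 (p i (root t)); last by rewrite subr0 mul0r addr0.
  suff /negbTE -> : shift i t \notin A by rewrite subr0 subrr mulr1 add0r.
  apply: contra At; rewrite !inE /A /= => Wi.
  by rewrite (lt_le_trans _ (percolation_lim_ge_child root shift p01 i t)) // mulr_gt0.
have yh n : y <= h n.
  by apply: le_Rintegral_bounded => // t; exact: indic_percolation_lim_le.
have h1 n : h n <= 1.
  rewrite -[leRHS](Rintegral_prob_cst P 1) le_Rintegral_bounded // => t.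
  by case/andP: (percolation01 root shift q01 n t).
have N0 : 0 < N%:R :> R.
  rewrite ltr0n lt0n; apply/negP => /eqP N0; move: phiq1; rewrite /phiq.
  rewrite (_ : Rintegral _ _ _ = 0) ?ltr10 // -[RHS](Rintegral_prob_cst mu 0).
  by apply: eq_Rintegral => l _; rewrite big1 // => -[i /= iN]; exfalso; move: iN; rewrite N0.
(* Concavity of H: beyond the fixed point y, H stays below the diagonal. *)
have step n : (h n - y) * (y * (phiq - 1)) <= N%:R * (h n - h n.+1).
  rewrite hS; set x := h n.
  have yx : y <= x by exact: yh.
  have x1 : x <= 1 by exact: h1.
  have bpr z : bounded_measurable (fun l => \prod_(i < N) (1 - q i l * z)).
    apply: bounded_measurable_prod => i; apply: bounded_measurableB => //.
    exact: bounded_measurableM.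
  have bsq : bounded_measurable (fun l => \sum_(i < N) q i l).
    exact: bounded_measurable_sum.
  have : x * y * (x - y) * (phiq - 1) <= N%:R * (x * H y - y * H x).
    have -> : x * y * (x - y) * (phiq - 1) =
        \int[mu]_l (x * y * (x - y) * (\sum_(i < N) q i l - 1)).
      rewrite RintegralZl_bounded; last exact: bounded_measurableB.
      by rewrite RintegralD_bounded // Rintegral_prob_cst.
    have -> : N%:R * (x * H y - y * H x) = \int[mu]_l (N%:R *
      (x * (1 - \prod_(i < N) (1 - q i l * y)) +
       (- y) * (1 - \prod_(i < N) (1 - q i l * x)))).
      have bo z : bounded_measurable (fun l => 1 - \prod_(i < N) (1 - q i l * z)).
        exact: bounded_measurableB.
      have bm a z : bounded_measurable (fun l => a * (1 - \prod_(i < N) (1 - q i l * z))).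
        exact: bounded_measurableM.
      rewrite RintegralZl_bounded; last exact: bounded_measurableD.
      rewrite RintegralD_bounded // !RintegralZl_bounded // !Rintegral_onem //.
      by rewrite mulNr.
    apply: le_Rintegral_bounded.
    - by apply: bounded_measurableM => //; exact: bounded_measurableB.
    - apply: bounded_measurableM => //; apply: bounded_measurableD.
        by apply: bounded_measurableM => //; exact: bounded_measurableB.
      by apply: bounded_measurableM => //; exact: bounded_measurableB.
    - move=> l; rewrite mulNr !prod_onem_bool.
      have -> : \sum_(i < N) q i l = (count (fun i => 0 < p i l) (index_enum 'I_N))%:R.
        by rewrite -sum1_count natr_sum [in RHS]big_mkcond; apply: eq_bigr => i _;
          rewrite /q; case: (0 < p i l).
      apply: onem_expr_concave => //; first exact: ltW.
      apply: leq_trans (count_size _ _) _.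
      by rewrite [index_enum _]unlock -enumT size_enum_ord.
  have phiq1' : 0 < phiq - 1 by rewrite subr_gt0.
  have x_y : 0 <= x - y by rewrite subr_ge0.
  have x0 : 0 <= x by rewrite (le_trans (ltW y0)).
  have hx := ler_wpM2l x0 HyE.
  move=> h2; rewrite -(ler_pM2l y0).
  have h3 : y * ((x - y) * (y * (phiq - 1))) <= x * y * (x - y) * (phiq - 1).
    rewrite -subr_ge0 (_ : _ - _ = y * (x - y) ^+ 2 * (phiq - 1)); last by ring.
    by rewrite mulr_ge0 ?(ltW phiq1') // mulr_ge0 ?sqr_ge0 ?(ltW y0).
  apply: le_trans h3 _; apply: le_trans h2 _.
  rewrite mulrCA ler_pM2l //.
  by move: (H x) (H y) hx => a b hx; clearbody x y; lra.
(* If the excess never falls below [e], each step lowers [N * h n] by at least [k], so the total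
   drop eventually exceeds [N]. *)
apply: contrapT => nh.
have he n : e <= h n - y by rewrite leNgt; apply/negP => hn; apply: nh; exists n.
pose k := e * (y * (phiq - 1)).
have k0 : 0 < k by rewrite !mulr_gt0 // subr_gt0.
have hk n : k * n%:R <= N%:R * (1 - h n).
  elim: n => [|n IH]; first by rewrite mulr0 mulr_ge0 ?subr_ge0 // ltW.
  have := le_trans (ler_wpM2r (_ : 0 <= y * (phiq - 1)) (he n)) (step n).
  rewrite mulr_ge0 ?subr_ge0 ?(ltW y0) ?(ltW phiq1) // -/k => /(_ isT) h2.
  rewrite -natr1 mulrDr mulr1 (le_trans (lerD IH h2)) // -mulrDr ler_pM2l //.
  by rewrite addrA subrK.
have := archi_boundP (_ : 0 <= N%:R / k); rewrite divr_ge0 ?(ltW k0) ?ler0n // => /(_ isT).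
rewrite ltr_pdivrMr // => hb; have := hk (Num.bound (N%:R / k)); rewrite leNgt => /negP; apply.
apply: (@le_lt_trans _ _ N%:R); last by rewrite mulrC.
by rewrite -[leRHS]mulr1 ler_pM2l // lerBlDr lerDl (le_trans (ltW y0)).
Qed.

(** For every [n], the trees that survive without percolating are among those that reach level [n]
    outside [A], and by [survival_gap] these have arbitrarily small probability. *)
Lemma survival_percolates (p : 'I_N -> Lab -> R) :
  (forall i, measurable_fun setT (p i)) -> (forall i l, 0 <= p i l <= 1) ->
  1 < \int[mu]_l (\sum_(i < N) p i l) ->
  1 < \int[mu]_l (\sum_(i < N) ((0 < p i l)%R%:R : R)) ->
  {ae P, forall t,
    (forall n, 0 < percolation root shift (fun i l => (0 < p i l)%R%:R : R) n t) ->
    0 < percolation_lim root shift p t}.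
Proof.
move=> mp p01 phi1 phiq1; set q := fun i l => (0 < p i l)%R%:R : R.
have q01 i l : 0 <= q i l <= 1 by rewrite /q; case: (0 < p i l)%R; rewrite ?lexx ?ler01.
have mq := measurable_support mp p01.
pose W := percolation_lim root shift p.
pose A : set T := [set t | 0 < W t].
have mA : measurable A.
  exact/measurable_pos/bounded_measurable_percolation_lim.
pose S : set T := (\bigcap_n [set t | 0 < percolation root shift q n t]) `\` A.
have bV n := bounded_measurable_percolation mq q01 n.
have mS : measurable S.
  by apply: measurableD => //; apply: bigcapT_measurable => n; exact: measurable_pos.
exists S; split => //; last first.
  move=> t /= /not_implyP[h1 h2]; split; first by move=> n _; exact: h1.
  exact: h2.
have PS : (P S <= 0)%E.
  have <- : (\int[P]_t (\1_S t)%:E = P S)%E by rewrite integral_indic // setIT.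
  rewrite EFin_Rintegral; last first.
    exact: bounded_measurable_indic.
  rewrite lee_fin; apply/ler_addgt0Pl => e e0; rewrite addr0.
  have [n hn] := survival_gap mp p01 phi1 phiq1 e0.
  rewrite (le_trans _ (ltW hn)) // -RintegralB //; last 2 first.
  - exact/bounded_measurable_integrable/bV.
  - exact/bounded_measurable_integrable/bounded_measurable_indic.
  have bA := bounded_measurable_indic R mA.
  apply: le_Rintegral_bounded; first exact: bounded_measurable_indic.
    exact: bounded_measurableB.
  move=> t; have [St|nSt] := boolP (t \in S); last first.
    by rewrite [\1_S t]indicE (negbTE nSt) subr_ge0 indic_percolation_lim_le.
  move: (St); rewrite inE => -[/(_ n Logic.I)/= hn0 nA].
  have [v|->] := percolation_bool R root shift (fun i l => 0 < p i l)%R n t.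
    by move: hn0; rewrite v ltxx.
  by rewrite !indicE St (negbTE (_ : t \notin A)) ?subr0 // notin_setE.
by apply/eqP; rewrite eq_le PS measure_ge0.
Qed.

End random_galton_watson.

(** * Similarities and packings in Euclidean space *)

Section euclidean.
Context (R : realType) (d : nat).
Implicit Types (x y : 'rV[R]_d).

Lemma enorm_ge0 x : 0 <= enorm x. Proof. exact: sqrtr_ge0. Qed.

Lemma enorm_sqr x : enorm x ^+ 2 = \sum_(i < d) x 0 i ^+ 2.
Proof. by rewrite sqr_sqrtr // sumr_ge0 // => i _; exact: sqr_ge0. Qed.

Lemma coord_le_enorm x i : `|x 0 i| <= enorm x.
Proof.
rewrite -sqrtr_sqr ler_wsqrtr // (bigD1 i) //= lerDl.
by apply: sumr_ge0 => j _; exact: sqr_ge0.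
Qed.

Lemma rV_normE x : `|x| = \big[Num.max/0]_(ij : 'I_1 * 'I_d) `|x ij.1 ij.2|.
Proof. exact: mx_normrE. Qed.

Lemma norm_le_enorm x : `|x| <= enorm x.
Proof.
rewrite rV_normE; apply: bigmax_le; first exact: enorm_ge0.
by move=> [i j] _ /=; rewrite (ord1 i) coord_le_enorm.
Qed.

Lemma enorm_le_coord x (b : R) : (forall i, `|x 0 i| <= b) ->
  enorm x <= d%:R * b.
Proof.
move=> xb; have [d0|d0] := posnP d.
  rewrite /enorm big1 ?sqrtr0 ?d0 ?mul0r // => i _.
  by case: i => j jd; exfalso; move: jd; rewrite d0.
have b0 : 0 <= b by rewrite (le_trans _ (xb (Ordinal d0))).
have db : 0 <= d%:R * b by rewrite mulr_ge0.
rewrite -[leRHS]ger0_norm // -sqrtr_sqr ler_wsqrtr //.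
apply: (@le_trans _ _ (\sum_(i < d) b ^+ 2)).
  by apply: ler_sum => i _; rewrite -real_normK ?num_real // lerXn2r ?nnegrE.
rewrite sumr_const card_ord -[b ^+ 2 *+ d]mulr_natl exprMn ler_wpM2r ?sqr_ge0 //.
by rewrite -natrX ler_nat -[leqLHS]expn1 leq_pexp2l.
Qed.

Lemma enorm_le_norm x : enorm x <= d%:R * `|x|.
Proof.
apply: enorm_le_coord => i; rewrite rV_normE.
exact: (@le_bigmax _ _ _ _ (fun ij : 'I_1 * 'I_d => `|x ij.1 ij.2|) (0, i)).
Qed.

Lemma enorm_eq0 x : enorm x = 0 -> x = 0.
Proof.
move=> e; apply/eqP; rewrite -normr_eq0 eq_le normr_ge0 andbT -e.
exact: norm_le_enorm.
Qed.

Lemma enorm0 : enorm (0 : 'rV[R]_d) = 0.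
Proof. by rewrite /enorm big1 ?sqrtr0 // => i _; rewrite mxE expr0n. Qed.

Lemma enormZ (a : R) x : enorm (a *: x) = `|a| * enorm x.
Proof.
rewrite -sqrtr_sqr -sqrtrM ?sqr_ge0 // mulr_sumr.
by congr Num.sqrt; apply: eq_bigr => i _; rewrite mxE exprMn.
Qed.

Section similarity.
Context (c : R) (f : 'rV[R]_d -> 'rV[R]_d) (c0 : 0 < c) (fc : similarity c f).

Lemma similarity_inj : injective f.
Proof.
move=> x y fxy; apply/subr0_eq/enorm_eq0/eqP.
by have /eqP := fc x y; rewrite fxy subrr enorm0 eq_sym mulf_eq0 gt_eqF.
Qed.

Lemma similarity_continuous : continuous f.
Proof.
move=> x; apply/(@cvgrPdist_lt _ _ _ _ (nbhs_filter x)) => e e0.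
(* The successor keeps the divisor nonzero when [d = 0]. *)
have k0 : 0 < c * d.+1%:R by rewrite mulr_gt0 // ltr0n.
have : \forall y \near x, `|x - y| < e / (c * d.+1%:R).
  apply/nbhs_ballP; exists (e / (c * d.+1%:R)); first by rewrite /= divr_gt0.
  by move=> y; rewrite -ball_normE.
apply: filterS => y; rewrite ltr_pdivlMr // => h.
apply: le_lt_trans (norm_le_enorm _) _; rewrite fc.
apply: le_lt_trans h; rewrite mulrCA ler_pM2l // mulrC.
apply: le_trans (enorm_le_norm _) _.
by rewrite ler_wpM2r // ler_nat.
Qed.

(* Up to scaling and translation f preserves inner products, so the images
   of the standard basis form an orthonormal basis. *)
Lemma similarity_surj (z : 'rV[R]_d) : exists x, f x = z.
Proof.
pose g x := c^-1 *: (f x - f 0).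
have gB x y : g x - g y = c^-1 *: (f x - f y).
  by rewrite /g -scalerBr; congr (_ *: _); rewrite opprB addrA subrK.
have gN x y : enorm (g x - g y) = enorm (x - y).
  rewrite gB enormZ fc mulrA ger0_norm ?invr_ge0 ?ltW // mulVf ?mul1r //.
  by rewrite gt_eqF.
pose ip (x y : 'rV[R]_d) := (x *m y^T) 0 0.
have ipE x y : 2 * ip x y = enorm x ^+ 2 + enorm y ^+ 2 - enorm (x - y) ^+ 2.
  rewrite !enorm_sqr /ip mxE -big_split -sumrB mulr_sumr.
  by apply: eq_bigr => i _; rewrite !mxE /=; ring.
have g0 : g 0 = 0 by rewrite /g subrr scaler0.
have gip x y : ip (g x) (g y) = ip x y.
  have h : 2 * ip (g x) (g y) = 2 * ip x y.
    rewrite !ipE gN; have := gN x 0; have := gN y 0.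
    by rewrite g0 !subr0 => -> ->.
  by lra.
pose e i : 'rV[R]_d := delta_mx 0 i.
pose G := \matrix_(i < d) g (e i).
have ipG x i : (g x *m G^T) 0 i = x 0 i.
  transitivity (ip (g x) (g (e i))).
    by rewrite /ip !mxE; apply: eq_bigr => j _; rewrite !mxE.
  rewrite gip /ip mxE (bigD1 i) //= !mxE !eqxx mulr1 big1 ?addr0 // => j ji.
  by rewrite !mxE (negbTE ji) andbF mulr0.
have GG : G *m G^T = 1%:M.
  apply/matrixP => i j; transitivity ((g (e i) *m G^T) 0 j).
    by rewrite !mxE; apply: eq_bigr => k _; rewrite !mxE.
  by rewrite ipG !mxE eqxx /= eq_sym.
have GG' := mulmx1C GG.
have gE x : g x = x *m G.
  rewrite -[LHS]mulmx1 -GG' mulmxA; congr (_ *m _).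
  by apply/rowP => i; rewrite ipG.
exists (c^-1 *: (z - f 0) *m G^T).
apply: (addIr (- f 0)); apply: (scalerI (_ : c^-1 != 0)).
  by rewrite invr_neq0 // gt_eqF.
by rewrite -/(g _) gE -mulmxA GG' mulmx1.
Qed.

End similarity.

(** Pigeonhole: the cube of half-side [a * rho] around [x] is cut into cells of side
    [e * rho / (d + 1)]. Two points of one cell are at Euclidean distance at most
    [d / (d + 1) * e * rho], so each cell holds one point, and the number of cells does not depend
    on [rho]. *)
Lemma packing_bound (a e : R) : 0 < a -> 0 < e -> exists M : nat,
  forall (rho : R) (I : eqType) (s : seq I) (f : I -> 'rV[R]_d) (x : 'rV[R]_d),
    0 < rho -> uniq s ->
    (forall i, i \in s -> `|f i - x| <= a * rho) ->
    {in s &, forall i j, i != j -> e * rho <= enorm (f i - f j)} ->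
  (size s <= M)%N.
Proof.
move=> a0 e0; pose dl := e / d.+1%:R.
have dl0 : 0 < dl by rewrite divr_gt0 // ltr0n.
pose m := Num.truncn (2 * a / dl).
exists #|{ffun 'I_d -> 'I_m.+1}| => rho I s f x rho0 us near_x sep.
have dr0 : 0 < dl * rho by rewrite mulr_gt0.
pose q i k := (f i 0 k - x 0 k + a * rho) / (dl * rho).
have cx i k : i \in s -> `|f i 0 k - x 0 k| <= a * rho.
  move=> /near_x; apply: le_trans; rewrite rV_normE.
  have := @le_bigmax _ _ _ 0 (fun ij : 'I_1 * 'I_d => `|(f i - x) ij.1 ij.2|) (0, k).
  by rewrite /= !mxE.
have q0 i k : i \in s -> 0 <= q i k <= 2 * a / dl.
  move=> /cx -/(_ k); rewrite ler_norml => /andP[h1 h2].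
  rewrite divr_ge0 ?(ltW dr0) //=; last by rewrite -lerBlDr sub0r.
  rewrite ler_pdivrMr // mulrA divfK ?gt_eqF //; lra.
pose cell i : {ffun 'I_d -> 'I_m.+1} := [ffun k => inord (Num.truncn (q i k))].
have cell_inj : {in s &, injective cell}.
  move=> i j si sj cij; apply/eqP; apply: contraT => ij.
  have := sep _ _ si sj ij; rewrite leNgt => /negP[].
  have dq k : `|f i 0 k - f j 0 k| <= dl * rho.
    have [/andP[i0 i1] /andP[j0 j1]] := (q0 i k si, q0 j k sj).
    have tE : Num.truncn (q i k) = Num.truncn (q j k).
      have := congr1 (fun c : {ffun 'I_d -> 'I_m.+1} => val (c k)) cij.
      by rewrite !ffunE /= !inordK // ltnS le_truncn.
    have /andP[] := truncn_itv i0; have /andP[] := truncn_itv j0.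
    rewrite tE -natr1; move: (_%:R) => t h1 h2 h3 h4.
    have -> : f i 0 k - f j 0 k = (q i k - q j k) * (dl * rho).
      by rewrite /q -mulrBl divfK ?gt_eqF //; ring.
    rewrite normrM (ger0_norm (ltW dr0)) ler_piMl ?(ltW dr0) //.
    by rewrite ler_norml; apply/andP; split; lra.
  apply: (@le_lt_trans _ _ (d%:R * (dl * rho))).
    by apply: enorm_le_coord => k; rewrite !mxE.
  rewrite mulrA ltr_pM2r // /dl mulrCA -[ltRHS]mulr1 ltr_pM2l //.
  by rewrite ltr_pdivrMr ?ltr0n // mul1r ltr_nat.
rewrite -(size_map cell) -(card_uniqP _) ?map_inj_in_uniq //.
exact: max_card.
Qed.

End euclidean.

(** * Box dimension and Assouad spectrum from covering estimates *)

Section covers.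
Context (R : realType) (d : nat).
Implicit Types (X : set 'rV[R]_d).

Definition covers (r : R) X (n : nat) : Prop :=
  exists U : 'I_n -> set 'rV[R]_d,
    X `<=` \bigcup_i U i /\ forall i, (ediam (U i) <= r%:E)%E.

Lemma ediam_leP (r : R) X : 0 <= r ->
  (ediam X <= r%:E)%E <-> (forall x y, X x -> X y -> enorm (x - y) <= r).
Proof.
move=> r0; rewrite /ediam ge_max lee_fin r0 /=; split.
  move=> h x y Xx Xy; rewrite -lee_fin; apply: le_trans h.
  by apply: ereal_sup_ubound; exists x => //; exists y.
by move=> h; apply: ge_ereal_sup => _ [x Xx [y Xy <-]]; rewrite lee_fin h.
Qed.

Lemma covers_seq (I : eqType) (s : seq I) (V : I -> set 'rV[R]_d) (r : R) X :
  0 <= r -> (forall x, X x -> exists2 i, i \in s & V i x) ->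
  (forall i, i \in s -> forall x y, V i x -> V i y -> enorm (x - y) <= r) ->
  covers r X (size s).
Proof.
move=> r0 XV hV; exists (fun j => V (tnth (in_tuple s) j)); split.
  move=> x /XV[i si Vi]; have /tnthP[j ij] : i \in in_tuple s by [].
  by exists j => //; rewrite -ij.
move=> j; apply/ediam_leP => //; apply: hV; exact: mem_tnth.
Qed.

Lemma covers_le r X Y n : X `<=` Y -> covers r Y n -> covers r X n.
Proof. by move=> XY [U [YU hU]]; exists U; split => //; exact: subset_trans YU. Qed.

Lemma covering_number_le r X n : covers r X n ->
  (covering_number r X <= n%:R%:E)%E.
Proof. by move=> h; apply: ereal_inf_lbound; exists n. Qed.

Lemma covering_number_lt r X y : (covering_number r X < y)%E ->
  exists2 n, covers r X n & (n%:R%:E < y)%E.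
Proof. by move=> /ereal_inf_lt[_ [n h <-] ny]; exists n. Qed.

Lemma le_covering_number r X y :
  (forall n, covers r X n -> (y <= n%:R%:E)%E) -> (y <= covering_number r X)%E.
Proof. by move=> h; apply: le_ereal_inf_tmp => _ [n hn <-]; exact: h. Qed.

End covers.

Section covers_operations.
Context (R : realType) (d : nat).
Implicit Types (X : set 'rV[R]_d).

Lemma covers_widen (r : R) X m n : 0 <= r -> (m <= n)%N ->
  covers r X m -> covers r X n.
Proof.
move=> r0 mn [U [XU hU]].
exists (fun j : 'I_n => if insub (val j) is Some i then U i else set0); split.
  move=> x /XU[i _ Ui]; exists (widen_ord mn i) => //=.
  case: insubP => [i' _ i'i|]; last by rewrite ltn_ord.
  by rewrite (_ : i' = i) //; exact: val_inj.
move=> j; case: insubP => [i _ _|_]; first exact: hU.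
by apply/ediam_leP.
Qed.

Lemma covers_ler (r r' : R) X n : r <= r' -> covers r X n -> covers r' X n.
Proof.
move=> rr' [U [XU hU]]; exists U; split => // i.
by apply: le_trans (hU i) _; rewrite lee_fin.
Qed.

(** A set of diameter at most [a] meeting [X] lies in the ball of radius [rho] around any of its
    points in [X]; the inequality [a < rho] is strict because balls are open. *)
Lemma covers_comp (a rho r : R) X m n : 0 <= r -> 0 <= a -> a < rho ->
  covers a X m -> (forall x, X x -> covers r (eball x rho `&` X) n) ->
  covers r X (m * n).
Proof.
move=> r0 a0 arho [U [XU hU]] hX.
have hV (i : 'I_m) : covers r (U i `&` X) n.
  have [[x [Ux Xx]]|/set0P/negP/negPn/eqP ->] := pselect (U i `&` X !=set0).
    apply: covers_le (hX x Xx) => y [Uy Xy]; split => //.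
    by rewrite /eball /=; apply: le_lt_trans arho; have /ediam_leP := hU i; apply.
  by exists (fun=> set0); split => // j; apply/ediam_leP.
have /(_ _)/cid-/all_sig[V hV'] := hV.
have -> : (m * n)%N = size (enum {: 'I_m * 'I_n}).
  by rewrite -cardT card_prod !card_ord.
apply: (covers_seq (V := fun ij : 'I_m * 'I_n => V ij.1 ij.2)) => //.
  move=> x Xx; have [i _ Ui] := XU _ Xx.
  have [j _ Vj] := (hV' i).1 x (conj Ui Xx).
  by exists (i, j); rewrite ?mem_enum.
by move=> [i j] _ x y Vx Vy; have /ediam_leP := (hV' i).2 j; apply.
Qed.

End covers_operations.

Section dimension.
Context (R : realType) (d : nat) (F : set 'rV[R]_d) (s D theta : R).
Context (s0 : 0 < s) (F0 : F !=set0) (theta01 : 0 < theta < 1)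
  (F_diam : forall x y, F x -> F y -> enorm (x - y) <= D).

(** Scales are written [r = expR (- l)], which turns powers of [r] into linear exponents. Each bound
    concerns an exponent strictly on one side of [s] and may choose its own constant. *)
Context (global_upper : forall a, s < a -> exists K : R, 0 < K /\
  forall l, 0 < l -> exists n,
    covers (expR (- l)) F n /\ n%:R <= K * expR (a * l)).
Context (local_upper : forall a, s < a -> exists K l0 : R, [/\ 0 < K, 0 < l0 &
  forall l x, l0 < l -> F x -> exists n,
    covers (expR (- l)) (eball x (expR (- (theta * l))) `&` F) n /\
    n%:R <= K * expR (a * ((1 - theta) * l))]).
Context (global_lower : forall a, 0 < a -> a < s -> exists K : R, 0 < K /\
  forall l n, 0 < l -> covers (expR (- l)) F n -> K * expR (a * l) <= n%:R).

Lemma box_dim_exists : is_box_dim F s%:E.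
Proof.
have s_gt0 := s0.
split; first by move=> F00; move: F0; rewrite F00 => -[].
(* The restriction [e < s] makes [s - e] an admissible exponent for [global_lower]. *)
move=> _; apply/fine_cvgP; suff key : forall e, 0 < e -> e < s ->
    \forall r \near (0 : R)^'+, exists2 y : R,
      (lne (covering_number r F) * (ln r^-1)^-1%:E)%E = y%:E &
      `|s - y| <= 2 * e.
  have s2 : 0 < s / 2 by lra.
  have s2' : s / 2 < s by lra.
  split; first by apply: filterS (key _ s2 s2') => r [y -> _].
  apply/cvgrPdist_le => e e0.
  pose e' := Num.min (e / 2) (s / 2).
  have e'0 : 0 < e' by rewrite lt_min !divr_gt0.
  have e's : e' < s by rewrite gt_min; apply/orP; right; lra.
  apply: filterS (key _ e'0 e's) => r [y /= -> h].
  apply: le_trans h _; rewrite mulrC -ler_pdivlMr //.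
  by rewrite ge_min lexx.
move=> e e0 es.
have [K [K0 hK]] : exists K : R, 0 < K /\ forall l, 0 < l -> exists n,
    covers (expR (- l)) F n /\ n%:R <= K * expR ((s + e) * l).
  by apply: global_upper; lra.
have [k [k0 hk]] : exists K : R, 0 < K /\
    forall l n, 0 < l -> covers (expR (- l)) F n -> K * expR ((s - e) * l) <= n%:R.
  by apply: global_lower; lra.
(* Beyond [L] the logarithms of both constants are at most [e * l]; together with the change of
   exponent this gives the error [2 * e]. *)
pose L := Num.max 1 ((`|ln K| + `|ln k|) / e).
have : \forall r \near (0 : R)^'+, 0 < r /\ r < expR (- L).
  near=> r; split; near: r; first exact: nbhs_right_gt.
  exact/nbhs_right_lt/expR_gt0.
apply: filterS => r [r0 rL].
pose l := - ln r.
have rE : expR (- l) = r by rewrite opprK lnK.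
have lL : L < l by rewrite ltrNr -ltr_expR lnK.
have l0 : 0 < l by rewrite (le_lt_trans _ lL) // le_max ler01.
have leL : `|ln K| + `|ln k| <= e * l.
  rewrite mulrC -ler_pdivrMr // (le_trans _ (ltW lL)) //.
  by rewrite le_max lexx orbT.
have [n0 [cn0 n0K]] := hK l l0; rewrite rE in cn0.
have lb : ((k * expR ((s - e) * l))%:E <= covering_number r F)%E.
  by apply: le_covering_number => n cn; rewrite lee_fin hk // rE.
have ub : (covering_number r F <= (K * expR ((s + e) * l))%:E)%E.
  by apply: le_trans (covering_number_le cn0) _; rewrite lee_fin.
move: lb ub; case: (covering_number r F) => [y| |] //; rewrite !lee_fin => lb ub.
have ke0 : 0 < k * expR ((s - e) * l) by rewrite mulr_gt0 // expR_gt0.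
have y0 : 0 < y by exact: lt_le_trans lb.
have lnr : ln r^-1 = l by rewrite lnV.
exists (ln y / l); first by rewrite lne_EFin // lnr.
have lb' : ln k + (s - e) * l <= ln y.
  by rewrite -[X in _ + X]expRK -lnM ?posrE ?expR_gt0 // ler_ln ?posrE.
have ub' : ln y <= ln K + (s + e) * l.
  by rewrite -[X in _ + X]expRK -lnM ?posrE ?expR_gt0 // ler_ln ?posrE //
    mulr_gt0 // expR_gt0.
have lnyE : ln y / l * l = ln y by rewrite divfK // gt_eqF.
have hk1 : - ln k <= `|ln k| by rewrite -normrN ler_norm.
have hK1 := ler_norm (ln K).
have hk2 := normr_ge0 (ln k); have hK2 := normr_ge0 (ln K).
have -> : (`|s - ln y / l| <= 2 * e) =
    (ln y - 2 * (e * l) <= s * l <= ln y + 2 * (e * l)).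
  by rewrite ler_distl -(ler_pM2r l0) mulrBl lnyE -mulrA; congr (_ && _);
    rewrite -(ler_pM2r l0) mulrDl lnyE -mulrA.
move: leL lb' ub' hk1 hK1 hk2 hK2; rewrite mulrBl mulrDl.
move: `|ln K| `|ln k| (ln K) (ln k) (ln y) (s * l) (e * l) => aK ak A B C x z.
by move=> *; apply/andP; split; lra.
Unshelve. all: by end_near. Qed.

Let radius_ratio (r rho a l : R) : 0 < r -> r `^ theta = rho -> l = - ln r ->
  rho = expR (- (theta * l)) /\ (rho / r) `^ a = expR (a * ((1 - theta) * l)).
Proof.
move=> r0 <- ->.
have e1 : r `^ theta = expR (- (theta * - ln r)).
  by rewrite /powR gt_eqF // mulrN opprK.
have e2 : r^-1 = expR (- ln r) by rewrite expRN lnK.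
split => //; rewrite e1 e2 -expRD -expRM.
by congr expR; ring.
Qed.

Lemma spectrum_le : (assouad_spectrum theta F <= s%:E)%E.
Proof.
have s_gt0 := s0; have /andP[th0 th1] := theta01.
apply/lee_addgt0Pr => e e0.
pose a := s + e; have sa : s < a by rewrite /a; lra.
have a0 : 0 < a by lra.
have [K [l0 [K0 l00 hK]]] := local_upper sa.
have [K1 [_ hK1]] := global_upper sa.
have [n0 [cn0 _]] := hK1 _ l00.
have D0 : 0 <= D.
  by have [x Fx] := F0; rewrite (le_trans _ (F_diam Fx Fx)) // enorm_ge0.
pose q := expR (a * ((1 - theta) * (- (ln (D + 1) / theta)))).
have q0 : 0 < q by exact: expR_gt0.
apply: ereal_inf_lbound; exists a => //; split; first exact: ltW.
exists (K + n0%:R / q); first by rewrite ltr_pwDl // divr_ge0 // ltW.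
move=> r rho r0 rho0 rE rhoF.
pose l := - ln r.
have rlE : r = expR (- l) by rewrite opprK lnK.
have [rhoE ratioE] := radius_ratio a r0 rE (erefl l).
rewrite ratioE; set Q := expR _.
have Q0 : 0 < Q by exact: expR_gt0.
apply: ge_ereal_sup => _ [x Fx <-].
have [ll0|ll0] := ltP l0 l.
  have [n [cn nK]] := hK l x ll0 Fx.
  rewrite -rlE -rhoE in cn.
  apply: le_trans (covering_number_le cn) _; rewrite lee_fin (le_trans nK) //.
  by rewrite ler_pM2r // lerDl divr_ge0 // ltW.
have cn : covers r F n0 by apply: covers_ler cn0; rewrite rlE ler_expR lerN2.
have cn' : covers r (eball x rho `&` F) n0 by apply: covers_le cn; exact: subIsetr.
apply: le_trans (covering_number_le cn') _; rewrite lee_fin mulrDl.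
apply: (@le_trans _ _ (n0%:R / q * Q)); last by rewrite lerDr mulr_ge0 // ltW.
rewrite -mulrA ler_peMr // ler_pdivlMl // mulr1 ler_expR.
rewrite ler_pM2l // ler_pM2l ?subr_gt0 // lerNl ler_pdivlMr // mulrC.
have rhoD : rho <= D.
  rewrite -lee_fin (le_trans rhoF) //; exact/ediam_leP.
rewrite mulrN -ler_expR -rhoE lnK ?posrE ?(le_trans rhoD) ?lerDl //.
by rewrite ltr_pwDr.
Qed.

(** A set of tiny diameter would be covered by a single set at that scale, against the growth in
    [global_lower]. This makes all small [rho] admissible in the definition of the spectrum. *)
Lemma ediam_pos : exists2 e : R, 0 < e & (e%:E <= ediam F)%E.
Proof.
have s_gt0 := s0.
have [||K [K0 hK]] := global_lower (a := s / 2); [lra|lra|].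
pose l := Num.max 1 (- ln K / (s / 2) + 1).
have l0 : 0 < l by rewrite lt_max ltr01.
exists (expR (- l)); first exact: expR_gt0.
rewrite leNgt; apply/negP => h.
have : covers (expR (- l)) F 1.
  by exists (fun=> F); split => [x Fx|_]; [exists ord0|exact: ltW].
move=> /(hK _ _ l0); apply/negP; rewrite -ltNge.
rewrite -ltr_pdivrMl // mulr1 -[ltLHS]lnK ?posrE ?invr_gt0 // ltr_expR lnV ?posrE //.
rewrite mulrC -ltr_pdivrMr ?divr_gt0 // lt_max; apply/orP; right.
by rewrite ltrDl.
Qed.

Lemma spectrum_ge : (s%:E <= assouad_spectrum theta F)%E.
Proof.
have s_gt0 := s0; have /andP[th0 th1] := theta01.
apply: le_ereal_inf_tmp => _ [a [a0 [C C0 hC]] <-]; rewrite lee_fin leNgt.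
apply/negP => a_s.
(* The available gap [(1 - theta) * (s - a)] is [4 * eta]. The lower bound at scale r loses [eta]
   and the upper bound at scale rho loses [theta * eta], so [dl] remains positive. *)
pose eta := (1 - theta) * (s - a) / 4.
have eta0 : 0 < eta by rewrite /eta divr_gt0 // mulr_gt0 // subr_gt0.
have eta_s : eta < s.
  have : (1 - theta) * (s - a) <= s - a by rewrite ler_piMl ?subr_ge0; lra.
  by rewrite /eta; lra.
have [||k [k0 hk]] := global_lower (a := s - eta); [lra|lra|].
have [|K [K0 hK]] := global_upper (a := s + eta); first lra.
pose dl := (s - eta) - theta * (s + eta) - a * (1 - theta).
have dl0 : 0 < dl.
  have -> : dl = 4 * eta - eta - theta * eta by rewrite /dl /eta; field.
  have : theta * eta < eta by rewrite gtr_pMl.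
  lra.
have [e e0 eF] := ediam_pos.
(* With rho = expR (- theta l) and r = expR (- l), covering F first at scale
   rho / 2 and then locally at scale r bounds the covering number at scale r
   by M * expR ((s - eta - dl) * l). *)
pose M := K * expR ((s + eta) * ln 2) * (C + 2).
have M0 : 0 < M by rewrite !mulr_gt0 ?expR_gt0 // addr_gt0.
(* The second term makes rho at most the diameter of [F]; the third makes [expR (dl * l)] exceed
   [M / k]. *)
pose l := Num.max 1 (Num.max (- ln e / theta) (ln (M / k) / dl + 1)).
have l1 : 1 <= l by rewrite le_max lexx.
have l0 : 0 < l by rewrite (lt_le_trans ltr01).
have le_ : - ln e / theta <= l by rewrite /l !le_max lexx orbT.
have lM : ln (M / k) / dl + 1 <= l by rewrite /l !le_max lexx !orbT.
pose r := expR (- l); pose rho := expR (- (theta * l)).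
have r0 : 0 < r by exact: expR_gt0.
have rho0 : 0 < rho by exact: expR_gt0.
have rE : r `^ theta = rho.
  by rewrite /r /rho -expRM; congr expR; ring.
have [_ ratioE] := radius_ratio a r0 rE (esym (congr1 -%R (expRK (- l)) )).
have rhoF : (rho%:E <= ediam F)%E.
  apply: le_trans eF; rewrite lee_fin -[leRHS]lnK ?posrE // ler_expR lerNl.
  by rewrite mulrC -ler_pdivrMr.
have := hC _ _ r0 rho0 rE rhoF; rewrite ratioE opprK => hC'.
set Q := expR _ in hC'.
have lth : 0 <= theta * l by rewrite mulr_ge0 // ltW.
have Q1 : 1 <= Q.
  rewrite -expR0 ler_expR mulr_ge0 // mulr_ge0 ?subr_ge0 // ltW //.
pose n := (Num.truncn (C * Q + 1)).
have CQ0 : 0 <= C * Q + 1 by rewrite addr_ge0 // mulr_ge0 ?ltW // expR_gt0.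
have /andP[nCQ CQn] := truncn_itv CQ0.
have cloc x : F x -> covers r (eball x rho `&` F) n.
  move=> Fx.
  have : (covering_number r (eball x rho `&` F) < (C * Q + 1)%:E)%E.
    apply: (@le_lt_trans _ _ (C * Q)%:E); last by rewrite lte_fin ltrDl.
    by apply: le_trans hC'; apply: ereal_sup_ubound; exists x.
  move=> /covering_number_lt[m cm]; rewrite lte_fin => mCQ.
  apply: covers_widen cm; first exact: ltW.
  rewrite -ltnS -(ltr_nat R); exact: lt_trans CQn.
have [|m [cm mK]] := hK (theta * l + ln 2).
  by rewrite ltr_wpDl // ln_gt0 // ltr1n.
have half : expR (- (theta * l + ln 2)) = rho / 2.
  by rewrite opprD expRD (expRN (ln 2)) lnK ?posrE.
rewrite half in cm.
have cF : covers r F (m * n).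
  apply: (covers_comp (a := rho / 2) (rho := rho)) => //.
  - exact: ltW.
  - by rewrite divr_ge0 // ltW.
  - by rewrite ltr_pdivrMr // ltr_pMr // ltr1n.
have := hk l _ l0 cF; apply/negP; rewrite -ltNge natrM.
have mn : m%:R * n%:R <= M * expR ((s + eta) * (theta * l)) * Q.
  have nQ : n%:R <= (C + 2) * Q.
    by rewrite (le_trans nCQ) // mulrDl lerD2l; lra.
  apply: le_trans (ler_pM _ _ mK nQ) _ => //.
  by rewrite mulrDr expRD /M le_eqVlt; apply/orP; left; apply/eqP; ring.
apply: le_lt_trans mn _.
have -> : (s - eta) * l = (s + eta) * (theta * l) + a * ((1 - theta) * l) + dl * l.
  by rewrite /dl; ring.
rewrite !expRD -/Q; set E1 := expR _; set E2 := expR _.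
have -> : k * (E1 * Q * E2) = (k * E2) * (E1 * Q) by ring.
rewrite -mulrA ltr_pM2r; last by rewrite !mulr_gt0 ?expR_gt0.
rewrite -ltr_pdivrMl // mulrC -[ltLHS]lnK ?posrE ?divr_gt0 // ltr_expR.
by rewrite [ltRHS]mulrC -ltr_pdivrMr // (lt_le_trans _ lM) // ltrDl.
Qed.

Lemma is_box_dim_spectrum : is_box_dim F (assouad_spectrum theta F).
Proof.
have -> : assouad_spectrum theta F = s%:E.
  by apply/eqP; rewrite eq_le spectrum_le spectrum_ge.
exact: box_dim_exists.
Qed.

End dimension.

(** * Stopping lines *)

Section stopping_line.
Context (R : realType) (Lab T : Type) (N : nat) (root : T -> Lab)
  (shift : 'I_N -> T -> T) (rate : 'I_N -> Lab -> R).

(** Rate 0 encodes an absent map, so positive weight characterises the admissible nodes. *)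
Fixpoint weight (t : T) (v : seq 'I_N) : R :=
  if v is i :: w then rate i (root t) * weight (shift i t) w else 1.

Definition subtree (t : T) (v : seq 'I_N) : T :=
  foldl (fun t i => shift i t) t v.

Definition children (t : T) : seq 'I_N :=
  [seq i <- enum 'I_N | 0 < rate i (root t)].

(* The nodes at which the weight first drops to [r] or below, provided that
   this happens within [n] generations. *)
Fixpoint cut (n : nat) (r : R) (t : T) : seq (seq 'I_N) :=
  if n is m.+1 then
    if r < 1 then
      [seq i :: v | i <- children t, v <- cut m (r / rate i (root t)) (shift i t)]
    else [:: [::]]
  else [:: [::]].

Lemma mem_children t i : (i \in children t) = (0 < rate i (root t)).
Proof. by rewrite mem_filter mem_enum andbT. Qed.

Lemma weight_cat t v w :
  weight t (v ++ w) = weight t v * weight (subtree t v) w.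
Proof. by elim: v t => [|i v IH] t /=; rewrite ?mul1r // IH mulrA. Qed.

Lemma cutSP n r t v : v \in cut n.+1 r t -> r < 1 ->
  exists i w, [/\ v = i :: w, 0 < rate i (root t) &
    w \in cut n (r / rate i (root t)) (shift i t)].
Proof.
rewrite /= => + r1; rewrite r1 => /allpairsPdep[i [w [ic wc ->]]].
by exists i, w; rewrite -mem_children.
Qed.

Lemma cut_root n r t : 1 <= r -> cut n r t = [:: [::]].
Proof. by case: n => //= n; rewrite leNgt => /negbTE ->. Qed.

Lemma cut_uniq n r t : uniq (cut n r t).
Proof.
elim: n r t => //= n IH r t; case: (r < 1) => //.
apply: allpairs_uniq_dep => //.
  by rewrite filter_uniq // enum_uniq.
by move=> [i v] [j w] _ _ /= [-> ->].
Qed.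

Lemma cut_prefix n r t u : 0 < r -> (forall i l, 0 <= rate i l) ->
  0 < weight t u -> (n <= size u)%N ->
  exists2 v, v \in cut n r t & exists w, u = v ++ w.
Proof.
move=> r0 rate0; elim: n r t u r0 => [|n IH] r t u r0 u0 nu.
  by exists [::]; [rewrite inE|exists u].
have [r1|r1] := ltP r 1; last first.
  by exists [::]; [rewrite cut_root ?inE|exists u].
case: u u0 nu => // i u /=.
have := rate0 i (root t); rewrite le_eqVlt => /predU1P[<-|ri].
  by rewrite mul0r ltxx.
rewrite pmulr_rgt0 // ltnS => u0 nu.
have [v vc [w uvw]] := IH (r / rate i (root t)) _ _ (divr_gt0 r0 ri) u0 nu.
exists (i :: v); last by exists w; rewrite uvw.
rewrite r1; apply/allpairsPdep; exists i, v; split=> //.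
by rewrite mem_children.
Qed.

Lemma cut_weight_gt0 n r t v : v \in cut n r t -> 0 < weight t v.
Proof.
elim: n r t v => [|n IH] r t v; first by rewrite inE => /eqP ->.
have [r1|r1] := ltP r 1; last by rewrite cut_root // inE => /eqP ->.
by move=> /cutSP -/(_ r1) [i [w [-> ri /IH]]] /= ?; rewrite mulr_gt0.
Qed.

Context (cmin cmax : R) (cmin0 : 0 < cmin) (cmax1 : cmax < 1)
  (rate_dich : forall i l, rate i l = 0 \/ cmin <= rate i l <= cmax).

Let rate_bounds i l : 0 < rate i l -> cmin <= rate i l <= cmax.
Proof. by have [->|//] := rate_dich i l; rewrite ltxx. Qed.

Lemma rate_ge0 i l : 0 <= rate i l.
Proof.
by have [->//|/andP[h _]] := rate_dich i l; rewrite (le_trans (ltW cmin0)).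
Qed.

Let cut_step n (r x : R) : 0 < r -> cmax ^+ n.+1 <= r -> 0 < x -> x <= cmax ->
  0 < r / x /\ cmax ^+ n <= r / x.
Proof.
move=> r0 nr x0 xc; split; first exact: divr_gt0.
rewrite ler_pdivlMr // (le_trans _ nr) // exprSr ler_wpM2l //.
by rewrite exprn_ge0 // (le_trans (ltW x0)).
Qed.

(** The condition [cmax ^+ n <= r] guarantees that [n] generations bring every weight down to [r],
    so the recursion never stops for lack of generations. It is inherited by the children because
    every rate is at most [cmax]. *)
Lemma cut_weight_le n r t v : 0 < r -> cmax ^+ n <= r ->
  v \in cut n r t -> weight t v <= r.
Proof.
elim: n r t v => [|n IH] r t v r0 nr; first by rewrite inE => /eqP ->.
have [r1|r1] := ltP r 1; last by rewrite cut_root // inE => /eqP ->.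
move=> /cutSP -/(_ r1) [i [w [-> ri wc]]] /=.
have /andP[_ h] := rate_bounds ri.
have [r0' nr'] := cut_step r0 nr ri h.
by have := IH _ _ _ r0' nr' wc; rewrite ler_pdivlMr // mulrC.
Qed.

(** The parent of a cut node still has weight above [r], and the last step costs at most a factor
    [cmin]. *)
Lemma cut_weight_ge n r t v : 0 < r -> cmax ^+ n <= r -> r < 1 ->
  v \in cut n r t -> cmin * r <= weight t v.
Proof.
elim: n r t v => [|n IH] r t v r0 nr r1.
  by move: nr; rewrite expr0 leNgt r1.
move=> /cutSP -/(_ r1) [i [w [-> ri wc]]] /=.
have /andP[h' h] := rate_bounds ri.
have [r0' nr'] := cut_step r0 nr ri h.
have [r1'|r1'] := ltP (r / rate i (root t)) 1.
  have := IH _ _ _ r0' nr' r1' wc.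
  by rewrite mulrA ler_pdivrMr // mulrC [weight _ _ * _]mulrC [r * _]mulrC.
move: wc; rewrite cut_root // inE => /eqP -> /=; rewrite mulr1.
by rewrite (le_trans _ h') // ler_piMr // ltW.
Qed.

(** The parent has weight above [r] and at most [cmax ^+ (size v - 1)]. Hence cut nodes have depth
    of order log (1/r), which converts growth in |v| into growth in the logarithm of the scale. *)
Lemma cut_size n r t v : 0 < r -> cmax ^+ n <= r -> r <= 1 -> 0 < cmax ->
  v \in cut n r t -> r * cmax <= cmax ^+ size v.
Proof.
move=> + + + cmax0; elim: n r t v => [|n IH] r t v r0 nr r1.
  by rewrite inE => /eqP -> /=; rewrite mulr_ile1 // ltW.
have [r1'|r1'] := ltP r 1; last first.
  by rewrite cut_root // inE => /eqP -> /=; rewrite mulr_ile1 // ltW.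
move=> /cutSP -/(_ r1') [i [w [-> ri wc]]] /=.
have /andP[h' h] := rate_bounds ri.
have [r0' nr'] := cut_step r0 nr ri h.
rewrite exprSr ler_pM2r //.
have [q1|q1] := ltP (r / rate i (root t)) 1.
  apply: le_trans (IH _ _ _ r0' nr' (ltW q1) wc).
  by rewrite -mulrA ler_peMr ?(ltW r0) // mulrC ler_pdivlMr // mul1r.
by move: wc; rewrite cut_root // inE => /eqP -> /=.
Qed.

Section powers.
Context (s : R) (s0 : 0 < s).

Let p i l := rate i l `^ s.

Lemma rate_powR01 i l : 0 <= p i l <= 1.
Proof.
rewrite powR_ge0 /=; have [e|/andP[h1 h2]] := rate_dich i l.
  by rewrite /p e powR0 ?gt_eqF.
apply: (@le_trans _ _ (1 `^ s)); last by rewrite powR1.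
rewrite ge0_ler_powR ?nnegrE ?(ltW s0) ?rate_ge0 //.
by rewrite (le_trans h2) // ltW.
Qed.

Let sum_children t (F : 'I_N -> R) :
  \sum_(i < N) p i (root t) * F i = \sum_(i <- children t) p i (root t) * F i.
Proof.
rewrite big_filter big_enum_cond [RHS]big_mkcond /=; apply: eq_bigr => i _.
case: ifPn => //; rewrite -leNgt => h.
have r0 : rate i (root t) = 0 by apply/eqP; rewrite eq_le h rate_ge0.
by rewrite /p r0 powR0 ?gt_eqF // mul0r.
Qed.

Let sum_cut n r t (F : seq 'I_N -> R) : r < 1 ->
  \sum_(v <- cut n.+1 r t) weight t v `^ s * F v =
  \sum_(i < N) p i (root t) *
    \sum_(v <- cut n (r / rate i (root t)) (shift i t))
      weight (shift i t) v `^ s * F (i :: v).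
Proof.
move=> r1; rewrite sum_children /= r1 big_allpairs_dep /=.
rewrite big_seq [RHS]big_seq; apply: eq_bigr => i; rewrite mem_children => ri.
rewrite mulr_sumr big_seq [RHS]big_seq; apply: eq_bigr => v vc.
by rewrite powRM ?mulrA // ?rate_ge0 // ltW // (cut_weight_gt0 vc).
Qed.

(** Cut nodes are distinct and of level at most [n], so their weights are among the terms of the
    total weight. *)
Lemma cut_sum_le_total n r t :
  \sum_(v <- cut n r t) weight t v `^ s <= total_weight root shift p n.+1 t.
Proof.
rewrite (_ : \sum_(v <- _) _ = \sum_(v <- cut n r t) weight t v `^ s * 1); last first.
  by apply: eq_bigr => v _; rewrite mulr1.
have T0 m t' := total_weight_ge0 root shift rate_powR01 m t'.
elim: n r t => [|n IH] r t.
  rewrite big_seq1 /= powR1 mulr1 lerDl sumr_ge0 // => i _.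
  by rewrite mulr0.
have [r1|r1] := ltP r 1; last first.
  rewrite cut_root // big_seq1 /= powR1 mulr1 lerDl sumr_ge0 // => i _.
  rewrite mulr_ge0 //; first by case/andP: (rate_powR01 i (root t)).
  exact: (T0 n.+1).
rewrite sum_cut // [leRHS]/= -[leLHS]add0r lerD // ler_sum // => i _.
by rewrite ler_wpM2l //; case/andP: (rate_powR01 i (root t)).
Qed.

Lemma cut_card_le n r t : 0 < r -> cmax ^+ n <= r -> r < 1 ->
  (size (cut n r t))%:R * (cmin * r) `^ s <= total_weight root shift p n.+1 t.
Proof.
move=> r0 nr r1; apply: le_trans (cut_sum_le_total n r t).
have -> : (size (cut n r t))%:R * (cmin * r) `^ s =
    \sum_(v <- cut n r t) (cmin * r) `^ s.
  by rewrite big_const_seq count_predT iter_addr_0 mulr_natl.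
rewrite big_seq [leRHS]big_seq; apply: ler_sum => v vc.
rewrite ge0_ler_powR ?nnegrE ?(ltW s0) ?mulr_ge0 ?(ltW r0) ?(ltW cmin0) //.
  exact/ltW/cut_weight_gt0/vc.
exact: cut_weight_ge vc.
Qed.

Lemma percolation_le_cut n r t :
  percolation_lim root shift p t <=
  \sum_(v <- cut n r t) weight t v `^ s *
    percolation_lim root shift p (subtree t v).
Proof.
elim: n r t => [|n IH] r t; first by rewrite big_seq1 /= powR1 mul1r.
have [r1|r1] := ltP r 1; last by rewrite cut_root // big_seq1 /= powR1 mul1r.
rewrite sum_cut //; apply: le_trans (percolation_lim_le_sum _ _ rate_powR01 _) _.
apply: ler_sum => i _; rewrite ler_wpM2l //.
by case/andP: (rate_powR01 i (root t)).
Qed.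

Lemma percolation_le_card n r t : 0 < r -> cmax ^+ n <= r ->
  percolation_lim root shift p t <= r `^ s *
    (count (fun v => 0 < percolation_lim root shift p (subtree t v)) (cut n r t))%:R.
Proof.
move=> r0 nr; apply: le_trans (percolation_le_cut n r t) _.
rewrite -sum1_count natr_sum mulr_sumr [leRHS]big_mkcond /=.
rewrite big_seq [leRHS]big_seq; apply: ler_sum => v vc.
have W0 := percolation_lim_ge0 root shift rate_powR01 (subtree t v).
case: ltP => [Wv|Wv]; last first.
  by have -> : percolation_lim root shift p (subtree t v) = 0;
    [apply/eqP; rewrite eq_le Wv W0|rewrite mulr0].
apply: ler_pM => //; first exact: powR_ge0.
  rewrite ge0_ler_powR ?nnegrE ?(ltW s0) ?(ltW r0) //.
    exact/ltW/cut_weight_gt0/vc.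
  exact: cut_weight_le vc.
exact: (percolation_lim_le root shift rate_powR01 0 (subtree t v)).
Qed.

End powers.
End stopping_line.

(** * The attractor of a tree *)

Section attractor.
Context (R : realType) (d : nat) (Lab T : Type) (N : nat) (root : T -> Lab)
  (shift : 'I_N -> T -> T) (rate : 'I_N -> Lab -> R)
  (f : Lab -> 'I_N -> 'rV[R]_d -> 'rV[R]_d).

Fixpoint branch_map (t : T) (v : seq 'I_N) : 'rV[R]_d -> 'rV[R]_d :=
  if v is i :: w then f (root t) i \o branch_map (shift i t) w else id.

Local Notation weight := (weight root shift rate).
Local Notation cut := (cut root shift rate).
Local Notation subtree := (subtree shift).

Context (Delta : set 'rV[R]_d).

Definition level (n : nat) (t : T) : set 'rV[R]_d :=
  [set x | exists v, [/\ size v = n, 0 < weight t v & (branch_map t v @` Delta) x]].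

(** Level 0, which is [Delta], is included; since the levels decrease, the intersection is the same
    as from level 1 on. *)
Definition attractor (t : T) : set 'rV[R]_d := \bigcap_n level n t.

Context (cmin cmax : R) (cmin0 : 0 < cmin) (cmax1 : cmax < 1)
  (rate_dich : forall i l, rate i l = 0 \/ cmin <= rate i l <= cmax).
Context (f_similarity : forall i l, 0 < rate i l -> similarity (rate i l) (f l i)).
Context (Delta_compact : compact Delta)
  (Delta_trap : forall i l, 0 < rate i l -> f l i @` Delta `<=` Delta).

Let weight_gt0 t i v : 0 < weight t (i :: v) ->
  0 < rate i (root t) /\ 0 < weight (shift i t) v.
Proof.
move=> /= h; have := rate_ge0 cmin0 rate_dich i (root t).
rewrite le_eqVlt => /predU1P[e|r0]; first by move: h; rewrite -e mul0r ltxx.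
by move: h; rewrite pmulr_rgt0.
Qed.

Lemma branch_map_cat t v w :
  branch_map t (v ++ w) = branch_map t v \o branch_map (subtree t v) w.
Proof. by elim: v t => [|i v IH] t //=; rewrite IH. Qed.

Lemma branch_map_similarity t v : 0 < weight t v ->
  similarity (weight t v) (branch_map t v).
Proof.
elim: v t => [|i v IH] t; first by move=> _ x y /=; rewrite mul1r.
move=> /weight_gt0[ri wv] x y.
by rewrite [branch_map _ _]/= /= f_similarity // IH // mulrA.
Qed.

Lemma branch_map_trap t v (B : set 'rV[R]_d) : 0 < weight t v ->
  (forall i l, 0 < rate i l -> f l i @` B `<=` B) -> branch_map t v @` B `<=` B.
Proof.
move=> + hB; elim: v t => [|i v IH] t; first by move=> _ _ [x Bx <-].
move=> /weight_gt0[ri wv] _ [x Bx <-] /=; apply: (hB i (root t)) => //.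
by exists (branch_map (shift i t) v x) => //; apply: (IH _ wv); exists x.
Qed.

Let weight_cat_gt0 t v w : 0 < weight t (v ++ w) ->
  0 < weight t v /\ 0 < weight (subtree t v) w.
Proof.
elim: v t => [|i v IH] t; first by move=> h; split => //=.
by move=> /weight_gt0[ri /IH[h1 h2]]; split => //=; rewrite mulr_gt0.
Qed.

Lemma level_decreasing m n t : (m <= n)%N -> level n t `<=` level m t.
Proof.
move=> mn _ [u [un u0 [z Dz <-]]].
move: u0; rewrite -{1}(cat_take_drop m u) => /weight_cat_gt0[h1 h2].
exists (take m u); split => //; first by rewrite size_takel // un.
exists (branch_map (subtree t (take m u)) (drop m u) z).
  by apply: (branch_map_trap h2 Delta_trap); exists z.
by rewrite -[in RHS](cat_take_drop m u) branch_map_cat.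
Qed.

Lemma branch_map_attractor t v : 0 < weight t v ->
  branch_map t v @` attractor (subtree t v) `<=` attractor t.
Proof.
move=> v0 _ [x Fx <-] n _.
have [w [wn w0 [z Dz <-]]] := Fx n Logic.I.
apply: (@level_decreasing n (size (v ++ w))); first by rewrite size_cat wn leq_addl.
exists (v ++ w); split => //; first by rewrite weight_cat mulr_gt0.
by exists z => //; rewrite branch_map_cat.
Qed.

Lemma attractor_sub_Delta t : attractor t `<=` Delta.
Proof.
by move=> x /(_ 0%N Logic.I)[v [/size0nil -> _ [z Dz <-]]].
Qed.

Lemma closed_level n t : closed (level n t).
Proof.
have -> : level n t = \bigcup_(v in [set v : seq 'I_N | size v = n /\ 0 < weight t v])
    (branch_map t v @` Delta).
  by apply/seteqP; split => x; [move=> [v [? ? ?]]; exists v|move=> [v [? ?] ?]; exists v].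
apply: closed_bigcup.
  apply: (@sub_finite_set _ _ [set val v | v in [set: n.-tuple 'I_N]]).
    by move=> v [/eqP vn _]; exists (Tuple vn).
  by apply: finite_image; exact: finite_finset.
move=> v [_ v0]; apply: compact_closed; first exact: norm_hausdorff.
apply: continuous_compact => //; apply: continuous_subspaceT.
exact: (similarity_continuous v0 (branch_map_similarity v0)).
Qed.

(** Cantor's intersection theorem, by a cluster point of points chosen in the successive levels. *)
Lemma attractor_nonempty t : (forall n, level n t !=set0) -> attractor t !=set0.
Proof.
move=> /(_ _)/cid-/all_sig[x hx].
have [p [Dp clp]] : Delta `&` cluster (x @ \oo) !=set0.
  apply: Delta_compact; exists 0%N => // n _.
  have [v [_ v0 h]] := hx n; exact: (branch_map_trap v0 Delta_trap h).
exists p => n _; apply: closed_level => B Bp; apply: clp => //.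
by exists n => // m /= nm; apply: (level_decreasing nm).
Qed.

Context (O : set 'rV[R]_d) (O_open : open O) (a : 'rV[R]_d) (Oa : O a)
  (O_trap : forall i l, 0 < rate i l -> f l i @` O `<=` O)
  (O_sep : forall i j l, 0 < rate i l -> 0 < rate j l ->
     (f l i @` O) `&` (f l j @` O) !=set0 -> i = j).

(** Where two cut nodes first differ, the open set condition separates their images; a common first
    map is cancelled by injectivity. *)
Lemma cut_disjoint n r t v w : v \in cut n r t -> w \in cut n r t ->
  (branch_map t v @` O) `&` (branch_map t w @` O) !=set0 -> v = w.
Proof.
elim: n r t v w => [|n IH] r t v w.
  by rewrite !inE => /eqP -> /eqP ->.
have [r1|r1] := ltP r 1; last by rewrite cut_root // !inE => /eqP -> /eqP ->.
move=> vcut wcut.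
have [i [v' [-> ri vc]]] := cutSP vcut r1.
have [j [w' [-> rj wc]]] := cutSP wcut r1.
rewrite /=.
move=> [x [[y Oy yx] [z Oz zx]]].
have trapO s u := branch_map_trap (t := s) (v := u) (B := O).
have ij : i = j.
  apply: (O_sep ri rj); exists x; split.
    exists (branch_map (shift i t) v' y) => //.
    by apply: (trapO _ _ (cut_weight_gt0 vc) O_trap); exists y.
  exists (branch_map (shift j t) w' z) => //.
  by apply: (trapO _ _ (cut_weight_gt0 wc) O_trap); exists z.
subst j; congr cons; apply: (IH _ _ _ _ vc wc).
exists (branch_map (shift i t) v' y); split; first by exists y.
exists z => //; apply: (similarity_inj ri (f_similarity ri)).
exact: etrans zx (esym yx).
Qed.

(** The cut pieces have size comparable to [r], so the images of one point [a] of [O] are separated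
    by a multiple of [r], while those of the pieces near [x] stay within a multiple of [r] from [x].
    Packing then bounds their number. *)
Lemma near_cut_bound : exists M : nat, forall n r t (x : 'rV[R]_d),
  0 < r -> cmax ^+ n <= r -> r < 1 ->
  (count (fun v => `[< exists2 z, Delta z & (`|branch_map t v z - x| <= r)%R >])
     (cut n r t) <= M)%N.
Proof.
have [rho /= rho0 rhoO] : exists2 rho : R, 0 < rho & forall y, `|a - y| < rho -> O y.
  have /nbhs_ballP[rho rho0 h] := open_nbhs_nbhs (conj O_open Oa).
  by exists rho => // y ay; apply: h; rewrite -ball_normE.
have [D [D0 hD]] : exists D : R, 0 <= D /\ forall z, Delta z -> enorm (a - z) <= D.
  have [B [_ hB]] := compact_bounded Delta_compact.
  have := hB (`|B| + 1) _; rewrite ltr_pwDr ?ler_norm // => /(_ isT) {}hB.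
  exists (d%:R * (`|a| + (`|B| + 1))); split; first by rewrite mulr_ge0 // !addr_ge0.
  move=> z Dz; apply: le_trans (enorm_le_norm _) _; rewrite ler_wpM2l //.
  by rewrite (le_trans (ler_normB _ _)) // lerD2l; exact: hB.
have [M hM] := @packing_bound R d (D + 1) (rho * cmin) ltac:(lra) (mulr_gt0 rho0 cmin0).
exists M => n r t x r0 nr r1; rewrite -size_filter.
apply: (hM r _ _ (fun v => branch_map t v a) x r0).
- by rewrite filter_uniq // cut_uniq.
- move=> v; rewrite mem_filter => /andP[/asboolP[z Dz zx] vc].
  have v0 := cut_weight_gt0 vc.
  rewrite -(subrK (branch_map t v z) (branch_map t v a)) -addrA.
  apply: le_trans (ler_normD _ _) _; rewrite mulrDl mul1r lerD //.
  apply: le_trans (norm_le_enorm _) _; rewrite (branch_map_similarity v0) mulrC.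
  rewrite ler_pM ?enorm_ge0 ?hD ?(ltW v0) //.
  exact: (cut_weight_le rate_dich r0 nr vc).
- move=> v w; rewrite !mem_filter => /andP[_ vc] /andP[_ wc] vw.
  rewrite leNgt; apply/negP => h.
  have v0 := cut_weight_gt0 vc; have w0 := cut_weight_gt0 wc.
  (* If the images of [a] under [v] and [w] were too close, the preimage [z] under the map of [w]
     would lie so near [a] that it belongs to [O], and the two images of [O] would meet. *)
  have [z zE] := similarity_surj w0 (branch_map_similarity w0) (branch_map t v a).
  move: h; rewrite -zE (branch_map_similarity w0) => h.
  have cw : cmin * r <= weight t w.
    exact: (cut_weight_ge cmin0 rate_dich r0 nr r1 wc).
  have Oz : O z.
    apply: rhoO; rewrite distrC; apply: le_lt_trans (norm_le_enorm _) _.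
    rewrite -(ltr_pM2l w0); apply: lt_le_trans h _.
    by rewrite -mulrA [leRHS]mulrC ler_pM2l.
  move/eqP: vw; apply; apply: (cut_disjoint vc wc).
  by exists (branch_map t v a); split; [exists a|exists z].
Qed.

Let near (t : T) (x : 'rV[R]_d) (r : R) (v : seq 'I_N) : bool :=
  `[< exists2 z, Delta z & `|branch_map t v z - x| <= r >].

Let rate0 i l : 0 <= rate i l := rate_ge0 cmin0 rate_dich i l.

Lemma cut_depth n r t v : v \in cut n r t -> (size v <= n)%N.
Proof.
elim: n r t v => [|n IH] r t v; first by rewrite inE => /eqP ->.
have [r1|r1] := ltP r 1; last by rewrite cut_root // inE => /eqP ->.
by move=> vc; have [i [w [-> ri /IH]]] := cutSP vc r1.
Qed.

Context (cmax0 : 0 < cmax) (D : R) (D_ge1 : 1 <= D)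
  (Delta_diam : forall z z', Delta z -> Delta z' -> enorm (z - z') <= D).

Let D_gt0 : 0 < D := lt_le_trans ltr01 D_ge1.

Let branch_diam t v (r : R) : 0 < weight t v -> weight t v <= r ->
  forall x y, (branch_map t v @` Delta) x -> (branch_map t v @` Delta) y ->
  enorm (x - y) <= r * D.
Proof.
move=> v0 vr _ _ [z Dz <-] [z' Dz' <-]; rewrite (branch_map_similarity v0).
by rewrite ler_pM ?enorm_ge0 ?(ltW v0) // Delta_diam.
Qed.

Lemma covers_attractor n r t : 0 < r -> cmax ^+ n <= r ->
  covers (r * D) (attractor t) (size (cut n r t)).
Proof.
move=> r0 nr; apply: (covers_seq (V := fun v => branch_map t v @` Delta)).
- by rewrite mulr_ge0 ?(ltW r0) ?(ltW D_gt0).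
- move=> x /(_ n Logic.I)[u [un u0 [z Dz <-]]].
  have [|v vc [w uvw]] := cut_prefix (n := n) r0 rate0 u0; first by rewrite un.
  move: u0; rewrite uvw => /weight_cat_gt0[v0 w0].
  exists v => //; exists (branch_map (subtree t v) w z).
    by apply: (branch_map_trap w0 Delta_trap); exists z.
  by rewrite branch_map_cat.
- move=> v vc; apply: branch_diam; first exact: cut_weight_gt0 vc.
  exact: (cut_weight_le rate_dich r0 nr vc).
Qed.

(** Two stopping lines in succession: each piece of size rho near [x] is subdivided by a cut of its
    own subtree at the relative scale [r / weight t v]. *)
Lemma covers_ball n1 n2 rho r t x : 0 < rho -> cmax ^+ n1 <= rho -> rho <= 1 ->
  0 < r -> cmax ^+ n2 <= r ->
  covers (r * D) (eball x rho `&` attractor t)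
    (\sum_(v <- cut n1 rho t | near t x rho v)
       size (cut n2 (r / weight t v) (subtree t v))).
Proof.
move=> rho0 nrho rho1 r0 nr.
pose s := [seq v ++ w | v <- [seq v <- cut n1 rho t | near t x rho v],
  w <- cut n2 (r / weight t v) (subtree t v)].
have <- : size s = (\sum_(v <- cut n1 rho t | near t x rho v)
       size (cut n2 (r / weight t v) (subtree t v)))%N.
  by rewrite size_allpairs_dep sumnE big_map big_filter.
apply: (covers_seq (V := fun v => branch_map t v @` Delta)).
- by rewrite mulr_ge0 ?(ltW r0) ?(ltW D_gt0).
(* The first cut is crossed within [n1] generations, which leaves at least [n2] for the second. *)
- move=> y [xy /(_ (n1 + n2)%N Logic.I)[u [un u0 [z Dz yE]]]].
  have [|v vc [u' uvw]] := cut_prefix (n := n1) rho0 rate0 u0.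
    by rewrite un leq_addr.
  move: u0; rewrite uvw => /weight_cat_gt0[v0 u'0].
  have u'n : (n2 <= size u')%N.
    by rewrite -(leq_add2l n1) -un uvw size_cat leq_add2r (cut_depth vc).
  have [w wc [u'' u'E]] := cut_prefix (divr_gt0 r0 v0) rate0 u'0 u'n.
  move: (u'0); rewrite u'E => /weight_cat_gt0[w0 u''0].
  exists (v ++ w).
    apply/allpairsPdep; exists v, w; split => //; rewrite mem_filter vc andbT.
    apply/asboolP; exists (branch_map (subtree t v) u' z).
      by apply: (branch_map_trap u'0 Delta_trap); exists z.
    have -> : branch_map t v (branch_map (subtree t v) u' z) = y.
      by rewrite -yE uvw branch_map_cat.
    exact: le_trans (norm_le_enorm _) (ltW xy).
  exists (branch_map (subtree (subtree t v) w) u'' z).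
    by apply: (branch_map_trap u''0 Delta_trap); exists z.
  by rewrite -yE uvw u'E !branch_map_cat.
- move=> _ /allpairsPdep[v [w [+ wc ->]]]; rewrite mem_filter => /andP[_ vc].
  have v0 := cut_weight_gt0 vc; have w0 := cut_weight_gt0 wc.
  have v1 : weight t v <= 1.
    exact: le_trans (cut_weight_le rate_dich rho0 nrho vc) rho1.
  apply: branch_diam; first by rewrite weight_cat mulr_gt0.
  rewrite weight_cat mulrC -ler_pdivlMr //.
  apply: (cut_weight_le rate_dich (divr_gt0 r0 v0)) wc.
  by rewrite ler_pdivlMr // (le_trans _ nr) // ler_piMr // exprn_ge0 // ltW.
Qed.

(** Double counting of incidences: every counted piece meets some set of the cover, and a set of
    diameter at most [r] lies within [r] of one of its points, hence meets at most [M] pieces. *)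
Lemma count_cut_le_covers (M n n0 : nat) r t (Q : pred (seq 'I_N)) :
  (forall x, count (near t x r) (cut n0 r t) <= M)%N -> 0 <= r ->
  (forall v, v \in cut n0 r t -> Q v -> attractor (subtree t v) !=set0) ->
  covers r (attractor t) n -> (count Q (cut n0 r t) <= n * M)%N.
Proof.
move=> hM r0 hQ [U [FU hU]]; set s := cut n0 r t.
pose meets j v := `[< exists2 y, Delta y & U j (branch_map t v y) >].
apply: (@leq_trans (\sum_(j < n) count (meets j) s)).
  rewrite -sum1_count big_mkcond /=.
  under [leqRHS]eq_bigr do rewrite -sum1_count big_mkcond /=.
  rewrite exchange_big /= big_seq [leqRHS]big_seq leq_sum // => v vs.
  have [Qv|//] := boolP (Q v); have [y Fy] := hQ _ vs Qv.
  have v0 := cut_weight_gt0 vs.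
  have [j _ Uj] := FU (branch_map t v y)
    (branch_map_attractor v0 (imageP _ Fy)).
  rewrite (bigD1 j) //= (_ : meets j v) //; apply/asboolP.
  by exists y => //; exact: attractor_sub_Delta Fy.
rewrite -[n in leqRHS]card_ord -sum_nat_const leq_sum // => j _.
have [/hasP[v0 _ /asboolP[y0 Dy0 Uy0]]|] := boolP (has (meets j) s); last first.
  by rewrite has_count -eqn0Ngt => /eqP ->.
apply: leq_trans (hM (branch_map t v0 y0)); apply: sub_count => v /asboolP[y Dy Uy].
apply/asboolP; exists y => //; apply: le_trans (norm_le_enorm _) _.
by have /ediam_leP := hU j; apply.
Qed.

Context (Delta0 : Delta !=set0).

Lemma percolation_level (b : R) n t : 0 < b ->
  0 < percolation root shift (fun i l => rate i l `^ b) n t -> level n t !=set0.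
Proof.
move=> b0 h; suff [v [vn v0]] : exists v, size v = n /\ 0 < weight t v.
  by have [z Dz] := Delta0; exists (branch_map t v z), v; split => //; exists z.
elim: n t h => [|n IH] t h; first by exists [::].
have : 0 < \sum_(i < N) rate i (root t) `^ b *
    percolation root shift (fun i l => rate i l `^ b) n (shift i t).
  apply: lt_le_trans h _; apply: percolation_le_sum.
  exact: (rate_powR01 cmin0 cmax1 rate_dich b0).
rewrite lt0r => /andP[+ _]; rewrite psumr_neq0; last first.
  move=> i _; rewrite mulr_ge0 ?powR_ge0 //.
  by case/andP: (percolation01 root shift
    (rate_powR01 cmin0 cmax1 rate_dich b0) n (shift i t)).
move=> /hasP[i _ /= hi].
have ri : 0 < rate i (root t).
  rewrite lt_neqAle rate0 andbT; apply/eqP => e.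
  by move: hi; rewrite -e powR0 ?gt_eqF // mul0r ltxx.
rewrite pmulr_rgt0 ?powR_gt0 // in hi.
have [v [vn v0]] := IH _ hi.
by exists (i :: v); rewrite /= vn mulr_gt0.
Qed.

Lemma exists_expr_le (x r : R) : 0 < x -> x < 1 -> 0 < r -> exists n, x ^+ n <= r.
Proof.
move=> x0 x1 r0.
have L0 : 0 < - ln x by rewrite oppr_gt0 -ln1 ltr_ln ?posrE.
have := archi_boundP (divr_ge0 (normr_ge0 (ln r)) (ltW L0)).
move: (Num.bound _) => n; rewrite ltr_pdivrMr // => h; exists n.
rewrite -[x]lnK ?posrE // -expRM_natl -[leRHS]lnK ?posrE // ler_expR.
rewrite -lerN2 -mulrN (le_trans _ (ltW h)) //.
by rewrite -normrN ler_norm.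
Qed.

Context (t : T) (s theta : R) (s0 : 0 < s) (theta01 : 0 < theta < 1).
(** The two almost sure properties of the tree. Given them, the argument for the fixed [t] is
    deterministic. *)
Context (total_growth : forall b, s < b -> exists A C : R, 0 <= A /\
  forall v n, total_weight root shift (fun i l => rate i l `^ b) n (subtree t v)
    <= C + A * (size v)%:R).
Context (percolates : forall b, 0 < b -> b < s ->
  0 < percolation_lim root shift (fun i l => rate i l `^ b) t).

Let expR_lt1 (l : R) : 0 < l -> expR (- l) < 1.
Proof. by move=> l0; rewrite -expR0 ltr_expR oppr_lt0. Qed.

Let scale (b : R) : 0 < (cmin / D) `^ b.
Proof. by rewrite powR_gt0 // divr_gt0. Qed.

Let powR_scale (l b : R) :
  (cmin * (expR (- l) / D)) `^ b = (cmin / D) `^ b * expR (- (b * l)).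
Proof.
have -> : cmin * (expR (- l) / D) = cmin / D * expR (- l) by ring.
rewrite powRM ?expR_ge0 ?divr_ge0 ?(ltW cmin0) ?(ltW D_gt0) // -expRM.
by congr (_ * expR _); ring.
Qed.

Lemma attractor_global_upper b : s < b -> exists K : R, 0 < K /\
  forall l, 0 < l -> exists n,
    covers (expR (- l)) (attractor t) n /\ n%:R <= K * expR (b * l).
Proof.
move=> sb; have b0 : 0 < b by exact: lt_trans sb.
have [A [C [A0 hC]]] := total_growth sb.
exists ((`|C| + 1) / (cmin / D) `^ b); split.
  by rewrite divr_gt0 // ltr_wpDl.
(* A piece of weight at most [r] has diameter at most [r * D]; the bound [1 <= D] keeps [r] below
   1. *)
move=> l l0; pose r := expR (- l) / D.
have r0 : 0 < r by rewrite divr_gt0 // expR_gt0.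
have r1 : r < 1.
  by rewrite ltr_pdivrMr // mul1r (lt_le_trans (expR_lt1 l0)).
have [n nr] := exists_expr_le cmax0 cmax1 r0.
exists (size (cut n r t)); split.
  rewrite -[expR (- l)](divfK (_ : D != 0)) ?gt_eqF //.
  exact: covers_attractor.
have := cut_card_le root shift cmin0 cmax1 rate_dich b0 t r0 nr r1.
move=> /le_trans/(_ (hC [::] n.+1)); rewrite mulr0 addr0 powR_scale expRN => h.
rewrite mulrAC ler_pdivlMr // -ler_pdivrMr ?expR_gt0 // -mulrA.
by rewrite (le_trans h) // (le_trans (ler_norm C)) // lerDl.
Qed.

Lemma attractor_local_upper g : s < g -> exists K l0 : R, [/\ 0 < K, 0 < l0 &
  forall l x, l0 < l -> attractor t x -> exists n,
    covers (expR (- l)) (eball x (expR (- (theta * l))) `&` attractor t) n /\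
    n%:R <= K * expR (g * ((1 - theta) * l))].
Proof.
move=> sa; have /andP[th0 th1] := theta01.
have s_gt0 := s0.
pose b := (s + g) / 2.
have sb : s < b by rewrite /b; lra.
have ba : b < g by rewrite /b; lra.
have b0 : 0 < b by exact: lt_trans sb.
have [A [C [A0 hC]]] := total_growth sb.
(* Chosen so that [eps * (theta * l)] equals [(g - b) * ((1 - theta) * l)], the room between the
   exponents [b] and [g]. *)
pose eps := (g - b) * (1 - theta) / theta.
have eps0 : 0 < eps by rewrite divr_gt0 // mulr_gt0 // subr_gt0.
have [M hM] := near_cut_bound.
pose Lc := - ln cmax.
have Lc0 : 0 < Lc by rewrite oppr_gt0 -ln1 ltr_ln ?posrE.
(* With [size v <= 1 + theta * l / Lc] this gives [C + A * size v <= C1 * (1 + eps * (theta * l))],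
   and the last factor is at most [expR (eps * (theta * l))]. *)
pose C1 := `|C| + A + A / (eps * Lc).
have C1_ge0 : 0 <= C1.
  by rewrite !addr_ge0 // divr_ge0 // mulr_ge0 // ltW.
(* The threshold ensures [r < cmin * rho], so that the relative scale is below 1 at every node of
   the first cut. The added 1 only keeps the constant positive. *)
exists (M%:R * (C1 / (cmin / D) `^ b) + 1), (1 + `|ln cmin| / (1 - theta)).
split.
- by rewrite ltr_wpDl // mulr_ge0 // divr_ge0 // ltW.
- by rewrite ltr_pwDl // divr_ge0 // subr_ge0 ltW.
move=> l x ll0 _.
have l0 : 0 < l.
  by apply: lt_trans ll0; rewrite ltr_pwDl // divr_ge0 // subr_ge0 ltW.
have thl0 : 0 < theta * l by rewrite mulr_gt0.
pose rho := expR (- (theta * l)); pose r := expR (- l) / D.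
have rho0 : 0 < rho by exact: expR_gt0.
have rho1 : rho < 1 by exact: expR_lt1.
have r0 : 0 < r by rewrite divr_gt0 // expR_gt0.
have r_rho : r < cmin * rho.
  rewrite /r ltr_pdivrMr //; apply: (@lt_le_trans _ _ (cmin * rho)); last first.
    by rewrite ler_peMr // mulr_ge0 // ltW.
  rewrite -[cmin]lnK ?posrE // /rho -expRD ltr_expR.
  have h : `|ln cmin| < (1 - theta) * l.
    rewrite mulrC -ltr_pdivrMr ?subr_gt0 //; apply: lt_trans ll0.
    by rewrite ltrDr.
  have h' : - ln cmin <= `|ln cmin| by rewrite -normrN ler_norm.
  move: h h'; rewrite mulrBl mul1r; move: (theta * l) `|_| => y z; lra.
have [n1 nrho] := exists_expr_le cmax0 cmax1 rho0.
have [n2 nr] := exists_expr_le cmax0 cmax1 r0.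
exists (\sum_(v <- cut n1 rho t | near t x rho v)
  size (cut n2 (r / weight t v) (subtree t v)))%N; split.
  rewrite -[expR (- l)](divfK (_ : D != 0)) ?gt_eqF // -/r.
  by apply: covers_ball => //; exact: ltW.
pose B := C1 / (cmin / D) `^ b * expR (g * ((1 - theta) * l)).
have B0 : 0 <= B by rewrite mulr_ge0 ?expR_ge0 // divr_ge0 // ltW.
have hB v : v \in cut n1 rho t ->
    (size (cut n2 (r / weight t v) (subtree t v)))%:R <= B.
  move=> vc; have v0 := cut_weight_gt0 vc.
  have vrho := cut_weight_le rate_dich rho0 nrho vc.
  have vge := cut_weight_ge cmin0 rate_dich rho0 nrho rho1 vc.
  have rv0 : 0 < r / weight t v by rewrite divr_gt0.
  have rv1 : r / weight t v < 1.
    by rewrite ltr_pdivrMr // mul1r (lt_le_trans r_rho).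
  have nrv : cmax ^+ n2 <= r / weight t v.
    rewrite ler_pdivlMr // (le_trans _ nr) // ler_piMr ?exprn_ge0 ?(ltW cmax0) //.
    exact: le_trans vrho (ltW rho1).
  have := cut_card_le root shift cmin0 cmax1 rate_dich b0 (subtree t v) rv0 nrv rv1.
  move=> /le_trans/(_ (hC v n2.+1)) h1.
  have vsize : Lc * (size v)%:R <= Lc + theta * l.
    have := cut_size cmax1 rate_dich rho0 nrho (ltW rho1) cmax0 vc.
    rewrite -[cmax]lnK ?posrE // -expRM_natl /rho -expRD ler_expR /Lc.
    have -> : - ln cmax * (size v)%:R = - ((size v)%:R * ln cmax) by ring.
    by move: ((size v)%:R * ln cmax) (theta * l) (ln cmax) => y z w; lra.
  have hC1 : C + A * (size v)%:R <= C1 * expR (eps * (theta * l)).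
    apply: (@le_trans _ _ (C1 * (1 + eps * (theta * l)))); last first.
      by rewrite ler_wpM2l // expR_ge1Dx.
    have h2 : A * (size v)%:R <= A + A / (eps * Lc) * (eps * (theta * l)).
      have -> : A / (eps * Lc) * (eps * (theta * l)) = A * (theta * l / Lc).
        by field; rewrite !gt_eqF.
      rewrite -[X in X + _]mulr1 -mulrDr ler_wpM2l // -(ler_pM2l Lc0).
      by rewrite mulrDr mulr1 [_ * (_ / _)]mulrCA divff ?mulr1 ?gt_eqF.
    have h3 : 0 <= (`|C| + A) * (eps * (theta * l)).
      by rewrite mulr_ge0 ?addr_ge0 // mulr_ge0 // ltW.
    have h4 : 0 <= A / (eps * Lc) by rewrite divr_ge0 // mulr_ge0 // ltW.
    have h5 := ler_norm C.
    rewrite /C1; move: h2 h3 h4 h5.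
    move: (A / (eps * Lc)) (A * (size v)%:R) (eps * (theta * l)) => y z w; lra.
  have h6 : (cmin / D) `^ b * expR (- (b * ((1 - theta) * l))) <=
      (cmin * (r / weight t v)) `^ b.
    rewrite -powR_scale ge0_ler_powR ?nnegrE ?(ltW b0) //.
    - by rewrite mulr_ge0 ?(ltW cmin0) // divr_ge0 ?expR_ge0 // ltW.
    - by rewrite mulr_ge0 ?(ltW cmin0) // ltW.
    rewrite ler_pM2l // ler_pdivlMr // /r mulrAC ler_pM2r ?invr_gt0 //.
    apply: (@le_trans _ _ (expR (- ((1 - theta) * l)) * rho)).
      by rewrite ler_pM2l ?expR_gt0.
    by rewrite /rho -expRD ler_expR mulrBl mul1r; lra.
  have h7 := le_trans h1 hC1.
  have aE : g * ((1 - theta) * l) = eps * (theta * l) + b * ((1 - theta) * l).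
    by rewrite /eps; field; rewrite gt_eqF.
  have := le_trans (ler_wpM2l (ler0n R _) h6) h7.
  rewrite (expRN (b * _)) [_%:R * _]mulrA ler_pdivrMr ?expR_gt0 // => h8.
  rewrite /B aE expRD; set E1 := expR _; set E2 := expR _.
  have -> : C1 / (cmin / D) `^ b * (E1 * E2) = C1 * E1 * E2 / (cmin / D) `^ b.
    by ring.
  by rewrite ler_pdivlMr.
apply: (@le_trans _ _ (M%:R * B)).
  apply: (@le_trans _ _ (\sum_(v <- cut n1 rho t | near t x rho v) B)).
    rewrite natr_sum big_seq_cond [leRHS]big_seq_cond.
    by apply: ler_sum => v /andP[vc _]; exact: hB.
  rewrite big_const_seq iter_addr_0 -[B *+ _]mulr_natl ler_wpM2r // ler_nat.
  exact: hM.
by rewrite mulrDl mul1r /B mulrA lerDl expR_ge0.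
Qed.

Lemma attractor_global_lower b : 0 < b -> b < s -> exists K : R, 0 < K /\
  forall l n, 0 < l -> covers (expR (- l)) (attractor t) n ->
    K * expR (b * l) <= n%:R.
Proof.
move=> b0 bs; have W0 := percolates b0 bs; set W := percolation_lim _ _ _ _ in W0.
have [M hM] := near_cut_bound.
exists (W / M.+1%:R); split; first by rewrite divr_gt0 // ltr0n.
move=> l n l0 cn.
have r1 := expR_lt1 l0; have r0 : 0 < expR (- l) by exact: expR_gt0.
have [n0 nr] := exists_expr_le cmax0 cmax1 r0.
have h := percolation_le_card root shift cmin0 cmax1 rate_dich b0 t r0 nr.
have hc : (count (fun v => (0 < percolation_lim root shift
    (fun i l => rate i l `^ b) (subtree t v))%R) (cut n0 (expR (- l)) t) <= n * M)%N.
  apply: (count_cut_le_covers _ (ltW r0) _ cn) => [x|v vc Wv]; first exact: hM.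
  apply: attractor_nonempty => m.
  apply: (percolation_level b0); apply: lt_le_trans Wv _.
  exact: (percolation_lim_le root shift (rate_powR01 cmin0 cmax1 rate_dich b0)).
rewrite -/W -expRM mulNr in h.
rewrite mulrAC ler_pdivrMr ?ltr0n //.
rewrite -[expR (b * l)]invrK -expRN ler_pdivrMr ?expR_gt0 //.
apply: le_trans h _; rewrite [l * b]mulrC [leLHS]mulrC ler_pM2r ?expR_gt0 //.
by rewrite -natrM ler_nat (leq_trans hc) // leq_mul.
Qed.

Lemma attractor_dimension : attractor t !=set0 ->
  is_box_dim (attractor t) (assouad_spectrum theta (attractor t)).
Proof.
move=> F0; apply: (is_box_dim_spectrum (s := s) (D := D)) => //.
- by move=> x y /attractor_sub_Delta Dx /attractor_sub_Delta Dy; exact: Delta_diam.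
- exact: attractor_global_upper.
- exact: attractor_local_upper.
- exact: attractor_global_lower.
Qed.

End attractor.

(** * The critical exponent *)

Section critical_exponent.
Context (R : realType) (d1 : measure_display) (Lab : measurableType d1)
  (N : nat) (mu : probability Lab R) (rate : 'I_N -> Lab -> R)
  (mrate : forall i, measurable_fun setT (rate i)).
Context (cmin cmax : R) (cmin0 : 0 < cmin) (cmin_le : cmin <= cmax)
  (cmax1 : cmax < 1)
  (rate_dich : forall i l, rate i l = 0 \/ cmin <= rate i l <= cmax).
Context (mean_gt1 : 1 < \int[mu]_l (\sum_(i < N) ((0 < rate i l)%R%:R : R))).

Let cmax0 : 0 < cmax := lt_le_trans cmin0 cmin_le.

Let p b i l := rate i l `^ b.

Let p01 b : 0 < b -> forall i l, 0 <= p b i l <= 1.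
Proof. by move=> b0; exact: (rate_powR01 cmin0 cmax1 rate_dich b0). Qed.

Lemma measurable_rate_powR b i : measurable_fun setT (p b i).
Proof. exact: (measurableT_comp (measurable_powR b) (mrate i)). Qed.

Let phi b := \int[mu]_l (\sum_(i < N) p b i l).

Let bounded_sum b : 0 < b ->
  bounded_measurable (fun l => \sum_(i < N) p b i l).
Proof.
move=> b0; apply: bounded_measurable_sum => i.
split; first exact: measurable_rate_powR.
by exists 1 => l; have /andP[h0 h1] := p01 b0 i l; rewrite ger0_norm.
Qed.

(** This holds term by term. The quantitative decrease makes continuity of [phi] dispensable: it
    forces [phi] below 1 for large exponents and turns [phi b' >= 1] into [phi b > 1] for
    [b < b']. *)
Let phi_shrink b h : 0 < b -> 0 < h -> phi (b + h) <= cmax `^ h * phi b.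
Proof.
move=> b0 h0; have bh0 : 0 < b + h by rewrite addr_gt0.
rewrite /phi -RintegralZl_bounded; last exact: bounded_sum.
apply: le_Rintegral_bounded; first exact: bounded_sum.
  apply: bounded_measurableM; first exact: bounded_measurable_cst.
  exact: bounded_sum.
move=> l; rewrite mulr_sumr; apply: ler_sum => i _; rewrite /p.
have [->|/andP[h1 h2]] := rate_dich i l.
  by rewrite !powR0 ?gt_eqF // mulr0.
have r0 : 0 < rate i l by exact: lt_le_trans h1.
rewrite powRD; last by apply/implyP => _; rewrite gt_eqF.
rewrite mulrC ler_wpM2r ?powR_ge0 // ge0_ler_powR ?nnegrE ?(ltW h0) ?(ltW r0) //.
exact: ltW.
Qed.

Let phi_small : exists2 b, 0 < b & 1 < phi b.
Proof.
have := mean_gt1; set E := Rintegral _ _ _ => E1.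
have E0 : 0 < E by exact: lt_trans E1.
have c1 : cmin < 1 by exact: le_lt_trans cmax1.
have lc : 0 < - ln cmin by rewrite oppr_gt0 -ln1 ltr_ln ?posrE.
pose b := ln E / - ln cmin / 2.
have b0 : 0 < b by rewrite !divr_gt0 // ln_gt0.
exists b => //; apply: (@lt_le_trans _ _ (cmin `^ b * E)).
  rewrite -[E]lnK ?posrE // /powR gt_eqF // -expRD -expR0 ltr_expR.
  have -> : b * ln cmin + ln E = ln E / 2.
    by rewrite /b; field; rewrite -oppr_eq0 gt_eqF.
  by rewrite divr_gt0 // ln_gt0.
have bq : bounded_measurable (fun l => \sum_(i < N) ((0 < rate i l)%R%:R : R)).
  apply: bounded_measurable_sum => i; split.
    have -> : (fun l => (0 < rate i l)%R%:R : R) = (fun l => (0 < p 1 i l)%R%:R).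
      by apply/funext => l; rewrite /p powRr1 // (rate_ge0 cmin0 rate_dich).
    apply: measurable_support => //; first exact: measurable_rate_powR.
    exact: p01.
  by exists 1 => l; case: (0 < rate i l); rewrite ?normr1 ?normr0.
rewrite /E -RintegralZl_bounded //; apply: le_Rintegral_bounded.
- by apply: bounded_measurableM => //; exact: bounded_measurable_cst.
- exact: bounded_sum.
move=> l; rewrite mulr_sumr; apply: ler_sum => i _; rewrite /p.
case: ltP => ri; last by rewrite mulr0 powR_ge0.
have [e|/andP[h1 h2]] := rate_dich i l; first by rewrite e ltxx in ri.
by rewrite mulr1 ge0_ler_powR ?nnegrE ?(ltW b0) ?(ltW cmin0) ?(ltW ri).
Qed.

Let phi_large : exists B, forall b, B <= b -> phi b < 1.
Proof.
have [b0 b00 _] := phi_small.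
have phi0 : 0 <= phi b0.
  by apply: Rintegral_ge0 => l _; apply: sumr_ge0 => i _; exact: powR_ge0.
have phi1 : 0 < phi b0 + 1 by rewrite ltr_wpDl.
have e0 : 0 < (phi b0 + 1)^-1 by rewrite invr_gt0.
have [n hn] := exists_expr_le cmax0 cmax1 e0.
exists (b0 + n.+1%:R) => b hb.
have hn1 : n.+1%:R <= b - b0 by rewrite lerBrDl.
have h0 : 0 < b - b0 by rewrite (lt_le_trans _ hn1) // ltr0n.
have := phi_shrink b00 h0; rewrite addrC subrK => /le_lt_trans; apply.
apply: (@le_lt_trans _ _ ((phi b0 + 1)^-1 * phi b0)); last first.
  by rewrite mulrC ltr_pdivrMr // mul1r ltrDl.
rewrite ler_wpM2r // (le_trans _ hn) // -powR_mulrn ?(ltW cmax0) //.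
have -> : cmax = expR (ln cmax) by rewrite lnK.
rewrite -!expRM ler_expR ler_wnM2l //.
  by rewrite -ln1 ler_ln ?posrE // ltW.
by rewrite (le_trans _ hn1) // ler_nat.
Qed.

Lemma critical_exponent_exists : exists2 s, 0 < s &
  (forall b, s < b -> \int[mu]_l (\sum_(i < N) rate i l `^ b) < 1) /\
  (forall b, 0 < b -> b < s -> 1 < \int[mu]_l (\sum_(i < N) rate i l `^ b)).
Proof.
pose S := [set b | 0 < b /\ 1 <= phi b].
have [b0 b00 hb0] := phi_small; have [B hB] := phi_large.
have Sb0 : S b0 by split => //; exact: ltW.
have ubS : has_ubound S.
  exists B => b [_ hb]; rewrite leNgt; apply/negP => /ltW/hB.
  by rewrite ltNge hb.
have supS : b0 <= sup S by exact: ub_le_sup.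
have s0 : 0 < sup S by exact: lt_le_trans supS.
exists (sup S) => //; split => b.
  move=> sb; rewrite ltNge; apply/negP => h.
  have : S b by split => //; exact: lt_trans sb.
  by move=> /(ub_le_sup ubS); rewrite leNgt sb.
move=> b_gt0 bs; have [b' [b'0 hb'] bb'] : exists2 b', S b' & b < b'.
  by apply: sup_gt => //; exists b0.
have h0 : 0 < b' - b by rewrite subr_gt0.
have := phi_shrink b_gt0 h0; rewrite addrC subrK => h.
have ch0 : 0 < cmax `^ (b' - b) by exact: powR_gt0.
have ch1 : cmax `^ (b' - b) < 1.
  have -> : cmax = expR (ln cmax) by rewrite lnK.
  rewrite -expRM -expR0 ltr_expR pmulr_llt0 //.
  by rewrite -ln1 ltr_ln ?posrE.
rewrite -(ltr_pM2l ch0) mulr1 (lt_le_trans ch1) //.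
exact: le_trans h.
Qed.

End critical_exponent.

(** * Random labellings *)

Section labelling_space.
Context (R : realType) (k d : nat) (L : rifs R k d).
Local Notation T := (labelling L).
Local Notation N := (maxmaps L).

Definition shift (i : 'I_N) (tau : T) : T := fun v => tau (i :: v).

Definition root_label (tau : T) : label L := tau [::].

Definition graft (i : 'I_N) (x : T * T) : T := fun u =>
  if u is j :: w then if j == i then x.2 w else x.1 u else x.1 [::].

Lemma measurable_label (v : node L) :
  measurable_fun [set: T] (fun tau : T => tau v : label L).
Proof.
move=> _ B mB; rewrite setTI; apply: sub_sigma_algebra; by exists v, B.
Qed.

Lemma measurable_fun_labelling d' (X : measurableType d') (f : X -> T) :
  (forall v : node L, measurable_fun [set: X] (fun x => f x v : label L)) ->
  measurable_fun [set: X] f.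
Proof.
move=> mf; apply: (@measurability _ _ X T setT f (@cylinders _ _ _ L)) => //.
move=> _ [_ [v [B [mB ->]]] <-].
by have := mf v measurableT B mB; rewrite !setTI.
Qed.

Lemma measurable_shift i : measurable_fun [set: T] (shift i).
Proof. by apply: measurable_fun_labelling => v; exact: measurable_label. Qed.

Lemma measurable_graft i : measurable_fun [set: T * T] (graft i).
Proof.
apply: measurable_fun_labelling; case=> [|j w] /=.
  apply: (measurableT_comp (f := fun tau : T => tau [::] : label L)).
    exact: measurable_label.
  exact: measurable_fst.
case: (j == i).
  apply: (measurableT_comp (f := fun tau : T => tau w : label L)).
    exact: measurable_label.
  exact: measurable_snd.
apply: (measurableT_comp (f := fun tau : T => tau (j :: w) : label L)).
  exact: measurable_label.
exact: measurable_fst.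
Qed.

Lemma shift_graft i x : shift i (graft i x) = x.2.
Proof. by apply/funext => v; rewrite /shift /= eqxx. Qed.

(** Unlike the cylinders over one node, these form a pi-system, as uniqueness of measures requires,
    and they generate the same sigma-algebra. *)
Definition finite_cylinders : set (set T) :=
  [set C | exists (s : seq (node L)) (B : node L -> set (label L)),
    [/\ uniq s, forall v, measurable (B v) &
      C = [set tau | forall v, v \in s -> B v (tau v)]]].

Lemma measurable_finite_cylinder (s : seq (node L))
    (B : node L -> set (label L)) : (forall v, measurable (B v)) ->
  measurable [set tau : T | forall v, v \in s -> B v (tau v)].
Proof.
move=> mB; elim: s => [|u s IHs].
  rewrite (_ : [set _ | _] = setT) //; apply/seteqP; split => //.
rewrite (_ : [set _ | _] = [set tau : T | B u (tau u)] `&`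
    [set tau : T | forall v, v \in s -> B v (tau v)]).
  apply: measurableI => //.
  by have := measurable_label u measurableT (mB u); rewrite setTI.
apply/seteqP; split => tau /=.
  move=> h; split; first by apply: h; rewrite mem_head.
  by move=> v vs; apply: h; rewrite in_cons vs orbT.
by move=> [h1 h2] v; rewrite in_cons => /orP[/eqP -> //|]; exact: h2.
Qed.

Lemma setI_closed_finite_cylinders : setI_closed finite_cylinders.
Proof.
move=> _ _ [s1 [B1 [us1 mB1 ->]]] [s2 [B2 [us2 mB2 ->]]].
exists (undup (s1 ++ s2)), (fun v => (if v \in s1 then B1 v else setT) `&`
  (if v \in s2 then B2 v else setT)); split.
- exact: undup_uniq.
- by move=> v; apply: measurableI; case: ifP.
- apply/seteqP; split => tau /=.
    by move=> [h1 h2] v _; split; case: ifP => // ?; [apply: h1|apply: h2].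
  move=> h; split => v vs; have := h v.
    by rewrite mem_undup mem_cat vs /= => /(_ isT) [].
  by rewrite mem_undup mem_cat vs orbT => /(_ isT) [].
Qed.

Lemma measurable_labellingE :
  @measurable _ T = <<s finite_cylinders >>.
Proof.
apply/seteqP; split.
  apply: smallest_sub; first exact: smallest_sigma_algebra.
  move=> _ [v [B [mB ->]]]; apply: sub_sigma_algebra.
  exists [:: v], (fun=> B); split => //.
  by apply/seteqP; split => tau /= h; [move=> w; rewrite inE => /eqP ->|
    apply: h; rewrite mem_head].
apply: smallest_sub.
  exact: sigma_algebra_measurable.
by move=> _ [s [B [_ mB ->]]]; exact: measurable_finite_cylinder.
Qed.

Lemma probability_labelling_unique (P : probability T R)
    (m : {measure set T -> \bar R}) : is_product_law P ->
  (forall (s : seq (node L)) (B : node L -> set (label L)),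
    uniq s -> (forall v, measurable (B v)) ->
    m [set tau : T | forall v, v \in s -> B v (tau v)] =
      (\prod_(v <- s) law L (B v))%E) ->
  forall A, measurable A -> m A = P A.
Proof.
move=> PL mL A mA; apply/esym.
apply: (@measure_unique _ _ _ finite_cylinders (fun=> setT)) => //.
- exact: measurable_labellingE.
- exact: setI_closed_finite_cylinders.
- move=> _; exists [::], (fun=> setT); split => //.
  by apply/seteqP; split.
- by rewrite bigcup_const //; exists 0%N.
- by move=> _ [s [B [us mB ->]]]; rewrite mL //; exact: PL.
- by move=> n; rewrite (le_lt_trans (probability_le1 _ _)) // ltry.
Qed.

End labelling_space.

Section recursive_law.
Context (R : realType) (k d : nat) (L : rifs R k d).
Local Notation T := (labelling L).
Local Notation N := (maxmaps L).
Context (P : probability T R) (PL : is_product_law P).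

Lemma law_of_map d' (X : measurableType d') (m : {measure set X -> \bar R})
    (f : X -> T) : measurable_fun [set: X] f ->
  (forall (s : seq (node L)) (B : node L -> set (label L)),
    uniq s -> (forall v, measurable (B v)) ->
    m [set x | forall v, v \in s -> B v (f x v)] =
      (\prod_(v <- s) law L (B v))%E) ->
  forall A, measurable A -> m (f @^-1` A) = P A.
Proof.
move=> mf mE A mA.
have pm : isMeasurableFun _ _ _ _ f := isMeasurableFun.Build _ _ _ _ _ mf.
pose F : {mfun X >-> T} := HB.pack f pm.
by apply: (probability_labelling_unique (m := pushforward m F)).
Qed.

(** A finite cylinder pulls back to a rectangle: its nodes below [i] constrain the grafted tree, all
    others the original one. The product over [s] splits accordingly. *)
Lemma law_graft i A : measurable A ->
  (P \x P)%E (@graft _ _ _ L i @^-1` A) = P A.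
Proof.
apply: (law_of_map (m := (P \x P)%E)); first exact: measurable_graft.
move=> s B us mB.
pose below (u : node L) := if u is j :: _ then j == i else false.
pose s1 := [seq u <- s | ~~ below u].
pose s2 := [seq behead u | u <- [seq u <- s | below u]].
have belowE u : below u -> u = i :: behead u by case: u => //= j w /eqP ->.
rewrite (_ : [set _ | _] =
   [set tau : T | forall v, v \in s1 -> B v (tau v)] `*`
   [set tau : T | forall v, v \in s2 -> B (i :: v) (tau v)]); last first.
  apply/seteqP; split => -[t1 t2] /=.
    move=> h; split => v.
      rewrite mem_filter => /andP[bv vs]; move: (h _ vs) bv; rewrite /graft.
      by case: v {vs} => //= j w; case: (j == i).
    move=> /mapP[u]; rewrite mem_filter => /andP[bu us'] ->.
    by have := h _ us'; rewrite {1 2}(belowE _ bu) /= eqxx.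
  move=> [h1 h2] v vs; have [bv|bv] := boolP (below v).
    rewrite (belowE _ bv) /= eqxx; apply: h2; apply/mapP; exists v => //.
    by rewrite mem_filter bv.
  have := h1 v; rewrite mem_filter bv vs => /(_ isT).
  by case: v bv {vs} => //= j w; case: (j == i).
rewrite [LHS]product_measure1E; last 2 first.
- exact: measurable_finite_cylinder.
- exact: (@measurable_finite_cylinder _ _ _ _ _ (fun v => B (i :: v))).
transitivity ((\prod_(v <- s1) law L (B v)) *
  \prod_(v <- s2) law L (B (i :: v)))%E.
  congr (_ * _)%E; apply: PL => //; first exact: filter_uniq.
  rewrite map_inj_in_uniq ?filter_uniq // => u v.
  rewrite !mem_filter => /andP[bu _] /andP[bv _] e.
  by rewrite (belowE _ bu) e -belowE.
rewrite big_map !big_filter [RHS](bigID (fun u => ~~ below u)) /=.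
congr (_ * _)%E; apply: eq_big => u; first by rewrite negbK.
by move=> bu; rewrite -belowE.
Qed.

Lemma law_root (B : set (label L)) : measurable B ->
  P (@root_label _ _ _ L @^-1` B) = law L B.
Proof.
move=> mB; have := PL (s := [:: [::]]) (B := fun=> B) isT (fun=> mB).
rewrite big_seq1 => <-; congr (P _); apply/seteqP; split => tau /=.
  by move=> h v; rewrite inE => /eqP ->.
by move=> h; apply: h; rewrite mem_head.
Qed.

Lemma branching_labelling :
  branching (law L) P (@root_label R k d L) (@shift R k d L) (@graft R k d L).
Proof.
split=> //.
- exact: measurable_label.
- exact: measurable_shift.
- exact: measurable_graft.
- exact: law_root.
- exact: law_graft.
- exact: shift_graft.
- by move=> i j x /negbTE ji; apply/funext => v; rewrite /shift /= ji.
Qed.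

End recursive_law.

(** * The random recursive set *)

Lemma total_weight_le (R : realType) (Lab T : Type) (N : nat) (root : T -> Lab)
    (shift : 'I_N -> T -> T) (p q : 'I_N -> Lab -> R) n t :
  (forall i l, 0 <= p i l) -> (forall i l, p i l <= q i l) ->
  (forall i l, q i l <= 1) ->
  total_weight root shift p n t <= total_weight root shift q n t.
Proof.
move=> p0 pq q1; elim: n t => [|n IH] t //=; rewrite lerD2l ler_sum // => i _.
rewrite ler_pM //; apply: total_weight_ge0 => j l.
by rewrite p0 (le_trans (pq _ _)).
Qed.

Lemma weight_percolation (R : realType) (Lab T : Type) (N : nat) (root : T -> Lab)
    (shift : 'I_N -> T -> T) (rate : 'I_N -> Lab -> R) t v :
  (forall i l, 0 <= rate i l) -> 0 < weight root shift rate t v ->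
  0 < percolation root shift (fun i l => (0 < rate i l)%R%:R : R) (size v) t.
Proof.
move=> rate0; elim: v t => [|i v IH] t //= .
have := rate0 i (root t); rewrite le_eqVlt => /predU1P[<-|ri].
  by rewrite mul0r ltxx.
rewrite pmulr_rgt0 // => /IH h; apply: lt_le_trans h _.
have q01 j l : 0 <= ((0 < rate j l)%R%:R : R) <= 1.
  by case: (0 < rate j l); rewrite ?lexx ?ler01.
apply: le_trans (percolation_ge_child root shift q01 (size v) i t).
by rewrite ri mul1r.
Qed.

Section random_set_attractor.
Context (R : realType) (k d : nat) (L : rifs R k d).
Context (c : label L -> 'I_(maxmaps L) -> R) (cmin cmax : R).
Context (cmin0 : 0 < cmin) (cmin_le : cmin <= cmax) (cmax1 : cmax < 1).
Context (c_similarity : forall (l : label L) (i : 'I_(maxmaps L)),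
  index_val l <> 0 -> (i < nmaps l)%N ->
  similarity (c l i) (rifs_map l i) /\ cmin <= c l i <= cmax).

Definition rifs_rate (i : 'I_(maxmaps L)) (l : label L) : R :=
  if (i < nmaps l)%N then c l i else 0.

Let index_neq0 (l : label L) (i : 'I_(maxmaps L)) : (i < nmaps l)%N ->
  index_val l <> 0.
Proof. by move=> + /nmaps_eq0 e; rewrite e. Qed.

Lemma rifs_rate_dich i l :
  rifs_rate i l = 0 \/ cmin <= rifs_rate i l <= cmax.
Proof.
rewrite /rifs_rate; case: ifPn => il; last by left.
by right; have [] := c_similarity (index_neq0 il) il.
Qed.

Lemma rifs_rate_gt0 i l : (0 < rifs_rate i l) = (i < nmaps l)%N.
Proof.
rewrite /rifs_rate; case: ifPn => il; last by rewrite ltxx.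
have [_ /andP[h _]] := c_similarity (index_neq0 il) il.
by rewrite (lt_le_trans cmin0).
Qed.

Lemma rifs_rate_similarity i l : 0 < rifs_rate i l ->
  similarity (rifs_rate i l) (rifs_map l i).
Proof.
rewrite rifs_rate_gt0 => il; rewrite /rifs_rate il.
by have [] := c_similarity (index_neq0 il) il.
Qed.

Lemma sum_rifs_rate_gt0 l :
  \sum_(i < maxmaps L) ((0 < rifs_rate i l)%R%:R : R) = (nmaps l)%:R.
Proof.
under eq_bigr do rewrite rifs_rate_gt0.
rewrite -natr_sum; congr (_%:R).
rewrite -[RHS]card_ord -sum1_card (big_ord_widen _ (fun=> 1%N) (nmaps_le l)).
by rewrite [RHS]big_mkcond; apply: eq_bigr => i _; case: ifP.
Qed.

(** Measurability is assumed of the maps, not of [c]. In positive dimension the rate is recovered as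
    the distance between the images of 0 and of a unit vector. *)
Lemma measurable_rifs_rate i : (0 < d)%N -> measurable_fun setT (rifs_rate i).
Proof.
move=> d0; pose e : 'rV[R]_d := delta_mx 0 (Ordinal d0).
have e1 : enorm e = 1.
  rewrite /enorm (bigD1 (Ordinal d0)) //= big1 ?addr0 => [|j j0].
    by rewrite mxE !eqxx expr1n sqrtr1.
  by rewrite mxE (negbTE j0) andbF expr0n.
have mi : measurable_fun setT (fun l : label L => (i < nmaps l)%N).
  apply: (measurableT_comp (f := fun n => (i < n)%N)) => //.
  exact: nmaps_measurable.
pose g l := Num.sqrt (\sum_(j < d)
  (rifs_map l i e 0 j - rifs_map l i 0 0 j) ^+ 2).
have -> : rifs_rate i = fun l => if (i < nmaps l)%N then g l else 0.
  apply/funext => l; rewrite /rifs_rate; case: ifPn => // il.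
  have [/(_ e 0) h _] := c_similarity (index_neq0 il) il.
  move: h; rewrite subr0 e1 mulr1 => <-; congr Num.sqrt.
  by apply: eq_bigr => j _; rewrite !mxE.
apply: measurable_fun_if => //.
have -> : setT `&` (fun l : label L => (i < nmaps l)%N) @^-1` [set true] =
    [set l : label L | (i < nmaps l)%N] by rewrite setTI.
have mcoord (x : 'rV[R]_d) j : measurable_fun [set l : label L | (i < nmaps l)%N]
    (fun l => rifs_map l i x 0 j).
  have mc : measurable_fun setT (fun y : borel 'rV[R]_d => (y : 'rV[R]_d) 0 j).
    apply: (measurability _ (RGenOpens.measurableE R)) => _ [_ [a [b ->] <-]].
    rewrite setTI; apply: sub_sigma_algebra.
    have /continuousP h := @coord_continuous R 1 d 0 j.
    by apply: h; exact: interval_open.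
  exact: (measurableT_comp mc (@rifs_map_measurable _ _ _ L i x)).
apply: measurableT_comp.
  by apply: continuous_measurable_fun; exact: sqrt_continuous.
apply: measurable_sum => j; apply: measurable_funX.
by apply: measurable_funB; exact: mcoord.
Qed.

Local Notation root := (@root_label R k d L).
Local Notation sh := (@shift R k d L).
Local Notation weight := (weight root sh rifs_rate).

(** [node_map_from] keeps the tree and extends the current node, whereas [branch_map] passes to the
    shifted tree; generalising over the current node reconciles the two. *)
Lemma node_map_cons (tau : labelling L) i v :
  node_map tau (i :: v) = rifs_map (root tau) i \o node_map (shift i tau) v.
Proof.
rewrite /node_map /=; congr (_ \o _).
suff h u : node_map_from tau (i :: u) v = node_map_from (shift i tau) u v by exact: h.
by elim: v u => //= j v IH u; rewrite IH.
Qed.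

Lemma node_mapE tau v : node_map tau v = branch_map root sh (@rifs_map _ _ _ L) tau v.
Proof. by elim: v tau => [|i v IH] tau //; rewrite node_map_cons IH. Qed.

Lemma admissibleP tau v : admissible tau v <-> 0 < weight tau v.
Proof.
elim: v tau => [|i v IH] tau.
  by split => // _ u i; rewrite prefixs0 -size_eq0 size_rcons.
have rate0 := rate_ge0 cmin0 rifs_rate_dich.
have cons_adm : admissible tau (i :: v) <->
    (i < nmaps (root tau))%N /\ admissible (shift i tau) v.
  split=> [h|[h1 h2] [|j u] l].
  - split; first by apply: (h [::] i); rewrite /= eqxx prefix0s.
    by move=> u j uv; apply: (h (i :: u) j); rewrite /= eqxx.
  - by rewrite /= => /andP[/eqP -> _].
  - by rewrite /= => /andP[/eqP -> /h2].
rewrite cons_adm IH /= -rifs_rate_gt0; split.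
  by move=> [h1 h2]; rewrite mulr_gt0.
have := rate0 i (root tau); rewrite le_eqVlt => /predU1P[<-|ri].
  by rewrite mul0r ltxx.
by rewrite pmulr_rgt0.
Qed.

Lemma random_setE (Delta : set 'rV[R]_d) tau : trapping L Delta ->
  random_set Delta tau = attractor root sh rifs_rate (@rifs_map _ _ _ L) Delta tau.
Proof.
move=> [_ _ trap].
have levelE n : (\bigcup_(v in [set v : node L | size v = n /\ admissible tau v])
    (node_map tau v @` Delta)) =
    level root sh rifs_rate (@rifs_map _ _ _ L) Delta n tau.
  apply/seteqP; split => x.
    by move=> [v [vn /admissibleP v0]]; rewrite node_mapE => h; exists v.
  move=> [v [vn v0 h]]; exists v; last by rewrite node_mapE.
  by split => //; exact/admissibleP.
apply/seteqP; split => x h n _.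
  have trap' i l : 0 < rifs_rate i l -> rifs_map l i @` Delta `<=` Delta.
    by rewrite rifs_rate_gt0; exact: trap.
  apply: (level_decreasing cmin0 rifs_rate_dich trap' (leqnSn n)).
  by rewrite -levelE; exact: h.
by rewrite levelE; exact: h.
Qed.

End random_set_attractor.

Lemma is_box_dim_set0 (R : realType) (d : nat) (theta : R) :
  is_box_dim (set0 : set 'rV[R]_d) (assouad_spectrum theta (set0 : set 'rV[R]_d)).
Proof.
split; last by move=> [].
move=> _; apply/eqP; rewrite eq_le; apply/andP; split.
  apply: ereal_inf_lbound; exists 0 => //; split => //; exists 1 => //.
  move=> r rho _ rho0 _ rhoE; exfalso.
  have ediam0 : (ediam (set0 : set 'rV[R]_d) <= 0%:E)%E by exact/ediam_leP.
  by have := le_trans rhoE ediam0; rewrite lee_fin leNgt rho0.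
by apply: le_ereal_inf_tmp => _ [a [a0 _] <-]; rewrite lee_fin.
Qed.

(** In dimension 0 the space is a point, so all images of the open set meet. A mean offspring above
    1 therefore forces [0 < d]. *)
Lemma nmaps_le1_dim0 (R : realType) (k d : nat) (L : rifs R k d) (l : label L) :
  uosc L -> d = 0%N -> (nmaps l <= 1)%N.
Proof.
move=> [U [[a Ua] _ _ hU]] d0; rewrite leqNgt; apply/negP => l2.
have lN : (1 < maxmaps L)%N := leq_trans l2 (nmaps_le l).
pose i := Ordinal (ltnW lN : (0 < maxmaps L)%N); pose j := Ordinal lN.
have l0 : index_val l <> 0 by move=> /nmaps_eq0 e; move: l2; rewrite e.
have [_ h] := hU l l0 i j (ltnW l2) l2.
suff : i = j by move/(congr1 val).
apply: h; exists (rifs_map l i a); split; exists a => //.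
by subst d; rewrite !thinmx0.
Qed.

Theorem corollary2p7 (R : realType) (k d : nat) (L : rifs R k d)
    (c : label L -> 'I_(maxmaps L) -> R) (cmin cmax : R)
    (Delta : set 'rV[R]_d) (P : probability (labelling L) R) :
  non_extinguishing L ->
  uosc L ->
  0 < cmin -> cmin <= cmax -> cmax < 1 ->
  (forall (l : label L) (i : 'I_(maxmaps L)),
     index_val l <> 0 -> (i < nmaps l)%N ->
     similarity (c l i) (rifs_map l i) /\ cmin <= c l i <= cmax) ->
  trapping L Delta ->
  is_product_law P ->
  forall theta : R, 0 < theta < 1 ->
  {ae P, forall tau : labelling L,
     is_box_dim (random_set Delta tau)
       (assouad_spectrum theta (random_set Delta tau))}.
Proof.
move=> mean_gt1 osc cmin0 cmin_le cmax1 sim trap PL theta theta01.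
have cmax0 : 0 < cmax by exact: lt_le_trans cmin_le.
pose rate := rifs_rate c.
have dich : forall i l, rate i l = 0 \/ cmin <= rate i l <= cmax.
  exact: rifs_rate_dich sim.
have rate_pos i l : (0 < rate i l) = (i < nmaps l)%N.
  exact: (rifs_rate_gt0 cmin0 sim).
have bn : bounded_measurable (fun l : label L => (nmaps l)%:R : R).
  have mnat : measurable_fun [set: nat] (fun n => n%:R : R) by [].
  split; first exact: (measurableT_comp mnat (@nmaps_measurable _ _ _ L)).
  by exists (maxmaps L)%:R => l; rewrite ger0_norm // ler_nat nmaps_le.
have mean_n : 1 < \int[law L]_l ((nmaps l)%:R : R).
  by rewrite -lte_fin -EFin_Rintegral.
have d0 : (0 < d)%N.
  rewrite lt0n; apply/negP => /eqP d0; move: mean_n; rewrite ltNge => /negP; apply.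
  rewrite -[leRHS](Rintegral_prob_cst (law L) 1).
  apply: le_Rintegral_bounded => //; first exact: bounded_measurable_cst.
  by move=> l; rewrite (ler_nat _ _ 1) (nmaps_le1_dim0 _ osc).
have mrate i : measurable_fun setT (rate i) by exact: (measurable_rifs_rate sim).
have mean : 1 < \int[law L]_l (\sum_(i < maxmaps L) ((0 < rate i l)%R%:R : R)).
  apply: (lt_le_trans mean_n); rewrite le_eqVlt; apply/orP; left; apply/eqP.
  by apply: eq_Rintegral => l _; rewrite (sum_rifs_rate_gt0 cmin0 sim).
have [s s0 [hi lo]] :=
  critical_exponent_exists mrate cmin0 cmin_le cmax1 dich mean.
have br := branching_labelling PL.
have p01 b : 0 < b -> forall i l, 0 <= rate i l `^ b <= 1.
  exact: (rate_powR01 cmin0 cmax1 dich).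
have mp b i : measurable_fun setT (fun l => rate i l `^ b).
  exact: (measurable_rate_powR mrate).
have powR_le a b i l : 0 < a -> a <= b -> rate i l `^ b <= rate i l `^ a.
  move=> a0 ab; have b0 : 0 < b by exact: lt_le_trans ab.
  have [->|/andP[h1 h2]] := dich i l; first by rewrite !powR0 ?gt_eqF.
  have r0 : 0 < rate i l by exact: lt_le_trans h1.
  rewrite /powR gt_eqF // ler_expR ler_wnM2r // -ln1 ler_ln ?posrE //.
  exact: le_trans h2 (ltW cmax1).
have pos_powR b : 0 < b -> (fun i l => (0 < rate i l `^ b)%R%:R : R) =
    (fun i l => (0 < rate i l)%R%:R).
  move=> b0; apply/funext => i; apply/funext => l.
  have [->|/andP[h1 _]] := dich i l; first by rewrite powR0 ?gt_eqF.
  have r0 : 0 < rate i l by exact: lt_le_trans h1.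
  by rewrite powR_gt0 // r0.
pose root := @root_label R k d L; pose sh := @shift R k d L.
(* Only countably many exponents tending to [s] are treated almost surely; monotonicity in the
   exponent supplies the others tree by tree. *)
have growth : {ae P, forall t, forall j : nat, exists A C : R, 0 <= A /\
    forall v n, total_weight root sh (fun i l => rate i l `^ (s + j.+1%:R^-1)) n
      (subtree sh t v) <= C + A * (size v)%:R}.
  apply/ae_foralln => j.
  have sj : s < s + j.+1%:R^-1 by rewrite ltrDl invr_gt0 ltr0n.
  have [A [A0 hA]] := total_weight_ae_growth br (mp _) (p01 _ (lt_trans s0 sj)) (hi _ sj).
  by apply: filterS hA => t [C hC]; exists A, C.
(* The offset [j.+2] keeps the exponent strictly between 0 and [s], also for [j = 0]. *)
have survive : {ae P, forall t, forall j : nat,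
    (forall n, 0 < percolation root sh (fun i l => (0 < rate i l)%R%:R : R) n t) ->
    0 < percolation_lim root sh (fun i l => rate i l `^ (s * (1 - j.+2%:R^-1))) t}.
  apply/ae_foralln => j; set b := s * _.
  have j0 : 0 < j.+2%:R^-1 :> R by rewrite invr_gt0 ltr0n.
  have j1 : j.+2%:R^-1 < 1 :> R by rewrite invf_lt1 ?ltr0n // ltr1n.
  have b0 : 0 < b by rewrite mulr_gt0 // subr_gt0.
  have bs : b < s by rewrite gtr_pMr // gtrBl.
  have := survival_percolates br (mp b) (p01 b b0) (lo b b0 bs).
  rewrite pos_powR //; apply; apply: (lt_le_trans mean).
  rewrite le_eqVlt; apply/orP; left; apply/eqP.
  apply: eq_Rintegral => l _; apply: eq_bigr => i _.
  by have /(congr1 (fun f => f i l)) /= -> := pos_powR b b0.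
have [[_ Dc Dtrap] [U [[a Ua] _ Uo osc']]] := (trap, osc).
have idx (l : label L) (i : 'I_(maxmaps L)) : (i < nmaps l)%N -> index_val l <> 0.
  by move=> + /nmaps_eq0 e; rewrite e.
have [D D1 hD] : exists2 D : R, 1 <= D &
    forall z z', Delta z -> Delta z' -> enorm (z - z') <= D.
  have [B [_ hB]] := compact_bounded Dc.
  have := hB (`|B| + 1) _; rewrite ltr_pwDr ?ler_norm // => /(_ isT) {}hB.
  exists (d%:R * (`|B| + 1 + (`|B| + 1)) + 1).
    by rewrite lerDr mulr_ge0 // !addr_ge0.
  move=> z z' Dz Dz'; apply: le_trans (enorm_le_norm _) _.
  rewrite -[leLHS]addr0 lerD // ler_wpM2l // (le_trans (ler_normB _ _)) //.
  by rewrite lerD //; exact: hB.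
apply: filterS2 growth survive => tau growth survive.
rewrite (random_setE cmin0 sim tau trap) -/rate -/root -/sh.
set F := attractor _ _ _ _ _ _.
(* A tree with empty attractor is settled by convention. A point of the attractor provides nodes of
   positive weight at every level, which is the survival demanded by [survive]. *)
have [F0|/set0P/negP/negPn/eqP ->] := pselect (F !=set0); last first.
  exact: is_box_dim_set0.
have rate0 := rate_ge0 cmin0 dich.
have alive n : 0 < percolation root sh (fun i l => (0 < rate i l)%R%:R : R) n tau.
  have [x /(_ n Logic.I)[v [<- v0 _]]] := F0.
  exact: weight_percolation.
have Dne : Delta !=set0 by have [x /(_ 0%N Logic.I)[v [_ _ [z Dz _]]]] := F0; exists z.
apply: (@attractor_dimension R d (label L) (labelling L) (maxmaps L) root sh rate
  (@rifs_map _ _ _ L) Delta cmin cmax cmin0 cmax1 dich _ Dc _ U Uo a Ua _ _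
  cmax0 D D1 hD Dne tau s theta s0 theta01) => //.
- by move=> i l; exact: (rifs_rate_similarity cmin0 sim).
- by move=> i l; rewrite rate_pos; exact: Dtrap.
- move=> i l; rewrite rate_pos => il.
  by have [] := osc' l (idx l i il) i i il il.
- move=> i j l; rewrite !rate_pos => il jl.
  by have [_] := osc' l (idx l i il) i j il jl; apply.
- move=> b sb.
  have bs0 : 0 <= (b - s)^-1 by rewrite invr_ge0 subr_ge0 ltW.
  have hj := archi_boundP bs0; set j := Num.bound _ in hj.
  have [A [C [A0 hC]]] := growth j.
  have j0 : 0 < j.+1%:R :> R by rewrite ltr0n.
  have a0 : 0 < s + j.+1%:R^-1 by rewrite addr_gt0 // invr_gt0.
  have ab : s + j.+1%:R^-1 <= b.
    rewrite -lerBrDl -[leRHS]invrK lef_pV2 ?posrE ?invr_gt0 ?subr_gt0 //.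
    by rewrite (le_trans (ltW hj)) // ler_nat.
  exists A, C; split => // v n; apply: le_trans (hC v n).
  apply: total_weight_le => i l; first by case/andP: (p01 b (lt_trans s0 sb) i l).
    exact: powR_le.
  by case/andP: (p01 _ a0 i l).
- move=> b b0 bs.
  have h0 : 0 < 1 - b / s by rewrite subr_gt0 ltr_pdivrMr // mul1r.
  have hj := archi_boundP (ltW (_ : 0 < (1 - b / s)^-1)); rewrite invr_gt0 in hj.
  move: (hj h0) => {}hj; set j := Num.bound _ in hj.
  have j0 : 0 < j.+2%:R^-1 :> R by rewrite invr_gt0 ltr0n.
  have j1 : j.+2%:R^-1 < 1 :> R by rewrite invf_lt1 ?ltr0n // ltr1n.
  set b' := s * (1 - j.+2%:R^-1).
  have b'0 : 0 < b' by rewrite mulr_gt0 // subr_gt0.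
  have bb' : b <= b'.
    rewrite /b' mulrC -ler_pdivrMr // lerBrDl -lerBrDr.
    rewrite -[leRHS]invrK lef_pV2 ?posrE ?invr_gt0 ?ltr0n //.
    by rewrite (le_trans (ltW hj)) // ler_nat -addn2 leq_addr.
  apply: lt_le_trans (survive j alive) _.
  apply: (percolation_lim_ge (p01 b b0)) => n.
  apply: le_trans (percolation_lim_le root sh (p01 b' b'0) n tau) _.
  apply: percolation_le => i l; first by case/andP: (p01 b' b'0 i l).
    exact: powR_le.
  by case/andP: (p01 b b0 i l).
Qed.
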